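(* Let $k,b$ be positive integers such that either $k\ge 4$, or $k=3$ and $b\ge 2$. Let $H$ be a graph for which there exists a subgraph $H'\subseteq H$ with $d_1(H')=m_1(H)$ and either $H'=K_k$ or $H'=C_k$. Then there exist constants $c,C>0$ such that, for $G\sim G(n,p)$, $$\lim_{n\to\infty}\Pr\left[G \text{ is Maker's win in the } (1:b) \text{ Maker-Breaker vertex } H\text{-game}\right]=\begin{cases}1 & p\ge Cn^{-1/m_1(H)},\\ 0 & p\le cn^{-1/m_1(H)}.\end{cases}$$
   Context: For a graph $F$, $v(F)=|V(F)|$, $e(F)=|E(F)|$. For a graph $F$ with $v(F)\ge 2$, the 1-density is $d_1(F)=\frac{e(F)}{v(F)-1}$, and the maximum 1-density is $m_1(F)=\max\{d_1(F')\,:\,F'\subseteq F,\ v(F')\ge 2\}$. $G(n,p)$ is the binomial random graph on $n$ vertices, each edge present independently with probability $p$. For graphs $G,H$ and a positive integer $b$, the $(1:b)$ Maker-Breaker vertex $H$-game on $G$ is played as follows: Maker and Breaker alternately claim previously unclaimed vertices of $G$, Maker claiming one vertex per turn and Breaker claiming $b$ vertices per turn (the last player may claim fewer if not enough free vertices remain), until all vertices are claimed. Maker wins if the subgraph of $G$ induced by the set of vertices he claimed contains a (not necessarily induced) copy of $H$; otherwise Breaker wins. ''$G$ is Maker's win'' means Maker has a winning strategy (the statement holds with either player moving first). *)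

(* Defs.v *)
From mathcomp Require Import all_boot.
From Stdlib Require Import Reals.

Set Implicit Arguments.
Unset Strict Implicit.
Unset Printing Implicit Defensive.

Definition pairs (n : nat) : {set {set 'I_n}} := [set e : {set 'I_n} | #|e| == 2].
Definition simple_graph (n : nat) (E : {set {set 'I_n}}) : bool := E \subset pairs n.

Definition contains_copy (h : nat) (EH : {set {set 'I_h}}) (n : nat)
    (EG : {set {set 'I_n}}) (M : {set 'I_n}) : bool :=
  [exists f : {ffun 'I_h -> 'I_n},
     [&& injectiveb f, [forall x, f x \in M] & [forall e in EH, (f @: e) \in EG]]].

Fixpoint maker_wins_from (h : nat) (EH : {set {set 'I_h}}) (n : nat)
    (EG : {set {set 'I_n}}) (b : nat) (fuel : nat) (M B : {set 'I_n})
    (maker_turn : bool) {struct fuel} : bool :=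
  let F := ~: (M :|: B) in
  match fuel with
  | 0 => contains_copy EH EG M
  | f.+1 =>
      if F == set0 then contains_copy EH EG M else
      if maker_turn then
        [exists v in F, maker_wins_from EH EG b f (v |: M) B false]
      else
        [forall S : {set 'I_n},
           ((S \subset F) && (#|S| == minn b #|F|)) ==>
           maker_wins_from EH EG b f M (B :|: S) true]
  end.

(* G is Maker's win (fuel n suffices: each move claims at least one vertex). *)
Definition makers_win (h : nat) (EH : {set {set 'I_h}}) (n : nat)
    (EG : {set {set 'I_n}}) (b : nat) (maker_first : bool) : bool :=
  maker_wins_from EH EG b n set0 set0 maker_first.

Definition prob_gnp (n : nat) (p : R) (P : {set {set 'I_n}} -> bool) : R :=
  foldr Rplus 0%R
    (map (fun E : {set {set 'I_n}} =>
            if P E then Rmult (pow p #|E|) (pow (Rminus 1 p) (subn #|pairs n| #|E|)) else 0%R)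
         (enum [set E : {set {set 'I_n} } | E \subset pairs n])).

Definition is_subgraph (h : nat) (EH : {set {set 'I_h}}) (V : {set 'I_h})
    (E : {set {set 'I_h}}) : bool :=
  (E \subset EH) && [forall e in E, e \subset V].

Definition one_density (h : nat) (V : {set 'I_h}) (E : {set {set 'I_h}}) : R :=
  (INR #|E| / INR (subn #|V| 1))%R.

(* m_1(H) = max of d_1(F') over subgraphs F' with v(F') >= 2 (all are >= 0). *)
Definition max_one_density (h : nat) (EH : {set {set 'I_h}}) : R :=
  foldr Rmax 0%R
    (map (fun VE : {set 'I_h} * {set {set 'I_h}} => one_density VE.1 VE.2)
         (enum [set VE : {set 'I_h} * {set {set 'I_h}} |
                  is_subgraph EH VE.1 VE.2 && (1 < #|VE.1|)])).

Definition clique_edges (k : nat) : {set {set 'I_k}} := pairs k.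
Definition cycle_edges (k : nat) : {set {set 'I_k}} :=
  [set [set i; ordS i] | i : 'I_k].

Definition iso_to (h k : nat) (Ek : {set {set 'I_k}}) (V : {set 'I_h})
    (E : {set {set 'I_h}}) : bool :=
  [exists f : {ffun 'I_k -> 'I_h},
     [&& injectiveb f, V == f @: setT & E == [set f @: (e : {set 'I_k}) | e in Ek]]].

Definition is_Kk (h k : nat) V E := @iso_to h k (clique_edges k) V E.
Definition is_Ck (h k : nat) V E := @iso_to h k (cycle_edges k) V E.

(* Main.v *)
Require Import Defs.
From Stdlib Require Import Classical_Prop Classical_Pred_Type Reals Lra.
From mathcomp Require Import all_boot all_order all_algebra zify Rstruct.
From mathcomp Require ring lra.

(** Write [K] for the clique or cycle attaining [m_1(H)]; it has [k] vertices and [q] edges, so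
    [1/m_1(H) = (k-1)/q].

    Breaker's side: if some graph [P] of maximum degree at most [b] on the vertices of [G] meets
    every copy of [K] in an edge, then Breaker wins by always claiming all free [P]-neighbours of
    Maker's last vertex.  Call [G] critical if no such [P] exists for [G] but one exists for every
    proper subgraph.  A discharging argument shows that a critical graph is a connected union of
    copies of [K] with [q v < (k-1) e]; here [b = 1] suffices for [k >= 4], and [b = 2] for [k = 3].
    Exploring such a union copy by copy, the explored part either becomes too dense or reaches
    more than [log n] edges, and a first moment bound shows that with high probability neither
    happens for [p <= c n^(-(k-1)/q)].

    Maker's side: whatever Breaker does, Maker claims about [n/(b+1)] vertices.  By Janson's
    inequality a fixed set of this size spans no copy of [H] with probability at most [exp(-2n)]
    once [p >= C n^(-1/m_1(H))], and a union bound over all [2^n] sets finishes the proof. *)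

Set Implicit Arguments.
Unset Strict Implicit.
Unset Printing Implicit Defensive.

(** * Pairings and critical graphs *)

(** Strictness is what shapes the structural part. For [p = c n^(-(k-1)/q)] a fixed union with [v]
    vertices and [e] edges has expected number about [c^e n^(v - e(k-1)/q)]: constant order if
    [q v = (k-1) e], but at most of order [n^(-1/q)] once [q v < (k-1) e], since these are integers.
    Discharging alone yields only the weak inequality, so each of the four cases (long cycles,
    four-cycles, large cliques, triangles) also has to analyse the graphs in which every vertex is
    tight, and to refute them by explicit local pairings.

    The unions have no bounded size, so a union bound over finitely many isomorphism types is not
    enough: the gain [n^(-1/q)] must absorb the choices made in up to [log n] attachments. A copy
    meeting the explored part in one vertex has boundedly many ways to attach and is paid for by a
    small constant. Any other copy may cost a polylogarithmic factor, but raises [(k-1) e - q v] by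
    at least one; as this starts at [-q] and the exploration stops once it is positive, that factor
    is spent only boundedly often. *)

Section Adjacency.
Variables (n : nat) (E : {set {set 'I_n}}).

Definition adj (u v : 'I_n) : bool := [set u; v] \in E.
Definition nbh (u : 'I_n) : {set 'I_n} := [set v | adj u v].

Lemma adjC u v : adj u v = adj v u.
Proof. by rewrite /adj setUC. Qed.

Lemma in_nbh u v : (v \in nbh u) = adj u v.
Proof. by rewrite inE. Qed.

Hypothesis sE : E \subset pairs n.

Lemma card_edge e : e \in E -> #|e| = 2.
Proof. by move/(subsetP sE); rewrite inE => /eqP. Qed.

Lemma adj_neq u v : adj u v -> u != v.
Proof. by move/card_edge; rewrite cards2; case: eqP. Qed.

Lemma adjxx u : adj u u = false.
Proof. by apply/negP => /adj_neq; rewrite eqxx. Qed.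

Lemma edge_other e u : e \in E -> u \in e -> exists2 v, e = [set u; v] & u != v.
Proof.
move=> eE ue; have /cards2P [a [b [nab eab]]] : #|e| == 2 by rewrite card_edge.
move: ue; rewrite eab !inE => /orP [] /eqP ->; first by exists b.
by exists a; rewrite 1?setUC // eq_sym.
Qed.

Lemma in_cover_nbh u : (u \in cover E) = (0 < #|nbh u|).
Proof.
apply/bigcupP/card_gt0P => [[e eE ue]|[v]].
  by have [v ev _] := edge_other eE ue; exists v; rewrite in_nbh /adj -ev.
by rewrite in_nbh => uv; exists [set u; v]; rewrite ?set21.
Qed.

Lemma adj_cover u v : adj u v -> u \in cover E.
Proof. by move=> uv; apply/bigcupP; exists [set u; v]; rewrite ?set21. Qed.

Lemma card_nbh u : #|nbh u| = #|[set e in E | u \in e]|.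
Proof.
rewrite -(card_in_imset (f := fun v => [set u; v])).
  apply: eq_card => e; rewrite !inE; apply/imsetP/andP => [[v]|[eE ue]].
    by rewrite in_nbh => uv ->; rewrite set21.
  by have [v ev _] := edge_other eE ue; exists v; rewrite ?in_nbh /adj -?ev.
move=> v w; rewrite !in_nbh => uv uw /setP eq.
have := eq v; rewrite !inE eqxx orbT => /esym /orP [] /eqP // vu.
by move: (adj_neq uv); rewrite vu eqxx.
Qed.

Lemma handshake : \sum_(v in cover E) #|nbh v| = 2 * #|E|.
Proof.
have -> : \sum_(v in cover E) #|nbh v| = \sum_v #|nbh v|.
  rewrite [RHS](bigID (mem (cover E))) /= [X in _ = _ + X]big1 ?addn0 // => v.
  by rewrite in_cover_nbh -eqn0Ngt => /eqP.
under eq_bigr => v _ do rewrite card_nbh -sum1dep_card.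
rewrite (exchange_big_dep (mem E)) /=; last by move=> v e _ /andP[].
rewrite mulnC -sum_nat_const; apply: eq_bigr => e eE.
by rewrite sum1dep_card -(card_edge eE); apply: eq_card => v; rewrite inE eE.
Qed.

End Adjacency.

(* Double counting of the transfers [tr]; a tight total forces every vertex to be tight. *)
Lemma discharging n (V : {set 'I_n}) (a b : 'I_n -> nat) (tr : rel 'I_n) :
    (forall u v, tr u v -> (u \in V) && (v \in V)) ->
    {in V, forall v, a v + #|[set u | tr u v]| <= b v + #|[set u | tr v u]|} ->
    \sum_(v in V) a v < \sum_(v in V) b v \/
    {in V, forall v, a v + #|[set u | tr u v]| = b v + #|[set u | tr v u]|}.
Proof.
move=> trV le.
have eqtr : \sum_(v in V) #|[set u | tr u v]| = \sum_(v in V) #|[set u | tr v u]|.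
  under eq_bigr => v _ do rewrite -sum1dep_card.
  under [RHS]eq_bigr => v _ do rewrite -sum1dep_card.
  rewrite (exchange_big_dep (mem V)) /= => [|v u _ /trV /andP[] //].
  apply: eq_bigr => u uV; apply: eq_bigl => v.
  by case: (boolP (tr u v)) => [/trV /andP[_ ->]|]; rewrite ?andbF.
have := leqif_sum (P := mem V) (fun v vV => conj (le v vV) (erefl _)).
rewrite !big_split /= eqtr => -[le_sum /esym eq_sum].
have [lt|ge] := ltnP (\sum_(v in V) a v) (\sum_(v in V) b v); first by left.
have /forall_inP tight : [forall (v | v \in V),
    a v + #|[set u | tr u v]| == b v + #|[set u | tr v u]|].
  by rewrite eq_sum eqn_leq le_sum leq_add2r.
by right => v vV; apply/eqP/tight.
Qed.

Section Pairable.
(** [C E S] is to be read as: [S] is the vertex set of a copy inside [E]. It is abstract because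
    cliques use a predicate on vertex sets and cycles one on embeddings. *)
Variables (n b : nat) (C : {set {set 'I_n}} -> {set 'I_n} -> bool).
Implicit Types (E : {set {set 'I_n}}) (S X : {set 'I_n}) (P : rel 'I_n).

Definition hits P S : bool := [exists u in S, exists v in S, P u v].

Lemma hitsP P S : reflect (exists u v, [/\ u \in S, v \in S & P u v]) (hits P S).
Proof.
apply: (iffP exists_inP) => [[u uS /exists_inP [v vS Puv]]|[u [v [uS vS Puv]]]].
  by exists u, v.
by exists u => //; apply/exists_inP; exists v.
Qed.

(* Breaker answers every vertex of Maker by its [P]-neighbours. *)
Definition pairing P E : Prop :=
  [/\ symmetric P, irreflexive P, forall v, #|[set u | P v u]| <= b &
      forall S, C E S -> hits P S].

Definition pairable E : Prop := exists P, pairing P E.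

Definition critical E : Prop :=
  ~ pairable E /\ forall E' : {set {set 'I_n}}, E' \proper E -> pairable E'.

Definition avoiding X E : {set {set 'I_n}} := [set e in E | [disjoint e & X]].

Hypothesis C_mono : forall (E E' : {set {set 'I_n}}) S, E \subset E' -> C E S -> C E' S.
Hypothesis C_local : forall E S, C E S -> C [set e in E | e \subset S] S.

Lemma exists_critical E : ~ pairable E -> exists2 E' : {set {set 'I_n}}, E' \subset E & critical E'.
Proof.
elim: {E}_.+1 {-2}E (ltnSn #|E|) => // m IH E ltEm npE.
case: (classic (forall E' : {set {set 'I_n}}, E' \proper E -> pairable E')).
  by exists E.
case/not_all_ex_not => E' nE'; have [pE' npE'] := imply_to_and _ _ nE'.
have [|E2 sE2 cE2] := IH E' _ npE'; first by rewrite (leq_trans (proper_card pE')).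
by exists E2 => //; apply: subset_trans sE2 (proper_sub pE').
Qed.

Variable E : {set {set 'I_n}}.
Hypothesis sE : E \subset pairs n.

Lemma C_avoiding S X : C E S -> [disjoint S & X] -> C (avoiding X E) S.
Proof.
move=> CS dSX; apply: C_mono (C_local CS); apply/subsetP => e.
by rewrite !inE => /andP[-> /disjointWl ->].
Qed.

Hypothesis crE : critical E.

Lemma critical_exists : exists S, C E S.
Proof.
apply: NNPP => no; apply: crE.1; exists (fun _ _ => false); split=> // [v|S CS].
  by rewrite (eq_card (B := pred0)) ?card0 // => u; rewrite !inE.
by case: no; exists S.
Qed.

(** If no copy contained both ends, removing the edge would destroy no copy, and the pairing of the
    smaller graph would already serve [E]. *)
Lemma critical_edge u v : adj E u v -> exists S, [/\ C E S, u \in S & v \in S].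
Proof.
move=> uv; have [P [sP iP dP hP]] := crE.2 _ (properD1 uv).
have /not_all_ex_not [S nS] : ~ forall S, C E S -> hits P S.
  by move=> hP'; apply: crE.1; exists P.
have [CS nhS] := imply_to_and _ _ nS.
have [/subsetP uvS|nuvS] := boolP ([set u; v] \subset S).
  by exists S; split=> //; apply: uvS; rewrite ?set21 ?set22.
case: nhS; apply/hP/C_mono/C_local/CS.
apply/subsetP => e; rewrite !inE => /andP[-> eS]; rewrite andbT.
by apply: contraNneq nuvS => <-.
Qed.

Lemma avoiding_proper X x : x \in X -> x \in cover E -> avoiding X E \proper E.
Proof.
move=> xX /bigcupP [e eE xe]; apply/properP; split.
  by apply/subsetP => e'; rewrite inE => /andP[].
exists e => //; rewrite inE eE /=; apply/negP => /pred0P /(_ x) /=.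
by rewrite xe xX.
Qed.

(** The pairing of the graph without the edges at [X] is thinned to pairs lying inside some copy
    disjoint from [X]. Hence no vertex of [X] is used by it, and pairs inside [X] can be added
    without raising degrees. *)
Lemma avoiding_pairing X x : x \in X -> x \in cover E ->
  exists P, [/\ symmetric P, irreflexive P, forall v, #|[set u | P v u]| <= b,
    forall S, C E S -> [disjoint S & X] -> hits P S &
    forall u v, P u v ->
      exists S, [/\ C E S, [disjoint S & X], u \in S & v \in S]].
Proof.
move=> xX xE; have [P [sP iP dP hP]] := crE.2 _ (avoiding_proper xX xE).
pose P' u v := P u v && [exists S : {set 'I_n},
   [&& C E S, [disjoint S & X], u \in S & v \in S]].
exists P'; split.
- by move=> u v; rewrite /P' sP; congr (_ && _); apply: eq_existsb => S; rewrite [(u \in S) && _]andbC.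
- by move=> u; rewrite /P' iP.
- move=> v; apply: leq_trans (dP v); apply/subset_leq_card/subsetP => u.
  by rewrite !inE => /andP[].
- move=> S CS dS; have /hitsP [u [v [uS vS Puv]]] := hP _ (C_avoiding CS dS).
  apply/hitsP; exists u, v; split=> //; rewrite /P' Puv; apply/existsP; exists S.
  by rewrite CS dS uS vS.
by move=> u v /andP[_ /existsP [S /and4P[CS dS uS vS]]]; exists S.
Qed.

(** The reduction behind all structural arguments: if pairs inside [X] suffice for every copy
    meeting [X], they combine with a pairing for the copies avoiding [X]. The two pairings live on
    disjoint vertex sets, so the degree bound survives. *)
Lemma critical_irreducible X (P0 : rel 'I_n) x :
  x \in X -> x \in cover E -> symmetric P0 -> irreflexive P0 ->
  (forall u v, P0 u v -> u \in X) -> (forall v, #|[set u | P0 v u]| <= b) ->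
  (forall S y, C E S -> y \in S -> y \in X -> hits P0 S) -> False.
Proof.
move=> xX xE s0 i0 in0 d0 h0.
have [P [sP iP dP hP pP]] := avoiding_pairing xX xE.
have outP u v : P u v -> u \notin X.
  by move=> /pP [S [_ dS uS _]]; rewrite (disjointFr dS).
apply: crE.1; exists (fun u v => P u v || P0 u v); split.
- by move=> u v; rewrite sP s0.
- by move=> u; rewrite iP i0.
- move=> v; have [vX|vX] := boolP (v \in X).
    rewrite (eq_card (B := [set u | P0 v u])) // => u; rewrite !inE.
    by case: (boolP (P v u)) => // /outP; rewrite vX.
  rewrite (eq_card (B := [set u | P v u])) // => u; rewrite !inE.
  by case: (boolP (P0 v u)) => [/in0|]; rewrite ?(negPf vX) ?orbF.
- move=> S CS; have [dS|] := boolP [disjoint S & X].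
    have /hitsP [u [v [uS vS Puv]]] := hP _ CS dS.
    by apply/hitsP; exists u, v; split=> //; rewrite Puv.
  case/pred0Pn => y /= /andP[yS yX].
  have /hitsP [u [v [uS vS Puv]]] := h0 _ _ CS yS yX.
  by apply/hitsP; exists u, v; split=> //; rewrite Puv orbT.
Qed.

End Pairable.

Lemma uniq_map_inj (S U : eqType) (f : S -> U) (s : seq S) :
  uniq (map f s) -> {in s &, injective f}.
Proof.
elim: s => //= r s IH /andP[nr us] p q; rewrite !inE.
case/predU1P=> [->|ps] /predU1P[->|qs] e //; last exact: IH.
  by move: nr; rewrite e map_f.
by move: nr; rewrite -e map_f.
Qed.

Section PairLists.
Variable n : nat.
Implicit Types (l : seq ('I_n * 'I_n)) (S : {set 'I_n}).

Definition paired l : rel 'I_n := fun u v => ((u, v) \in l) || ((v, u) \in l).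
Definition ends l := unzip1 l ++ unzip2 l.

Lemma paired_sym l : symmetric (paired l).
Proof. by move=> u v; rewrite /paired orbC. Qed.

Lemma mem_ends1 l u v : (u, v) \in l -> u \in ends l.
Proof. by move=> uv; rewrite mem_cat (map_f (@fst _ _) uv). Qed.

Lemma mem_ends2 l u v : (u, v) \in l -> v \in ends l.
Proof. by move=> uv; rewrite mem_cat (map_f (@snd _ _) uv) orbT. Qed.

Lemma paired_ends l u v : paired l u v -> u \in ends l.
Proof. by case/orP => [/mem_ends1|/mem_ends2]. Qed.

Lemma paired_irr l : uniq (ends l) -> irreflexive (paired l).
Proof.
rewrite cat_uniq => /and3P[_ /hasPn d _] u; rewrite /paired orbb.
apply/negP => uu; have := d u (map_f (@snd _ _) uu).
by rewrite /= (map_f (@fst _ _) uu).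
Qed.

Lemma card_paired l v : uniq (ends l) -> #|[set u | paired l v u]| <= 1.
Proof.
rewrite cat_uniq => /and3P[u1 /hasPn d u2].
apply/card_le1_eqP => x y; rewrite !inE.
have inj1 := uniq_map_inj u1; have inj2 := uniq_map_inj u2.
have mix w z : (v, w) \in l -> (z, v) \in l -> False.
  by move=> vw zv; have := d v (map_f (@snd _ _) zv); rewrite /= (map_f (@fst _ _) vw).
by case/orP=> vx /orP[] vy; [have [->] := inj1 _ _ vx vy erefl|
  case: (mix _ _ vx vy)|case: (mix _ _ vy vx)|have [->] := inj2 _ _ vx vy erefl].
Qed.

Lemma hits_paired l S u v : (u, v) \in l -> u \in S -> v \in S -> hits (paired l) S.
Proof. by move=> uv uS vS; apply/hitsP; exists u, v; split; rewrite ?/paired ?uv. Qed.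

(** The case of bias one with the reduction given as an explicit list; [uniq (ends l)] says that the
    listed pairs form a matching. *)
Lemma critical_irreducible_pairs (C : {set {set 'I_n}} -> {set 'I_n} -> bool) E l x :
  (forall (E E' : {set {set 'I_n}}) S, E \subset E' -> C E S -> C E' S) ->
  (forall E S, C E S -> C [set e in E | e \subset S] S) ->
  critical 1 C E -> uniq (ends l) -> x \in ends l -> x \in cover E ->
  (forall S y, C E S -> y \in S -> y \in ends l -> hits (paired l) S) -> False.
Proof.
move=> Cm Cl cr ul xl xE h.
apply: (@critical_irreducible n 1 C Cm Cl E cr [set y in ends l] (paired l) x) => //.
- by rewrite inE.
- exact: paired_sym.
- exact: paired_irr.
- by move=> u v /paired_ends; rewrite inE.
- by move=> v; apply: card_paired.
- by move=> S y CS yS; rewrite inE; apply: h.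
Qed.

End PairLists.

(** * Degree two vertices and long cycles *)

(* Greedy matching: serving the only left vertex with a single free neighbour
   creates at most one new such vertex, because right vertices have degree at most 2. *)
Lemma matching_of_degree_two (T : finType) (r : rel T) (A B : {set T}) :
  {in A, forall a, 0 < #|[set b in B | r a b]|} ->
  {in A &, forall a a', a != a' ->
     1 < #|[set b in B | r a b]| \/ 1 < #|[set b in B | r a' b]|} ->
  {in B, forall b, #|[set a in A | r a b]| <= 2} ->
  exists j : T -> T, {in A, forall a, r a (j a) && (j a \in B)} /\ {in A &, injective j}.
Proof.
elim: {A}_.+1 {-2}A (ltnSn #|A|) B => // m IH A ltA B pos two deg.
have [->|/set0Pn [a1 a1A]] := eqVneq A set0.
  by exists id; split=> [a|a a']; rewrite inE.
have [a aA amin] : exists2 a, a \in A & {in A, forall a', a' != a ->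
    1 < #|[set b in B | r a' b]|}.
  have [/exists_inP [a aA lt2]|/exists_inPn no] :=
    boolP [exists a in A, #|[set b in B | r a b]| < 2].
    exists a => // a' a'A na; have [] := two _ _ a'A aA na => //.
    by move=> le2; move: lt2; rewrite ltnNge le2.
  by exists a1 => // a' a'A _; rewrite ltnNge; have := no _ a'A; rewrite -leqNgt => ->.
have /card_gt0P [b] := pos _ aA; rewrite inE => /andP[bB rab].
have shrink a' : [set c in B :\ b | r a' c] = [set c in B | r a' c] :\ b.
  by apply/setP => c; rewrite !inE andbA.
have sz a' : a' \in A :\ a ->
    #|[set c in B | r a' c]| = r a' b + #|[set c in B :\ b | r a' c]|.
  by move=> _; rewrite shrink (cardsD1 b [set c in B | r a' c]) inE bB.
have [||||j [jr ji]] := IH (A :\ a) _ (B :\ b).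
- by move: ltA; rewrite (cardsD1 a) aA.
- move=> a' a'A; have := sz _ a'A; move: (a'A); rewrite !inE => /andP[na a'A'].
  by have := amin _ a'A' na; case: (r a' b) => /=; clear; lia.
- move=> a' a2 a'A a2A na; have := sz _ a'A; have := sz _ a2A.
  move: a'A a2A; rewrite !inE => /andP[na' a'A] /andP[na2 a2A].
  have := amin _ a'A na'; have := amin _ a2A na2.
  case r1: (r a' b); case r2: (r a2 b) => /=; try by clear; lia.
  move=> _ _ _ _; have := deg b bB.
  suff : #|[set a; a'; a2]| <= #|[set a0 in A | r a0 b]|.
    rewrite -setUA cardsU1 cards2 !inE !(eq_sym a) (negPf na') (negPf na2) na /=.
    by clear; lia.
  apply/subset_leq_card/subsetP => c; rewrite !inE.
  by case/orP => [/orP[]|] /eqP ->; rewrite ?aA ?rab ?a'A ?a2A ?r1 ?r2.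
- move=> c; rewrite inE => /andP[_ cB]; apply: leq_trans (deg c cB).
  by apply/subset_leq_card/subsetP => d; rewrite !inE => /andP[/andP[_ ->] ->].
exists (fun x => if x == a then b else j x); split.
  move=> x xA; have [->|nx] := eqVneq x a; first by rewrite rab bB.
  have /andP[-> ] : r x (j x) && (j x \in B :\ b) by apply: jr; rewrite !inE nx.
  by rewrite inE => /andP[_ ->].
have nj x : x \in A -> x != a -> j x != b.
  move=> xA nx; have /andP[_ ] : r x (j x) && (j x \in B :\ b) by apply: jr; rewrite !inE nx.
  by rewrite !inE => /andP[].
move=> x y xA yA; have [->|nx] := eqVneq x a; have [->|ny] := eqVneq y a => //.
- by move/eqP; rewrite eq_sym (negPf (nj _ _ _)).
- by move/eqP; rewrite (negPf (nj _ _ _)).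
- by apply: ji; rewrite !inE ?nx ?ny.
Qed.

Lemma card2_split (T : finType) (A : {set T}) x :
  #|A| = 2 -> x \in A -> exists2 y, A = [set x; y] & x != y.
Proof.
move=> /eqP/cards2P [a [b [nab ->]]]; rewrite !inE => /orP[] /eqP ->; first by exists b.
by exists a; rewrite 1?setUC // eq_sym.
Qed.

Lemma card3_split (T : finType) (A D : {set T}) : #|A| = 3 -> 1 < #|A :&: D| ->
  exists x1 x2 w, [/\ A = [set x1; x2; w], uniq [:: x1; x2; w], x1 \in D & x2 \in D].
Proof.
move=> A3 /card_gt1P [x [y [/setIP[xA xD] /setIP[yA yD] nxy]]].
have /card_gt0P [w] : 0 < #|A :\ x :\ y|.
  by move: A3; rewrite (cardsD1 x A) xA (cardsD1 y (A :\ x)) !inE eq_sym nxy yA; clear; lia.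
rewrite !inE => /and3P[nwy nwx wA].
exists x, y, w; split=> //=; last by rewrite !inE negb_or nxy !(eq_sym _ w) nwx nwy.
apply/esym/eqP; rewrite eqEcard A3; apply/andP; split.
  by apply/subsetP => z; rewrite !inE -orbA => /or3P[] /eqP ->.
by rewrite setUC cardsU1 cards2 !inE negb_or nwx nwy nxy.
Qed.

Section DegreeTwo.
Variables (n : nat) (C : {set {set 'I_n}} -> {set 'I_n} -> bool).
Hypothesis C_mono : forall (E E' : {set {set 'I_n}}) S, E \subset E' -> C E S -> C E' S.
Hypothesis C_local : forall E S, C E S -> C [set e in E | e \subset S] S.
Variable E : {set {set 'I_n}}.
Hypothesis sE : E \subset pairs n.
Hypothesis C_deg : forall S v, C E S -> v \in S -> 1 < #|nbh E v :&: S|.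
Hypothesis crE : critical 1 C E.

Local Notation nb := (nbh E).
Local Notation deg v := #|nbh E v|.
Implicit Types (S : {set 'I_n}) (u v x y : 'I_n).

Let irreducible l x := @critical_irreducible_pairs n C E l x C_mono C_local crE.

Lemma cover_deg v : v \in cover E -> 1 < deg v.
Proof.
rewrite in_cover_nbh // => /card_gt0P [u]; rewrite in_nbh => vu.
have [S [CS vS uS]] := critical_edge C_mono C_local crE vu.
by apply: leq_trans (C_deg CS vS) _; apply/subset_leq_card/subsetIl.
Qed.

Lemma deg2_sub x S : deg x = 2 -> C E S -> x \in S -> nb x \subset S.
Proof.
move=> dx CS xS; apply/setIidPl/eqP; rewrite eqEcard subsetIl dx.
exact: C_deg.
Qed.

Lemma deg2_adj x y S : deg x = 2 -> adj E x y -> C E S -> x \in S -> y \in S.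
Proof.
by move=> dx xy CS xS; apply: (subsetP (deg2_sub dx CS xS)); rewrite in_nbh.
Qed.

(** A copy through a degree two vertex contains both its neighbours, so the single pair [(x, y)]
    would hit all copies through [x] or [y]. *)
Lemma deg2_nonadj x y : adj E x y -> deg x = 2 -> deg y = 2 -> False.
Proof.
move=> xy dx dy; have nxy := adj_neq sE xy.
apply: (@irreducible [:: (x, y)] x); rewrite ?inE ?eqxx //=.
- by rewrite inE nxy.
- exact: adj_cover xy.
move=> S z CS zS; rewrite !inE => /orP[] /eqP ez; rewrite ez in zS.
  by apply: hits_paired zS (deg2_adj dx xy CS zS); rewrite mem_head.
by rewrite adjC in xy; apply: hits_paired (deg2_adj dy xy CS zS) zS; rewrite mem_head.
Qed.

Lemma deg3_S v x1 x2 x3 S : nb v = [set x1; x2; x3] -> C E S -> v \in S ->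
  [|| (x1 \in S) && (x2 \in S), (x1 \in S) && (x3 \in S) | (x2 \in S) && (x3 \in S)].
Proof.
move=> nv CS vS; have /card_gt1P [a [c [/setIP[anv aS] /setIP[cnv cS] nac]]] := C_deg CS vS.
move: anv cnv nac aS cS; rewrite nv !inE -!orbA.
by move=> /or3P[]/eqP-> /or3P[]/eqP->; rewrite ?eqxx // => _ -> ->; rewrite ?orbT.
Qed.

(** Every copy through one of these four vertices contains [v] and two of the [xi], hence [x1]
    together with [v], or both [x2] and [x3]. *)
Lemma deg3_two_deg2 v x1 x2 x3 : nb v = [set x1; x2; x3] -> uniq [:: x1; x2; x3] ->
  deg x1 = 2 -> deg x2 = 2 -> deg x3 = 2 -> False.
Proof.
move=> nv ux d1 d2 d3.
have [a1 a2 a3] : [/\ adj E v x1, adj E v x2 & adj E v x3].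
  by rewrite -!in_nbh nv !inE !eqxx !orbT.
apply: (@irreducible [:: (v, x1); (x2, x3)] v); rewrite ?inE ?eqxx //=.
- move: ux; rewrite /= !inE !negb_or !andbT => /andP[/andP[n12 n13] n23].
  by rewrite (adj_neq sE a1) (adj_neq sE a2) (adj_neq sE a3) (eq_sym x2 x1) n12 n23 n13.
- exact: adj_cover a1.
move=> S z CS zS zl.
have vS : v \in S.
  move: a1 a2 a3 zl; rewrite !(adjC _ v) !inE => a1 a2 a3.
  case/or4P => /eqP ez; subst z => //.
  - exact: deg2_adj d2 a2 CS zS.
  - exact: deg2_adj d1 a1 CS zS.
  - exact: deg2_adj d3 a3 CS zS.
have := deg3_S nv CS vS; case/or3P => /andP[s1 s2].
- by apply: hits_paired vS s1; rewrite mem_head.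
- by apply: hits_paired vS s1; rewrite mem_head.
- by apply: hits_paired s1 s2; rewrite !inE eqxx orbT.
Qed.

Lemma critical_cover : (forall S, C E S -> S != set0) -> exists x, x \in cover E.
Proof.
move=> C0; have [S CS] := critical_exists crE; have /set0Pn [v vS] := C0 _ CS; exists v.
by rewrite in_cover_nbh // (leq_trans _ (subset_leq_card (subsetIl _ S))) // ltnW // C_deg.
Qed.

(* [D] is matched into its neighbours; all copies meeting the matched vertices are hit. *)
Lemma deg2_matching (D B : {set 'I_n}) x : x \in D -> x \in cover E ->
  {in D, forall y, deg y = 2 /\ nb y \subset B} -> [disjoint D & B] ->
  {in B, forall v, #|nb v :&: D| <= 2} ->
  (forall S v, C E S -> v \in S -> v \in B -> exists2 y, y \in S & y \in D) -> False.
Proof.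
move=> xD xE D2 dDB B2 BD.
have sz y : y \in D -> #|[set v in B | adj E y v]| = 2.
  move=> yD; have [<- /subsetP sB] := D2 _ yD; apply: eq_card => v; rewrite !inE.
  by case: (boolP (adj E y v)) => yv; rewrite ?andbF // andbT sB ?in_nbh.
have [|||j [jr ji]] := @matching_of_degree_two _ (adj E) D B.
- by move=> y yD; rewrite sz.
- by move=> y z yD zD _; rewrite sz //; left.
- move=> v vB; apply: leq_trans (B2 v vB); apply/subset_leq_card/subsetP => y.
  by rewrite !inE adjC andbC.
pose l := [seq (y, j y) | y <- enum D].
have endsE y : y \in ends l -> y \in D \/ y \in B.
  rewrite mem_cat => /orP[] /mapP [q /mapP [z]]; rewrite mem_enum => zD -> -> /=.
    by left.
  by right; have /andP[] := jr _ zD.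
have hitD S y : C E S -> y \in S -> y \in D -> hits (paired l) S.
  move=> CS yS yD; have /andP[ry _] := jr _ yD; have [dy _] := D2 _ yD.
  by apply: hits_paired yS (deg2_adj dy ry CS yS); apply/map_f; rewrite mem_enum.
apply: (@irreducible l x) => //.
- rewrite /ends /unzip1 /unzip2 -!map_comp /= map_id cat_uniq enum_uniq /=.
  rewrite map_inj_in_uniq ?enum_uniq ?andbT; last first.
    by move=> y z; rewrite !mem_enum; apply: ji.
  apply/hasPn => z /mapP [y]; rewrite mem_enum => yD ->.
  by have /andP[_ jB] := jr _ yD; rewrite /= mem_enum (disjointFl dDB).
- by apply: (mem_ends1 (v := j x)); apply/map_f; rewrite mem_enum.
move=> S y CS yS /endsE [yD|yB]; first exact: hitD yS yD.
by have [z zS zD] := BD _ _ CS yS yB; apply: hitD zS zD.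
Qed.

(** A vertex has charge [(k-1) deg] and needs [2k]. A degree two vertex lacks two units and gets one
    from each neighbour; a degree three vertex is asked at most twice by [deg3_two_deg2] and can pay
    since [k >= 5]. *)
Lemma long_cycle_critical k : 4 < k -> (forall S, C E S -> S != set0) ->
  k * #|cover E| < k.-1 * #|E|.
Proof.
move=> k5 C0.
pose D := [set v | deg v == 2].
pose tr u v := adj E u v && (u \in D).
have inE_ v : [set u | tr u v] = nb v :&: D by apply/setP => u; rewrite !inE /tr adjC inE.
have outE v : [set u | tr v u] = if v \in D then nb v else set0.
  by apply/setP => u; rewrite inE /tr; case: ifP; rewrite ?inE ?andbT ?andbF.
have in0 v : v \in D -> nb v :&: D = set0.
  rewrite inE => /eqP dv; apply/setP => u; rewrite !inE; apply/negP => /andP[vu /eqP du].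
  exact: deg2_nonadj vu dv du.
have in3 v : deg v = 3 -> #|nb v :&: D| <= 2.
  move=> d3; rewrite leqNgt; apply/negP => lt.
  have [x1 [x2 [x3 [nv ux _ _]]]] := card3_split d3 (ltnW lt).
  have /setIidPl/subsetP sD : nb v :&: D = nb v.
    by apply/eqP; rewrite eqEcard subsetIl d3.
  have d2 y : y \in nb v -> deg y = 2 by move/sD; rewrite inE => /eqP.
  by apply: (deg3_two_deg2 nv ux); apply: d2; rewrite nv !inE eqxx ?orbT.
have le v : v \in cover E ->
    2 * k + #|[set u | tr u v]| <= k.-1 * deg v + #|[set u | tr v u]|.
  move=> vE; rewrite inE_ outE; case: ifPn => [vD|vD].
    by rewrite in0 // cards0; move: vD; rewrite inE => /eqP ->; move: k5; clear; lia.
  rewrite cards0 addn0.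
  have [d3|d4] : deg v = 3 \/ 3 < deg v.
    by move: (cover_deg vE) vD; rewrite inE; move: #|nb v|; clear; lia.
    by have := in3 v d3; rewrite d3; move: k5 #|nb v :&: D|; clear; lia.
  have : #|nb v :&: D| <= deg v by apply/subset_leq_card/subsetIl.
  by move: #|nb v :&: D| #|nb v| k5 d4; clear; nia.
have eqa : \sum_(v in cover E) 2 * k = 2 * (k * #|cover E|).
  by rewrite sum_nat_const; clear; lia.
have eqb : \sum_(v in cover E) k.-1 * deg v = 2 * (k.-1 * #|E|).
  by rewrite -big_distrr /= handshake // mulnCA.
have [|lt|tight] := discharging _ le.
- by move=> u v /andP[uv _]; rewrite (adj_cover uv); move: uv; rewrite adjC; apply: adj_cover.
- by move: lt; rewrite eqa eqb; clear; lia.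
(* Equality at such a vertex excludes degree four and more, and at degree three forces [k = 5] and
   exactly two neighbours in [D]. *)
have T3 v : v \in cover E -> v \notin D -> deg v = 3 /\ #|nb v :&: D| = 2.
  move=> vE vD; have := tight _ vE; rewrite inE_ outE (negPf vD) cards0.
  have := cover_deg vE; move: (vD); rewrite inE => nv2 d2.
  have : #|nb v :&: D| <= deg v by apply/subset_leq_card/subsetIl.
  have := in3 v; move: (#|nb v :&: D|) (#|nb v|) nv2 d2 k5; clear; nia.
have [x0 x0E] := critical_cover C0.
have [x [xD xE]] : exists x, x \in D /\ x \in cover E.
  have [x0D|x0D] := boolP (x0 \in D); first by exists x0.
  have [_ c2] := T3 _ x0E x0D.
  have /card_gt0P [x /setIP[xx0 xD]] : 0 < #|nb x0 :&: D| by rewrite c2.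
  by exists x; split=> //; move: xx0; rewrite in_nbh adjC; apply: adj_cover.
apply: False_ind.
apply: (@deg2_matching D (cover E :\: D) x) => //.
- move=> y yD; split; first by move: yD; rewrite inE => /eqP.
  apply/subsetP => v vy; rewrite !inE; apply/andP; split.
    apply/negP => dv; have := in0 _ yD; move/setP/(_ v); rewrite !inE dv.
    by move: vy; rewrite in_nbh => ->.
  by move: vy; rewrite in_nbh adjC; apply: adj_cover.
- by apply/pred0P => v /=; rewrite !inE; case: eqP; rewrite ?andbF.
- by move=> v; rewrite inE => /andP[vD vE]; have [_ ->] := T3 _ vE vD.
(* The copy uses two of the three neighbours of [v], and two of the three lie in [D], so the two
   sets overlap. *)
move=> S v CS vS; rewrite inE => /andP[vD vE]; have [d3 c2] := T3 _ vE vD.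
have : 0 < #|(nb v :&: S) :&: (nb v :&: D)|.
  have := cardsUI (nb v :&: S) (nb v :&: D); rewrite c2 -setIUr.
  have := C_deg CS vS; have := subset_leq_card (subsetIl (nb v) (S :|: D)).
  by rewrite d3; clear; lia.
by case/card_gt0P => y /setIP[/setIP[_ yS] /setIP[_ yD]]; exists y.
Qed.

End DegreeTwo.

(** * Cliques *)

(** Cliques as bare vertex sets, free of embeddings; [copy_set_clique] identifies this with the
    general notion of a copy. *)
Definition clique_set n k (E : {set {set 'I_n}}) (S : {set 'I_n}) : bool :=
  (#|S| == k) && [forall u in S, forall v in S, (u != v) ==> adj E u v].

Lemma clique_setP n k (E : {set {set 'I_n}}) (S : {set 'I_n}) :
  reflect (#|S| = k /\ {in S &, forall u v, u != v -> adj E u v}) (clique_set k E S).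
Proof.
apply: (iffP andP) => [[/eqP cS /forall_inP aS]|[cS aS]]; split=> //.
- by move=> u v uS vS; apply/implyP; have /forall_inP := aS u uS; apply.
- exact/eqP.
- by apply/forall_inP => u uS; apply/forall_inP => v vS; apply/implyP/aS.
Qed.

Lemma clique_set_mono n k (E E' : {set {set 'I_n}}) (S : {set 'I_n}) :
  E \subset E' -> clique_set k E S -> clique_set k E' S.
Proof.
move=> sE /clique_setP [cS aS]; apply/clique_setP; split=> // u v uS vS nuv.
exact/(subsetP sE)/aS.
Qed.

Lemma clique_set_local n k (E : {set {set 'I_n}}) (S : {set 'I_n}) :
  clique_set k E S -> clique_set k [set e in E | e \subset S] S.
Proof.
move=> /clique_setP [cS aS]; apply/clique_setP; split=> // u v uS vS nuv.
by rewrite /adj inE; apply/andP; split; [apply: aS|rewrite subUset !sub1set uS].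
Qed.

Section Cliques.
Variables (n b k : nat) (E : {set {set 'I_n}}).
Hypothesis sE : E \subset pairs n.
Hypothesis crE : critical b (@clique_set n k) E.
Hypothesis k_gt0 : 0 < k.

Local Notation C := (@clique_set n k).
Local Notation nb := (nbh E).
Local Notation deg v := #|nbh E v|.
Implicit Types (S Q : {set 'I_n}) (u v x y z : 'I_n).

Lemma clique_sub S v : C E S -> v \in S -> S \subset v |: nb v.
Proof.
move=> /clique_setP [_ aS] vS; apply/subsetP => u uS; rewrite !inE.
by have [//|nuv] := eqVneq u v; rewrite aS // eq_sym.
Qed.

Lemma card_closed_nbh v : #|v |: nb v| = (deg v).+1.
Proof. by rewrite cardsU1 in_nbh adjxx. Qed.

Lemma clique_edge u v : adj E u v -> exists S, [/\ C E S, u \in S & v \in S].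
Proof. exact: (critical_edge (@clique_set_mono n k) (@clique_set_local n k) crE). Qed.

Lemma clique_cover v : v \in cover E -> exists2 S, C E S & v \in S.
Proof.
rewrite in_cover_nbh // => /card_gt0P [u]; rewrite in_nbh => /clique_edge [S [CS vS _]].
by exists S.
Qed.

Lemma clique_deg v : v \in cover E -> k.-1 <= deg v.
Proof.
move=> /clique_cover [S CS vS]; have := subset_leq_card (clique_sub CS vS).
by rewrite card_closed_nbh; have /clique_setP [-> _] := CS; move: k_gt0 #|nb v|; clear; lia.
Qed.

(** A vertex of the least possible degree [k - 1], called private from here on, lies in a single
    copy: its closed neighbourhood. *)
Lemma private_clique x S : deg x = k.-1 -> C E S -> x \in S -> S = x |: nb x.
Proof.
move=> dx CS xS; apply/eqP; rewrite eqEcard clique_sub //= card_closed_nbh dx.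
by have /clique_setP [-> _] := CS; move: k_gt0; clear; lia.
Qed.

Lemma private_is_clique x : x \in cover E -> deg x = k.-1 -> C E (x |: nb x).
Proof. by move=> /clique_cover [S CS xS] dx; rewrite -(private_clique dx CS xS). Qed.

Lemma private_adj x y z : x \in cover E -> deg x = k.-1 -> adj E x y -> adj E x z ->
  y != z -> adj E y z.
Proof.
move=> xE dx xy xz nyz; have /clique_setP [_ aS] := private_is_clique xE dx.
by apply: aS; rewrite // !inE ?xy ?xz orbT.
Qed.

(* Were some neighbour of [x] of degree less than [b] in the pairing of the rest,
   it could be paired with [x]. *)
Lemma private_pairing x : 0 < b -> x \in cover E -> deg x = k.-1 ->
  exists P : rel 'I_n, [/\ symmetric P, irreflexive P, forall v, #|[set u | P v u]| <= b,
    forall S, C E S -> x \notin S -> hits P S &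
    [/\ forall u v, P u v -> exists S, [/\ C E S, x \notin S, u \in S & v \in S],
        ~~ hits P (x |: nb x) &
        forall y, y \in nb x -> #|[set u | P y u]| = b]].
Proof.
move=> b0 xE dx.
have [P [sP iP dP hP pP]] := avoiding_pairing (@clique_set_mono n k)
  (@clique_set_local n k) crE (set11 x) xE.
have hP' S : C E S -> x \notin S -> hits P S.
  by move=> CS xS; apply: hP; rewrite // disjoint_sym disjoints1.
have pP' u v : P u v -> exists S, [/\ C E S, x \notin S, u \in S & v \in S].
  move=> /pP [S [CS dS uS vS]]; exists S; split=> //.
  by move: dS; rewrite disjoint_sym disjoints1.
have nPx u : P x u = false.
  by apply/negP => /pP' [S [_ /negP xS /xS]].
exists P; split=> //; split=> // [|y yx].
  apply/negP => hK; apply: crE.1; exists P; split=> // S CS.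
  have [xS|xS] := boolP (x \in S); last exact: hP'.
  by rewrite (private_clique dx CS xS).
apply/eqP; rewrite eqn_leq dP leqNgt; apply/negP => lt.
have nxy : x != y by apply: (adj_neq sE); rewrite -in_nbh.
apply: crE.1; exists (fun u v => [|| P u v, (u == x) && (v == y) | (u == y) && (v == x)]).
split.
- by move=> u v; rewrite sP [(u == x) && _]andbC [(u == y) && _]andbC [X in _ || X]orbC.
- move=> u; rewrite iP /=; have [->|//] := eqVneq u x; first by rewrite (negPf nxy).
  by rewrite andbF.
- move=> v; have [->|nvx] := eqVneq v x.
    apply: leq_trans b0; apply/card_le1_eqP => u w; rewrite !inE !nPx (negPf nxy) /=.
    by rewrite !orbF => /eqP -> /eqP ->.
  have [->|nvy] := eqVneq v y.
    apply: leq_trans lt; rewrite -[X in _ <= X]add1n -[1](cards1 x).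
    apply: leq_trans (leq_card_setU _ _); apply/subset_leq_card/subsetP => u.
    by rewrite !inE /= orbC.
  by apply: leq_trans (dP v); apply/subset_leq_card/subsetP => u; rewrite !inE /= orbF.
- move=> S CS; have [xS|xS] := boolP (x \in S).
    apply/hitsP; exists x, y; rewrite xS (private_clique dx CS xS) !inE -in_nbh yx !eqxx.
    by rewrite !orbT.
  have /hitsP [u [v [uS vS Puv]]] := hP' _ CS xS.
  by apply/hitsP; exists u, v; rewrite Puv.
Qed.

End Cliques.

(** * Critical graphs for cliques on at least four vertices, with pairings of maximum degree one *)

Section LargeCliques.
Variables (n k : nat) (E : {set {set 'I_n}}).
Hypothesis sE : E \subset pairs n.
Hypothesis crE : critical 1 (@clique_set n k) E.
Hypothesis k4 : 3 < k.

Local Notation C := (@clique_set n k).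
Local Notation nb := (nbh E).
Local Notation deg v := #|nbh E v|.
Implicit Types (S Q : {set 'I_n}) (u v x y z : 'I_n).

Let k0 : 0 < k. Proof. exact: leq_trans k4. Qed.
Let irreducible l x :=
  @critical_irreducible_pairs n C E l x (@clique_set_mono n k) (@clique_set_local n k) crE.

Lemma private_nonadj x y : adj E x y -> deg x = k.-1 -> deg y = k.-1 -> False.
Proof.
move=> xy dx dy; have nxy := adj_neq sE xy.
apply: (@irreducible [:: (x, y)] x).
- by rewrite /= inE nxy.
- by rewrite mem_head.
- exact: adj_cover xy.
move=> S z CS zS; rewrite !inE => /orP[] /eqP ez; rewrite ez in zS.
  by apply: (hits_paired (mem_head _ _) zS); rewrite (private_clique sE k0 dx CS zS) !inE xy orbT.
apply: (hits_paired (mem_head _ _) _ zS); rewrite (private_clique sE k0 dy CS zS) !inE.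
by rewrite adjC xy orbT.
Qed.

Section Private.
Variable x : 'I_n.
Hypotheses (xE : x \in cover E) (dx : deg x = k.-1).

(* [m y] is the partner of the neighbour [y] of [x] in a pairing of the copies avoiding [x]. *)
Lemma private_partners : exists (P : rel 'I_n) (m : 'I_n -> 'I_n),
  [/\ symmetric P, irreflexive P, forall v, #|[set u | P v u]| <= 1,
      forall S, C E S -> x \notin S -> hits P S &
      [/\ {in nb x, forall y, P y (m y)}, {in nb x, forall y, m y \notin x |: nb x},
          {in nb x &, injective m} &
          {in nb x, forall y, exists S, [/\ C E S, x \notin S, y \in S & m y \in S]}]].
Proof.
have [P [sP iP dP hP [pP nh fP]]] := private_pairing sE crE k0 (ltnSn 0) xE dx.
pose m y := odflt y [pick u | P y u].
have Pm y : y \in nb x -> P y (m y).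
  rewrite /m; case: pickP => //= no /fP; rewrite (eq_card (B := pred0)) ?card0 // => u.
  by rewrite !inE no.
have uni u v w : P u v -> P u w -> v = w.
  by move=> uv uw; have /card_le1_eqP := dP u; apply; rewrite inE.
exists P, m; split=> //; split=> //.
- move=> y yx; apply: contra nh => myK; apply/hitsP; exists y, (m y).
  by split; [rewrite inE yx orbT|exact: myK|exact: Pm].
- by move=> y z yx zx e; apply: (uni (m y)); rewrite sP ?Pm // e Pm.
- by move=> y yx; apply/pP/Pm.
Qed.

Variable m : 'I_n -> 'I_n.
Hypothesis mK : {in nb x, forall y, m y \notin x |: nb x}.
Hypothesis mI : {in nb x &, injective m}.
Hypothesis mS : {in nb x, forall y, exists S, [/\ C E S, x \notin S, y \in S & m y \in S]}.

Let cK : #|x |: nb x| = k.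
Proof. by rewrite card_closed_nbh // dx; move: k0; clear; lia. Qed.

Lemma partner_adj y : y \in nb x -> adj E y (m y).
Proof.
move=> yx; have [S [/clique_setP [_ aS] _ yS mS']] := mS yx; apply: aS => //.
by apply: contraTneq (mK yx) => <-; rewrite negbK inE yx orbT.
Qed.

Lemma private_nbh_sub y : y \in nb x -> (x |: nb x) :\ y \subset nb y.
Proof.
move=> yx; have /clique_setP [_ aS] := private_is_clique sE crE k0 xE dx.
apply/subsetP => u /setD1P[nuy uK]; rewrite in_nbh; apply: aS => //.
  by rewrite inE yx orbT.
by rewrite eq_sym.
Qed.

Lemma private_nbh_card (y : 'I_n) (s : seq 'I_n) : y \in nb x -> uniq s ->
  {in s, forall u, adj E y u /\ u \notin x |: nb x} ->
  [set u in s] :|: (x |: nb x) :\ y \subset nb y /\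
  #|[set u in s] :|: (x |: nb x) :\ y| = size s + k.-1.
Proof.
move=> yx us As; split.
  apply/subsetP => u /setUP[|/(subsetP (private_nbh_sub yx))//].
  by rewrite inE => /As [yu _]; rewrite in_nbh.
rewrite cardsU disjoint_setI0 ?cards0 ?subn0.
  congr (_ + _); first by rewrite cardsE (card_uniqP us).
  by have := cK; rewrite (cardsD1 y) inE yx orbT => <-.
by apply/pred0P => u /=; rewrite inE; apply/negP => /andP[/As [_ /negP nK] /setD1P[_ /nK]].
Qed.

Lemma private_nbh_deg (y : 'I_n) (s : seq 'I_n) : y \in nb x -> uniq s ->
  {in s, forall u, adj E y u /\ u \notin x |: nb x} -> size s + k.-1 <= deg y.
Proof.
move=> yx us As; have [sub <-] := private_nbh_card yx us As.
exact: subset_leq_card.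
Qed.

Lemma private_nbh_eq (y : 'I_n) (s : seq 'I_n) : y \in nb x -> uniq s ->
  {in s, forall u, adj E y u /\ u \notin x |: nb x} -> deg y = size s + k.-1 ->
  nb y = [set u in s] :|: (x |: nb x) :\ y.
Proof.
move=> yx us As dy; have [sub card] := private_nbh_card yx us As.
by apply/esym/eqP; rewrite eqEcard sub card dy /=.
Qed.

(** The only neighbour of [y] outside the closed neighbourhood of [x] is [m y]. So the copy
    containing [y] and [m y] but not [x] has no choice: it is [m y] together with all of [nb x]. *)
Lemma low_partner y z : y \in nb x -> deg y = k -> z \in nb x -> adj E z (m y).
Proof.
move=> yx dy zx.
have ny : nb y = [set u in [:: m y]] :|: (x |: nb x) :\ y.
  apply: private_nbh_eq => //; last by rewrite dy /=; move: k0; clear; lia.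
  by move=> u; rewrite inE => /eqP ->; rewrite partner_adj ?mK.
have [S [CS xS yS myS]] := mS yx.
have SE : S = m y |: nb x.
  apply/eqP; rewrite eqEcard; apply/andP; split.
    apply/subsetP => u uS; have := subsetP (clique_sub CS yS) u uS.
    have nux : u != x by apply: contraNneq xS => <-.
    rewrite ny !inE (negPf nux) /=; have [->|_] := eqVneq u y; last by [].
    by rewrite -in_nbh yx orbT.
  rewrite cardsU1 dx; have /clique_setP [-> _] := CS.
  by case: (_ \notin _); move: k0; clear; lia.
have /clique_setP [_ aS] := CS; apply: aS => //.
  by rewrite SE inE zx orbT.
by apply: contraTneq (mK yx) => <-; rewrite negbK inE zx orbT.
Qed.

(** By [low_partner], [z] sees [m y] besides its own partner [m z]: two distinct vertices outside
    the closed neighbourhood of [x]. *)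
Lemma second_nbh_deg y z : y \in nb x -> deg y = k -> z \in nb x -> z != y -> k < deg z.
Proof.
move=> yx dy zx nzy.
have : size [:: m y; m z] + k.-1 <= deg z.
  apply: private_nbh_deg => //=.
    by rewrite inE andbT; apply: contra nzy => /eqP /mI ->.
  by move=> u; rewrite in_cons mem_seq1 => /orP[] /eqP ->; rewrite ?mK ?partner_adj ?low_partner.
by move: k0; clear; rewrite /=; lia.
Qed.

(** Now [z] has exactly the outside neighbours [m y] and [m z], and [y] does not see [m z]. The copy
    through [z] and [m z] avoiding [x] is thus forced to be [m y], [m z] and [nb x] without [y]; it
    contains [u], which therefore has the three outside neighbours [m y], [m z], [m u]. *)
Lemma third_nbh_deg y z u : y \in nb x -> deg y = k -> z \in nb x -> deg z = k.+1 ->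
  u \in nb x -> z != y -> u != y -> u != z -> k.+1 < deg u.
Proof.
move=> yx dy zx dz ux nzy nuy nuz.
have nzym : m y != m z by apply: contra nzy => /eqP /mI ->.
have nz : nb z = [set u in [:: m y; m z]] :|: (x |: nb x) :\ z.
  apply: private_nbh_eq => //; first by rewrite /= inE andbT.
    by move=> w; rewrite in_cons mem_seq1 => /orP[] /eqP ->; rewrite ?mK ?partner_adj ?low_partner.
  by rewrite dz /=; move: k0; clear; lia.
have ny : nb y = [set u in [:: m y]] :|: (x |: nb x) :\ y.
  apply: private_nbh_eq => //; last by rewrite dy /=; move: k0; clear; lia.
  by move=> w; rewrite inE => /eqP ->; rewrite partner_adj ?mK.
have [S [CS xS zS mzS]] := mS zx; have /clique_setP [cS aS] := CS.
have nymz : adj E y (m z) = false.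
  rewrite -in_nbh ny !inE (eq_sym (m z)) (negPf nzym) /=; apply/negP => /andP[_].
  by have := mK zx; rewrite !inE negb_or => /andP[/negPf -> /negPf ->].
have yS : y \notin S.
  apply/negP => yS; have := aS y (m z) yS mzS; rewrite nymz => /(_ _).
  by case: eqVneq (mK zx) => [<-|_ _ /(_ isT)//]; rewrite inE yx orbT.
have SE : S = m z |: (m y |: nb x :\ y).
  apply/eqP; rewrite eqEcard; apply/andP; split.
    apply/subsetP => w wS; have := subsetP (clique_sub CS zS) w wS.
    have nwx : w != x by apply: contraNneq xS => <-.
    have nwy : w != y by apply: contraNneq yS => <-.
    rewrite nz !inE (negPf nwx) nwy /=; have [->|_] := eqVneq w z.
      by rewrite -in_nbh zx !orbT.
    by case: (w == m y); case: (w == m z); rewrite ?orbT.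
  rewrite cS !cardsU1; have := dx; rewrite (cardsD1 y) yx.
  by move: k0 #|_ :\ y|; clear => k0 c; do 2!case: (_ \notin _); lia.
have umz : adj E u (m z).
  apply: aS => //; first by rewrite SE !inE nuy -in_nbh ux !orbT.
  by apply: contraTneq (mK zx) => <-; rewrite negbK inE ux orbT.
have : size [:: m y; m z; m u] + k.-1 <= deg u.
  apply: private_nbh_deg => //=.
    rewrite !inE negb_or nzym andbT /=; apply/andP; split.
      by apply: contra nuy => /eqP /mI ->.
    by apply: contra nuz => /eqP /mI ->.
  by move=> w; rewrite !in_cons orbF => /or3P[] /eqP ->; rewrite mK ?umz ?partner_adj ?low_partner.
by move: k0; clear; rewrite /=; lia.
Qed.

End Private.

(* The two pairs through [x2] and [x3] can be traded for one pair inside the common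
   neighbourhood, which then hits all three copies. *)
Lemma no_three_twins x1 x2 x3 Q : uniq [:: x1; x2; x3] ->
  {in [:: x1; x2; x3], forall x, [/\ x \in cover E, deg x = k.-1 & nb x = Q]} -> False.
Proof.
move=> /= /and3P[]; rewrite !inE negb_or => /andP[n12 n13] n23 _ H.
have [e1 d1 N1] : [/\ x1 \in cover E, deg x1 = k.-1 & nb x1 = Q] by apply: H; rewrite inE eqxx.
have [e2 d2 N2] : [/\ x2 \in cover E, deg x2 = k.-1 & nb x2 = Q] by apply: H; rewrite !inE eqxx orbT.
have [e3 d3 N3] : [/\ x3 \in cover E, deg x3 = k.-1 & nb x3 = Q] by apply: H; rewrite !inE eqxx !orbT.
have [P [m [sP iP dP hP [Pm mK mI mS]]]] := private_partners e1 d1.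
have uni u v w : P u v -> P u w -> v = w.
  by move=> uv uw; have /card_le1_eqP := dP u; apply; rewrite inE.
have nQ x : x \in [:: x1; x2; x3] -> x \notin Q.
  by move=> xs; have [_ _ <-] := H _ xs; rewrite in_nbh adjxx.
have find x : x \in [:: x2; x3] -> nb x = Q -> deg x = k.-1 -> x \in cover E ->
    exists2 q, q \in Q & P q x.
  move=> xs Nx dx xE.
  have Cx : C E (x |: Q) by rewrite -Nx; apply: (private_is_clique sE crE k0).
  have /hitsP [u [v [uS vS Puv]]] : hits P (x |: Q).
    apply: hP Cx _; rewrite inE negb_or nQ ?inE ?eqxx // andbT.
    by move: xs; rewrite !inE => /orP[] /eqP ->.
  have noQ a c : a \in Q -> c \in Q -> P a c -> False.
    move=> aQ cQ Pac; have aQ' : a \in nb x1 by rewrite N1.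
    by have := mK _ aQ'; rewrite (uni _ _ _ (Pm _ aQ') Pac) inE N1 cQ orbT.
  move: uS vS; rewrite !inE => /predU1P[eu|uQ] /predU1P[ev|vQ].
  - by move: Puv; rewrite eu ev iP.
  - by exists v; rewrite // -eu sP.
  - by exists u; rewrite // -ev.
  - by case: (noQ u v).
have [||||q2 q2Q P2] := find x2; rewrite ?inE ?eqxx //.
have [||||q3 q3Q P3] := find x3; rewrite ?inE ?eqxx ?orbT //.
have nq : q2 != q3.
  by apply: contraNneq n23 => e; rewrite (uni q2 x2 x3) // e.
pose P' u v := P u v && (u \notin [:: x2; x3]) && (v \notin [:: x2; x3])
   || (u == q2) && (v == q3) || (u == q3) && (v == q2).
apply: crE.1; exists P'; split.
- move=> u v; rewrite /P' sP -!andbA [(u \notin _) && _]andbC.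
  by rewrite [(u == q2) && _]andbC [(u == q3) && _]andbC -!orbA [X in _ || X]orbC.
- move=> u; rewrite /P' iP /=; have [->|//] := eqVneq u q2; first by rewrite (negPf nq).
  by rewrite andbF.
- have P'q2 u : P' q2 u -> u = q3.
    rewrite /P' eqxx (negPf nq) orbF /= => /orP[/andP[/andP[Pu _]]|/eqP //].
    by rewrite (uni _ _ _ Pu P2) inE eqxx.
  have P'q3 u : P' q3 u -> u = q2.
    rewrite /P' eqxx eq_sym (negPf nq) orbF /= => /orP[/andP[/andP[Pu _]]|/eqP //].
    by rewrite (uni _ _ _ Pu P3) !inE eqxx orbT.
  move=> v; have [->|nv2] := eqVneq v q2.
    by apply/card_le1_eqP => a c; rewrite !inE => /P'q2 -> /P'q2 ->.
  have [->|nv3] := eqVneq v q3.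
    by apply/card_le1_eqP => a c; rewrite !inE => /P'q3 -> /P'q3 ->.
  apply: leq_trans (dP v); apply/subset_leq_card/subsetP => u.
  by rewrite !inE /P' (negPf nv2) (negPf nv3) /= !orbF => /andP[/andP[]].
- move=> S CS.
  have QS x : x \in [:: x1; x2; x3] -> x \in S -> hits P' S.
    move=> xs xS; have [xE dx Nx] := H x xs.
    have SE := private_clique sE k0 dx CS xS.
    apply/hitsP; exists q2, q3; rewrite SE Nx !inE q2Q q3Q !orbT; split=> //.
    by rewrite /P' !eqxx orbT.
  have [x1S|x1S] := boolP (x1 \in S); first by apply: QS x1S; rewrite inE eqxx.
  have [x2S|x2S] := boolP (x2 \in S); first by apply: QS x2S; rewrite !inE eqxx orbT.
  have [x3S|x3S] := boolP (x3 \in S); first by apply: QS x3S; rewrite !inE eqxx !orbT.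
  have /hitsP [u [v [uS vS Puv]]] := hP _ CS x1S.
  apply/hitsP; exists u, v; split=> //; rewrite /P' Puv /= !inE.
  have out w : w \in S -> (w == x2) || (w == x3) = false.
    by move=> wS; apply/negP => /orP[] /eqP ew; move: wS; rewrite ew ?(negPf x2S) ?(negPf x3S).
  by rewrite !out.
Qed.

Let pv := [set v | deg v == k.-1].

(** Otherwise [y] has at most [k - 2] non-private neighbours. Each private neighbour of [y] has
    [k - 2] further neighbours, all of them non-private and adjacent to [y], so all private
    neighbours of [y] share one neighbourhood, against [no_three_twins]. *)
Lemma many_private_deg y : 2 < #|nb y :&: pv| -> #|nb y :&: pv| + k.-1 <= deg y.
Proof.
move=> t3; rewrite leqNgt; apply/negP => lt.
have inpv x : x \in nb y :&: pv -> [/\ x \in cover E, deg x = k.-1 & y \in nb x].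
  rewrite !inE => /andP[yx /eqP dx]; rewrite adjC in yx; split=> //.
  exact: adj_cover yx.
have sub x : x \in nb y :&: pv -> nb x :\ y \subset nb y :\: pv.
  move=> xp; have [xE dx yx] := inpv x xp; apply/subsetP => u.
  rewrite in_setD1 !inE => /andP[nuy xu]; apply/andP; split.
    by apply/negP => /eqP du; apply: (private_nonadj xu dx du).
  by apply: (private_adj sE crE k0 xE dx) => //; [rewrite -in_nbh|rewrite eq_sym].
have eqN x : x \in nb y :&: pv -> nb x = y |: nb y :\: pv.
  move=> xp; have [xE dx yx] := inpv x xp; rewrite -(setD1K yx); congr (_ |: _).
  apply/eqP; rewrite eqEcard sub //=; move: lt dx.
  rewrite -(cardsID pv (nb y)) (cardsD1 y (nb x)) yx.
  by move: #|nb y :&: pv| #|nb x :\ _| #|nb y :\: _|; clear => t a c; lia.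
have /card_gt2P [x1 [x2 [x3 [[p1 p2 p3] [n12 n23 n31]]]]] := t3.
apply: (@no_three_twins x1 x2 x3 (y |: nb y :\: pv)).
  by rewrite /= !inE negb_or n12 eq_sym n31 n23.
move=> x; rewrite !in_cons orbF => xs.
have xp : x \in nb y :&: pv by case/or3P: xs => /eqP ->.
by have [xE dx _] := inpv x xp; split; [exact: xE|exact: dx|exact: eqN].
Qed.

(** Charge [2 deg], demand [2k]. A private vertex lacks two units and asks its neighbours of degree
    above [k]; at most one neighbour is too low to be asked, so at least [k - 2 >= 2] pay. Vertices
    of degree above [k] can afford this by [many_private_deg]. *)
Lemma large_clique_critical : k * #|cover E| < 2 * #|E|.
Proof.
pose tr u v := [&& adj E u v, u \in pv & k < deg v].
have inE_ v : [set u | tr u v] = if k < deg v then nb v :&: pv else set0.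
  by apply/setP => u; rewrite inE /tr adjC; case: ifP; rewrite ?inE ?andbT ?andbF.
have outE v : [set u | tr v u] = if v \in pv then [set u in nb v | k < deg u] else set0.
  apply/setP => u; rewrite inE /tr; case: ifP => _; rewrite ?andbF ?inE //.
have dk x y : x \in cover E -> x \in pv -> y \in nb x -> k <= deg y.
  rewrite [_ \in pv]inE => xE /eqP dx yx.
  have [P [m [_ _ _ _ [_ mK mI mS]]]] := private_partners xE dx.
  have : size [:: m y] + k.-1 <= deg y.
    apply: (private_nbh_deg xE dx) => // u; rewrite mem_seq1 => /eqP ->.
    by rewrite (partner_adj mK mS) ?mK.
  by move: k0; clear; rewrite /=; lia.
have low1 x : x \in cover E -> x \in pv -> #|[set u in nb x | deg u <= k]| <= 1.
  move=> xE xpv; have /eqP dx : deg x == k.-1 by move: xpv; rewrite inE.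
  have [P [m [_ _ _ _ [_ mK mI mS]]]] := private_partners xE dx.
  apply/card_le1_eqP => y z; rewrite ![in _ \in _]inE -!in_nbh.
  move=> /andP[yx ly] /andP[zx lz]; apply/eqP; apply/negPn/negP => nzy.
  have dy : deg y = k by apply/eqP; rewrite eqn_leq ly (dk x).
  by have := second_nbh_deg xE dx mK mI mS yx dy zx nzy; rewrite ltnNge lz.
have split_nb x : deg x = #|[set u in nb x | deg u <= k]| + #|[set u in nb x | k < deg u]|.
  rewrite -(cardsID [set u | deg u <= k] (nb x)); congr (_ + _); apply: eq_card => u.
    by rewrite !inE.
  by rewrite !inE -ltnNge andbC.
have high_t v : k < deg v -> 2 * k + #|nb v :&: pv| <= 2 * deg v ?= iff
     ((deg v == k.+1) && (#|nb v :&: pv| == 2)).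
  have := @many_private_deg v; move: #|nb v :&: pv| #|nb v| k4; clear => t d k4 H kd.
  apply/leqifP; case: (leqP t 2) => [t2|/H]; last first.
    by case: (d =P k.+1) => /= ed; case: (t =P 2) => /= et; lia.
  by case: (d =P k.+1) => /= ed; case: (t =P 2) => /= et; lia.
have npv v : k < deg v -> v \notin pv.
  by rewrite inE; move: #|nb v| => d; clear; case: eqP => // ->; lia.
have le v : v \in cover E ->
    2 * k + #|[set u | tr u v]| <= 2 * deg v + #|[set u | tr v u]|.
  move=> vE; rewrite inE_ outE; case: (ltnP k (deg v)) => [hi|lo].
    by rewrite (negPf (npv v hi)) cards0 addn0 (high_t v hi).
  rewrite cards0 addn0; case: ifPn => [vpv|vpv].
    have := low1 v vE vpv; have := split_nb v; move: vpv; rewrite inE => /eqP.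
    by move: (#|nb v|) (#|[set _ in _ | _ <= _]|) (#|[set _ in _ | _ < _]|) k4; clear; lia.
  have := clique_deg sE crE k0 vE; move: vpv; rewrite inE cards0 addn0.
  by move: #|nb v| lo k0; clear; lia.
have eqa : \sum_(v in cover E) 2 * k = 2 * (k * #|cover E|).
  by rewrite sum_nat_const; clear; lia.
have eqb : \sum_(v in cover E) 2 * deg v = 2 * (2 * #|E|).
  by rewrite -big_distrr /= handshake.
have [|lt|tight] := discharging _ le.
- move=> u v /and3P[uv _ _]; rewrite (adj_cover uv); move: uv; rewrite adjC.
  exact: adj_cover.
- by move: lt; rewrite eqa eqb; clear; lia.
have high_eq v : v \in cover E -> k < deg v -> deg v = k.+1.
  move=> vE hv; have := tight v vE; rewrite inE_ outE hv (negPf (npv v hv)) cards0 addn0.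
  by move/eqP; rewrite (high_t v hv) => /andP[/eqP].
(* Equality at a private vertex means exactly two neighbours of degree above [k], hence [k = 4] and
   one neighbour of degree [k]. The other two would both have degree [k + 1], which [third_nbh_deg]
   forbids. *)
have no_pv x : x \in cover E -> x \notin pv.
  move=> xE; apply/negP => xpv; have /eqP dx : deg x == k.-1 by move: xpv; rewrite inE.
  have := tight x xE; rewrite inE_ outE xpv ltnNge dx.
  have -> : k.-1 <= k by move: k0; clear; lia.
  rewrite /= cards0 addn0 => hi2; have := split_nb x; rewrite dx => sp.
  have lo := low1 x xE xpv.
  have c2 : #|[set u in nb x | k < deg u]| = 2.
    by move: hi2; move: #|_| k4; clear; lia.
  have /card_gt0P [y] : 0 < #|[set u in nb x | deg u <= k]|.
    by move: sp; rewrite c2; move: #|_| k4; clear; lia.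
  have /card_gt1P [z [u [zh uh nzu]]] : 1 < #|[set u in nb x | k < deg u]| by rewrite c2.
  move: zh uh; rewrite ![in _ \in _]inE -!in_nbh => /andP[zx hz] /andP[ux hu] /andP[yx ly].
  have dy : deg y = k by apply/eqP; rewrite eqn_leq ly (dk x).
  have nbE w : w \in nb x -> w \in cover E by rewrite in_nbh adjC; apply: adj_cover.
  have nlow w : k < deg w -> w != y by move=> hw; apply: contraTneq hw => ->; rewrite dy ltnn.
  have [P [m [_ _ _ _ [_ mK mI mS]]]] := private_partners xE dx.
  have nuz : u != z by rewrite eq_sym.
  have := third_nbh_deg xE dx mK mI mS yx dy zx (high_eq z (nbE z zx) hz) ux
    (nlow z hz) (nlow u hu) nuz.
  by rewrite (high_eq u (nbE u ux) hu) ltnn.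
(* Without private vertices nothing is transferred, so equality means degree exactly [k]. *)
have regular v : v \in cover E -> deg v = k.
  move=> vE; have nk : deg v != k.-1 by move: (no_pv v vE); rewrite inE.
  have := clique_deg sE crE k0 vE; move: nk.
  have := tight v vE; rewrite inE_ outE (negPf (no_pv v vE)) cards0 addn0.
  case: (ltnP k (deg v)) => [hv|lo]; last first.
    by rewrite cards0; move: #|nb v| lo k4; clear; lia.
  suff -> : nb v :&: pv = set0 by rewrite cards0; move: #|nb v| hv k4; clear; lia.
  apply/setP => u; rewrite in_set0; apply/negP => /setIP[]; rewrite in_nbh adjC.
  by move/adj_cover/no_pv/negPf ->.
apply: False_ind.
have [K CK] := critical_exists crE; have /clique_setP [cK aK] := CK.
have KE v : v \in K -> v \in cover E.
  move=> vK; have /card_gt0P [u /setD1P[nuv uK]] : 0 < #|K :\ v|.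
    by move: cK; rewrite (cardsD1 v) vK; move: #|_| k4; clear; lia.
  by apply: (@adj_cover _ _ v u); apply: aK => //; rewrite eq_sym.
have sub v : v \in K -> K :\ v \subset nb v.
  by move=> vK; apply/subsetP => u /setD1P[nuv uK]; rewrite in_nbh aK // eq_sym.
have nbK v : v \in K -> exists2 v', v' \notin K & nb v = v' |: K :\ v.
  move=> vK; have cKv : #|K :\ v| = k.-1 by rewrite -cK (cardsD1 v K) vK.
  have /card_gt0P [v' /setDP[v'v v'K]] : 0 < #|nb v :\: (K :\ v)|.
    by rewrite cardsDS ?sub // regular ?KE // cKv; move: k0; clear; lia.
  have nv'v : v' != v.
    by apply: contraTneq v'v => ->; rewrite in_nbh adjxx.
  have v'K' : v' \notin K by move: v'K; rewrite in_setD1 nv'v.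
  exists v' => //; apply/esym/eqP; rewrite eqEcard subUset sub1set v'v sub //=.
  by rewrite regular ?KE // cardsU1 v'K cKv; move: k0; clear; lia.
have /card_gt0P [x0 x0K] : 0 < #|K| by rewrite cK.
have [x' x'K nx0] := nbK _ x0K.
have [K' [CK' x0K' x'K']] : exists S, [/\ C E S, x0 \in S & x' \in S].
  by apply: (clique_edge crE); rewrite -in_nbh nx0 setU11.
have sK' : K' \subset x' |: K.
  apply: subset_trans (clique_sub CK' x0K') _; rewrite nx0.
  by rewrite setUCA setD1K.
have cW : #|x' |: K| = k.+1 by rewrite cardsU1 x'K cK.
have /clique_setP [cK' aK'] := CK'.
have /cards1P [y ey] : #|(x' |: K) :\: K'| == 1.
  by rewrite cardsDS // cW cK' -addn1 addKn.
have yK : y \in K.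
  have : y \in (x' |: K) :\: K' by rewrite ey set11.
  by rewrite !inE => /andP[nyK' /predU1P[e|//]]; move: nyK'; rewrite e x'K'.
have inK' z : z \in K -> z != y -> z \in K'.
  move=> zK nzy; apply/negPn/negP => nzK'.
  have : z \in [set y] by rewrite -ey !inE zK nzK' orbT.
  by rewrite inE (negPf nzy).
(* All vertices of [K] have the same outside neighbour [x']. The one vertex [y] missed by [K'] is
   treated separately: a copy through [y] and its outside neighbour contains another vertex of [K],
   whose outside neighbour is already known. *)
have nbW z : z \in K -> nb z = x' |: K :\ z.
  suff W z' : z' \in K -> z' != y -> nb z' = x' |: K :\ z'.
    move=> zK; have [ezy|] := eqVneq z y; last exact: W.
    have [y' y'K ny] := nbK _ zK.
    have [S [CS zS y'S]] : exists S, [/\ C E S, z \in S & y' \in S].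
      by apply: (clique_edge crE); rewrite -in_nbh ny setU11.
    have /clique_setP [cS aS] := CS.
    have nzy' : z != y' by apply: contraNneq y'K => <-.
    have /card_gt0P [w] : 0 < #|S :\ z :\ y'|.
      move: cS; rewrite (cardsD1 z S) zS (cardsD1 y' (S :\ z)) !inE eq_sym nzy' y'S.
      by move: #|_| k4; clear; lia.
    rewrite !inE => /and3P[nwy' nwz wS].
    have wK : w \in K.
      have := subsetP (clique_sub CS zS) w wS; rewrite ny !inE (negPf nwz) (negPf nwy').
      by [].
    have : adj E w y' by apply: aS.
    rewrite -in_nbh W // -?ezy // !inE (negPf y'K) andbF orbF => /eqP e.
    by rewrite ny e.
  move=> z'K nz'y; apply/esym/eqP; rewrite eqEcard; apply/andP; split.
    rewrite subUset sub1set sub // andbT in_nbh; apply: aK' => //; first exact: inK'.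
    by apply: contraNneq x'K => <-.
  rewrite regular ?KE // cardsU1 in_setD1 (negPf x'K) andbF -cK (cardsD1 z' K) z'K.
  by [].
(* Four distinct vertices of [K] exist since [3 < k]. A copy meeting [K] omits at most one vertex of
   the [(k+1)]-set [x' |: K], so it contains [a] and [c], or [d] and [e]. *)
have [a [c [d [e [uK sK]]]]] : exists a c d e, uniq [:: a; c; d; e] /\
    {subset [:: a; c; d; e] <= K}.
  have := enum_uniq (mem K); have := cK; rewrite cardE.
  have : {subset enum K <= K} by move=> z; rewrite mem_enum.
  case: (enum K) => [|a [|c [|d [|e s]]]] sub' sz; try by move: k4; rewrite -sz.
  rewrite -[_ :: _]/([:: a; c; d; e] ++ s) cat_uniq => /andP[u4 _].
  exists a, c, d, e; split=> // z zs; apply: sub'.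
  by rewrite -[_ :: _]/([:: a; c; d; e] ++ s) mem_cat zs.
have inK z : z \in [:: a; c; d; e] -> z \in K by apply: sK.
apply: (@irreducible [:: (a, c); (d, e)] a).
- by rewrite (@perm_uniq _ _ [:: a; c; d; e]) //; apply/permP => p /=; rewrite [p d + _]addnCA.
- by rewrite mem_head.
- by apply/KE/inK; rewrite mem_head.
move=> S z CS zS zl; have zK : z \in K.
  by apply: inK; move: zl; rewrite !inE => /or4P[] ->; rewrite ?orbT.
have sSW : S \subset x' |: K.
  by apply: subset_trans (clique_sub CS zS) _; rewrite nbW // setUCA setD1K.
have /clique_setP [cS _] := CS.
have c1 : #|(x' |: K) :\: S| <= 1 by rewrite cardsDS // cW cS -addn1 addKn.
have inW w : w \in [:: a; c; d; e] -> w \notin S -> w \in (x' |: K) :\: S.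
  by move=> wl wS; rewrite !inE wS inK ?orbT.
have two w w' : w \in [:: a; c; d; e] -> w' \in [:: a; c; d; e] -> w != w' ->
    (w \in S) || (w' \in S).
  move=> wl w'l; apply: contraNT; rewrite negb_or => /andP[wS w'S].
  by have /card_le1_eqP := c1; move/(_ w w' (inW _ wl wS) (inW _ w'l w'S)) ->.
move: uK; rewrite /= !inE !negb_or => /and4P[/and3P[nac nad nae] /andP[ncd nce] nde _].
have [la lc ld le'] : [/\ a \in [:: a; c; d; e], c \in [:: a; c; d; e],
    d \in [:: a; c; d; e] & e \in [:: a; c; d; e]] by rewrite !inE !eqxx !orbT.
have dein : (d, e) \in [:: (a, c); (d, e)] by rewrite !inE eqxx orbT.
have [aS|aS] := boolP (a \in S); last first.
  by move: (two _ _ la ld nad) (two _ _ la le' nae); rewrite (negPf aS); apply: hits_paired dein.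
have [cS'|cS'] := boolP (c \in S); first exact: (hits_paired (mem_head _ _)).
by move: (two _ _ lc ld ncd) (two _ _ lc le' nce); rewrite (negPf cS'); apply: hits_paired dein.
Qed.

End LargeCliques.

(** * Critical graphs for triangles, with pairings of maximum degree two *)

Section Triangles.
Variables (n : nat) (E : {set {set 'I_n}}).
Hypothesis sE : E \subset pairs n.
Hypothesis crE : critical 2 (@clique_set n 3) E.

Local Notation C := (@clique_set n 3).
Local Notation nb := (nbh E).
Local Notation deg v := #|nbh E v|.
Implicit Types (S Q : {set 'I_n}) (u v x y z : 'I_n).

Let k0 : 0 < 3. Proof. by []. Qed.
Let irreducible X P0 x :=
  @critical_irreducible n 2 C (@clique_set_mono n 3) (@clique_set_local n 3) E crE X P0 x.

(** By [private_pairing] each neighbour of [x] has two partners. They are adjacent to it, because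
    every pair lies in a triangle, and differ from the two other vertices of the triangle at [x],
    which is not hit; so its degree is at least four. *)
Lemma triangle_private_nbh x y : x \in cover E -> deg x = 2 -> y \in nb x ->
  exists2 z, nb x = [set y; z] & [/\ y != z, adj E y z, 3 < deg y & 3 < deg z].
Proof.
move=> xE dx yx; have [z nx nyz] := card2_split dx yx.
have zx : z \in nb x by rewrite nx set22.
have yz : adj E y z.
  by apply: (private_adj sE crE k0 xE dx) => //; rewrite -in_nbh.
suff deg4 u v : adj E x u -> adj E x v -> adj E u v -> 3 < deg u.
  by exists z => //; split=> //; [apply: (deg4 y z)|apply: (deg4 z y)];
    rewrite ?(adjC _ z y) // -in_nbh.
move=> xu xv uv.
have [P [sP iP dP hP [pP nh fP]]] := private_pairing sE crE k0 (ltn0Sn 1) xE dx.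
have xuv : x != v := adj_neq sE xv.
have := fP u; rewrite in_nbh => /(_ xu) d2.
have : #|[set w | P u w] :|: [set x; v]| <= deg u.
  apply/subset_leq_card/subsetP => w /setUP[|].
    rewrite inE in_nbh => Puw; have [S [/clique_setP [_ aS] _ uS wS]] := pP _ _ Puw.
    by apply: aS => //; apply: contraTneq Puw => ->; rewrite iP.
  by rewrite !inE => /orP[] /eqP -> //; rewrite adjC.
rewrite cardsU d2 cards2 xuv disjoint_setI0 ?cards0 //.
apply/pred0P => w /=; rewrite !inE; apply/negP => /andP[Puw wxv].
case/negP: nh; apply/hitsP; exists u, w; rewrite !inE xu orbT; split=> //.
by case/orP: wxv => /eqP ->; rewrite ?eqxx ?xv ?orbT.
Qed.

Let pv := [set v in cover E | deg v == 2].
(** With charge [2 deg - 6], a degree four vertex can serve only two private neighbours. The weak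
    vertices are those asked for more; they pass the missing unit on. *)
Let wk := [set v | (deg v == 4) && (2 < #|nb v :&: pv|)].

Lemma pvP x : x \in pv -> x \in cover E /\ deg x = 2.
Proof. by rewrite inE => /andP[-> /eqP]. Qed.

Lemma private_nbh_notin x y : x \in pv -> y \in nb x -> y \notin pv.
Proof.
move=> /pvP [xE dx] yx; have [z _ [_ _ d4 _]] := triangle_private_nbh xE dx yx.
by apply: contraL d4 => /pvP [_ ->].
Qed.

(* A degree 4 vertex with three degree 2 neighbours: its fourth neighbour [u] cannot be
   spared by the pairing, since otherwise the pair [y,u] would hit all three triangles. *)
Lemma weak_nbh y : y \in wk -> exists u, [/\ nb y = u |: nb y :&: pv, u \notin pv,
  5 < deg u & {in nb y :&: pv, forall x, nb x = [set y; u]}].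
Proof.
rewrite inE => /andP[/eqP d4 t3].
have /card_gt0P [x1 x1p] : 0 < #|nb y :&: pv| by apply: ltn_trans t3.
have inpv x : x \in nb y :&: pv -> [/\ x \in pv, y \in nb x & x \in nb y].
  by rewrite in_setI => /andP[yx xp]; split=> //; move: yx; rewrite !in_nbh adjC.
have [p1 yx1 _] := inpv _ x1p; have [x1E dx1] := pvP p1.
have [u nx1 [nyu yu _ d4u]] := triangle_private_nbh x1E dx1 yx1.
have ux1 : u \in nb x1 by rewrite nx1 set22.
have npu : u \notin pv := private_nbh_notin p1 ux1.
have ny : nb y = u |: nb y :&: pv.
  apply/esym/eqP; rewrite eqEcard subUset sub1set in_nbh yu subsetIl d4 cardsU1.
  by rewrite in_setI (negPf npu) andbF.
have nbx x : x \in nb y :&: pv -> nb x = [set y; u].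
  move=> xp; have [px yx _] := inpv _ xp; have [xE dx] := pvP px.
  have [z nx [nyz yz _ _]] := triangle_private_nbh xE dx yx.
  have zp : z \notin pv by apply: (private_nbh_notin px); rewrite nx set22.
  have : z \in nb y by rewrite in_nbh.
  by rewrite {1}ny in_setU1 in_setI (negPf zp) andbF orbF nx => /eqP ->.
exists u; split=> //.
have [P [sP iP dP hP [pP nh fP]]] := private_pairing sE crE k0 (ltn0Sn 1) x1E dx1.
have Padj a c : P a c -> adj E a c.
  move=> Pac; have [S [/clique_setP [_ aS] _ aS' cS']] := pP _ _ Pac.
  by apply: aS => //; apply: contraTneq Pac => ->; rewrite iP.
have Kyu : {in [set x1; y; u] &, forall a c, P a c = false}.
  move=> a c aK cK; apply/negP => Pac; case/negP: nh; apply/hitsP; exists a, c.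
  by rewrite nx1 setUA; split.
have Py w : P y w -> w \in nb y :&: pv.
  move=> Pyw; have : w \in nb y by rewrite in_nbh Padj.
  rewrite {1}ny in_setU1 => /predU1P[ew|//].
  by move: Pyw; rewrite ew Kyu // !inE eqxx ?orbT.
case: (boolP [exists w, P u w && (w \in nb y :&: pv)]); last first.
  move/existsPn => no.
  have : #|[set w | P u w] :|: (y |: nb y :&: pv)| <= deg u.
    apply/subset_leq_card/subsetP => a; rewrite in_setU in_setU1 => /or3P[|/eqP ->|ap].
    - by rewrite inE in_nbh; apply: Padj.
    - by rewrite in_nbh adjC.
    - by rewrite in_nbh adjC -in_nbh nbx // set22.
  have ynW : y \notin nb y :&: pv by apply/negP => /setIP[]; rewrite in_nbh adjxx.
  have dj : [set w | P u w] :&: (y |: nb y :&: pv) = set0.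
    apply/setP => a; rewrite in_setI in_setU1 inE in_set0.
    apply/negP => /andP[Pua /orP[/eqP ea|ap]].
      by move: Pua; rewrite ea Kyu // !inE eqxx ?orbT.
    by have := no a; rewrite Pua ap.
  rewrite cardsU dj cards0 fP // cardsU1 ynW.
  by move: #|nb y :&: pv| #|nb u| t3; clear; lia.
case/existsP => w /andP[Puw wp].
case: crE.1.
pose W := nb y :&: pv.
pose P' a c := P a c && (a \notin W) && (c \notin W) || (a == y) && (c == u)
   || (a == u) && (c == y).
exists P'; split.
- move=> a c; rewrite /P' sP -!andbA [(a \notin _) && _]andbC.
  by rewrite [(a == y) && _]andbC [(a == u) && _]andbC -!orbA [X in _ || X]orbC.
- move=> a; rewrite /P' iP /=; have [->|//] := eqVneq a y; first by rewrite (negPf nyu).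
  by rewrite andbF.
- move=> a; have [->|nay] := eqVneq a y.
    have P'y e : P' y e -> e = u.
      rewrite /P' eqxx (negPf nyu) orbF => /orP[/andP[/andP[/Py yW _]]|/eqP //].
      by rewrite -/W in yW; rewrite yW.
    apply: (@leq_trans 1) => //; apply/card_le1_eqP => c d.
    by rewrite [_ \in _]inE [in X in _ -> X]inE => /P'y -> /P'y ->.
  have [->|nau] := eqVneq a u.
    apply: leq_trans (_ : #|y |: [set c | P u c] :\ w| <= 2).
      apply/subset_leq_card/subsetP => c; rewrite !inE /P' eqxx (eq_sym u) (negPf nyu) /= orbF.
      case/orP => [/andP[/andP[Puc _] ncW]|->//]; rewrite Puc andbT orbC.
      by rewrite (contraNneq _ ncW) // => ->.
    rewrite cardsU1; have := dP u; rewrite (cardsD1 w) inE Puw.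
    by case: (_ \notin _); move: #|_|; clear; lia.
  apply: leq_trans (dP a); apply/subset_leq_card/subsetP => c.
  by rewrite !inE /P' (negPf nay) (negPf nau) /= !orbF => /andP[/andP[]].
- move=> S CS.
  case: (boolP [exists x, (x \in S) && (x \in W)]) => [/existsP [x /andP[xS xW]]|/existsPn noW].
    have [px _ _] := inpv _ xW; have [xE dx] := pvP px.
    have SE := private_clique sE k0 dx CS xS.
    apply/hitsP; exists y, u; rewrite SE nbx // !inE !eqxx ?orbT; split=> //.
    by rewrite /P' !eqxx orbT.
  have out a : a \in S -> a \notin W by move=> aS; have := noW a; rewrite aS.
  have /hitsP [a [c [aS cS Pac]]] : hits P S by apply: hP => //; have := noW x1; rewrite x1p andbT.
  by apply/hitsP; exists a, c; split=> //; rewrite /P' Pac !out.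
Qed.

(** A complete graph on at most three vertices has maximum degree two, so with [b = 2] all pairs
    inside [X] may be used at once. *)
Lemma triangle_complete_reduction (X : {set 'I_n}) x : x \in X -> x \in cover E -> #|X| <= 3 ->
  (forall S y, C E S -> y \in S -> y \in X -> 1 < #|S :&: X|) -> False.
Proof.
move=> xX xE c3 h.
apply: (@irreducible X (fun u v => [&& u \in X, v \in X & u != v]) x) => //.
- by move=> u v; rewrite andbCA eq_sym.
- by move=> u; rewrite eqxx !andbF.
- by move=> u v /and3P[].
- move=> v; have [vX|vX] := boolP (v \in X); last first.
    by rewrite (eq_card (B := pred0)) ?card0 // => u; rewrite !inE.
  rewrite -ltnS; apply: leq_trans c3; rewrite (cardsD1 v X) vX ltnS.
  by apply/subset_leq_card/subsetP => u; rewrite !inE /= eq_sym andbC.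
move=> S y CS yS yX; have /card_gt1P [u [v [/setIP[uS uX] /setIP[vS vX] nuv]]] := h S y CS yS yX.
by apply/hitsP; exists u, v; rewrite uX vX nuv.
Qed.

Lemma nbh_cover v u : u \in nb v -> u \in cover E.
Proof. by rewrite in_nbh adjC; apply: adj_cover. Qed.

Lemma private_nbr_deg v x : x \in nb v -> x \in pv -> 3 < deg v.
Proof.
move=> xv xp; have [xE dx] := pvP xp; have vx : v \in nb x by rewrite in_nbh adjC -in_nbh.
by have [z _ [_ _ -> _]] := triangle_private_nbh xE dx vx.
Qed.

Lemma private_third v x : x \in nb v -> x \in pv ->
  exists u, [/\ u \in nb v, u \in nb x, u \notin pv & 3 < deg u].
Proof.
move=> xv xp; have [xE dx] := pvP xp; have vx : v \in nb x by rewrite in_nbh adjC -in_nbh.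
have [z nx [_ vz _ dz]] := triangle_private_nbh xE dx vx; exists z.
by rewrite in_nbh nx set22; split=> //; apply: (private_nbh_notin xp); rewrite nx set22.
Qed.

Lemma weak_nbr_deg v y : y \in nb v -> y \in wk -> v \notin pv -> 5 < deg v.
Proof.
move=> yv /weak_nbh [u [ny _ d6 _]] vp.
have : v \in nb y by rewrite in_nbh adjC -in_nbh.
by rewrite ny in_setU1 in_setI (negPf vp) andbF orbF => /eqP ->.
Qed.

(** Degree six is the only degree at which serving every neighbour is tight. A weak neighbour [y]
    and its three or more private neighbours, all adjacent to [v], leave at most two places [R]. A
    weak vertex in [R] would need three private neighbours inside [R], and a private vertex in [R]
    would bring a weak one with it. *)
Lemma weak_deg6 v : deg v = 6 -> nb v \subset pv :|: wk -> False.
Proof.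
move=> d6 /subsetP sub.
have vp : v \notin pv by apply/negP => /pvP [_]; rewrite d6.
have /card_gt0P [a0 a0v] : 0 < deg v by rewrite d6.
have [y yv yw] : exists2 y, y \in nb v & y \in wk.
  have /setUP[a0p|] := sub a0 a0v; last by exists a0.
  have [u [uv _ up _]] := private_third a0v a0p.
  by exists u => //; have := sub u uv; rewrite in_setU (negPf up).
have weakP c : c \in nb v -> c \in wk -> [/\ nb c = v |: nb c :&: pv,
    2 < #|nb c :&: pv| & {in nb c :&: pv, forall x, nb x = [set c; v]}].
  move=> cv cw; have [u [nc up _ nx]] := weak_nbh cw.
  have : v \in nb c by rewrite in_nbh adjC -in_nbh.
  rewrite {1}nc in_setU1 in_setI (negPf vp) andbF orbF => /eqP ev; rewrite ev; split=> //.
  by move: cw; rewrite inE => /andP[].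
have [ny ty nW] := weakP y yv yw.
have yp : y \notin pv by move: yw; rewrite inE => /andP[/eqP d4 _]; apply/negP => /pvP [_]; rewrite d4.
set W := nb y :&: pv in ny ty nW.
have WU : y |: W \subset nb v.
  rewrite subUset sub1set yv; apply/subsetP => x xW.
  by rewrite in_nbh adjC -in_nbh nW // set22.
have yW : y \notin W by rewrite in_setI (negPf yp) andbF.
pose R := nb v :\: (y |: W).
have cR : #|R| <= 2.
  by rewrite cardsDS // d6 cardsU1 yW; move: #|W| ty; clear; lia.
have Rw c : c \in R -> c \in wk -> False.
  move=> /setDP[cv cyW] cw; have [_ tc nc] := weakP c cv cw.
  have : nb c :&: pv \subset R.
    apply/subsetP => x xc; have nx := nc x xc; apply/setDP; split.
      by rewrite in_nbh adjC -in_nbh nx set22.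
    have xp : x \in pv by case/setIP: xc.
    rewrite in_setU1 negb_or; apply/andP; split.
      by apply: contraNneq yp => <-.
    apply/negP => xW; have := nW x xW; rewrite nx => /setP /(_ c).
    rewrite !inE eqxx /= => /esym /orP[/eqP e|/eqP e].
      by move: cyW; rewrite e in_setU1 eqxx.
    by move: cv; rewrite e in_nbh adjxx.
  by move/subset_leq_card => le; move: (leq_trans tc (leq_trans le cR)).
have /card_gt0P [a aR] : 0 < #|R|.
  rewrite cardsDS // d6 cardsU1 yW.
  have : #|W| <= 3.
    have : #|nb y| = 4 by move: yw; rewrite inE => /andP[/eqP].
    rewrite ny cardsU1 in_setI (negPf vp) andbF.
    by move: #|W|; clear; lia.
  by move: #|W|; clear; lia.
have /setDP[av ayW] := aR.
have ap : a \in pv.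
  by have /setUP[//|aw] := sub a av; case: (Rw a aR aw).
have [c [cv ca cp dc]] := private_third av ap.
have cw : c \in wk by have := sub c cv; rewrite in_setU (negPf cp).
apply: (Rw c _ cw); apply/setDP; split=> //.
apply/negP; rewrite in_setU1 => /orP[/eqP ecy|/setIP[_ cp']]; last by rewrite cp' in cp.
case/negP: ayW; rewrite in_setU1 in_setI ap andbT; apply/orP; right.
by rewrite in_nbh adjC -in_nbh -ecy.
Qed.

(** Charge [2 deg], demand [6]. A private vertex lacks two units and takes one from each neighbour.
    A weak vertex passes its missing unit to its only non-private neighbour, which has degree at
    least six and can therefore serve all its neighbours. *)
Lemma triangle_critical : 3 * #|cover E| < 2 * #|E|.
Proof.
pose tr v w := adj E v w && ((v \in pv) || (v \in wk) && (w \notin pv)).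
have wkp v : v \in wk -> v \notin pv.
  by rewrite [_ \in wk]inE => /andP[/eqP d4 _]; apply/negP => /pvP [_]; rewrite d4.
have in_pv v : v \in pv -> [set u | tr u v] = set0.
  move=> vp; apply/setP => u; rewrite inE in_set0 /tr vp andbF orbF.
  apply/negP => /andP[uv up]; have := private_nbh_notin up (y := v).
  by rewrite in_nbh vp => /(_ uv).
have in_npv v : v \notin pv -> [set u | tr u v] = nb v :&: (pv :|: wk).
  move=> vp; apply/setP => u; rewrite inE in_setI in_setU in_nbh /tr vp andbT.
  by rewrite adjC.
have out_pv v : v \in pv -> [set u | tr v u] = nb v.
  by move=> vp; apply/setP => u; rewrite inE in_nbh /tr vp andbT.
have out_wk v : v \in wk -> #|[set u | tr v u]| = 1.
  move=> vw; have [w [nv wp _ _]] := weak_nbh vw.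
  rewrite -(cards1 w); apply: eq_card => u.
  rewrite [LHS]inE in_set1 /tr (negPf (wkp v vw)) vw /= -in_nbh nv in_setU1 in_setI.
  by have [->|_] := eqVneq u w; rewrite ?wp //=; case: (u \in pv); rewrite ?andbF.
have out_0 v : v \notin pv -> v \notin wk -> [set u | tr v u] = set0.
  by move=> vp vw; apply/setP => u; rewrite !inE -/pv -/wk /tr (negPf vp) (negPf vw) andbF.
have t_lt v : 0 < #|nb v :&: pv| -> #|nb v :&: pv| < deg v.
  case/card_gt0P => x /setIP[xv xp]; have [u [uv _ up _]] := private_third xv xp.
  apply: proper_card; apply/properP; split; first exact: subsetIl.
  by exists u => //; rewrite in_setI (negPf up) andbF.
have inle v : v \notin pv -> deg v <= 5 -> nb v :&: (pv :|: wk) = nb v :&: pv.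
  move=> vp d5; rewrite setIUr; apply/setUidPl/subsetP => y /setIP[yv yw].
  by have := weak_nbr_deg yv yw vp; rewrite ltnNge d5.
have le v : v \in cover E -> 6 + #|[set u | tr u v]| <= 2 * deg v + #|[set u | tr v u]|.
  move=> vE; have [vp|vp] := boolP (v \in pv).
    by rewrite in_pv // out_pv // cards0; have [_ ->] := pvP vp.
  rewrite in_npv //; have d3 : 2 < deg v.
    rewrite ltn_neqAle eq_sym (clique_deg sE crE k0 vE) andbT.
    by move: vp; rewrite inE vE.
  have [d6|d5] := ltnP 5 (deg v).
    have : #|nb v :&: (pv :|: wk)| <= deg v by apply/subset_leq_card/subsetIl.
    by move: #|nb v :&: _| #|nb v| #|[set _ | _]| d6; clear; lia.
  rewrite inle //; have [vw|vw] := boolP (v \in wk).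
    rewrite out_wk //; move: vw; rewrite inE => /andP[/eqP d4 t3].
    by have := t_lt v; rewrite d4; move: #|nb v :&: pv| t3; clear; lia.
  rewrite out_0 // cards0 addn0.
  have [t0|tp] := posnP #|nb v :&: pv|; first by rewrite t0; move: #|nb v| d3; clear; lia.
  have d4 : 3 < deg v by move: (tp); case/card_gt0P => x /setIP[xv xp]; apply: private_nbr_deg xv xp.
  have := t_lt v tp; move: vw; rewrite inE; move: #|nb v :&: pv| #|nb v| d4 d5; clear; lia.
have eqa : \sum_(v in cover E) 6 = 2 * (3 * #|cover E|) by rewrite sum_nat_const; clear; lia.
have eqb : \sum_(v in cover E) 2 * deg v = 2 * (2 * #|E|).
  by rewrite -big_distrr /= handshake.
have [|lt|tight] := discharging _ le.
- move=> u v /andP[uv _]; rewrite (adj_cover uv); move: uv; rewrite adjC.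
  exact: adj_cover.
- by move: lt; rewrite eqa eqb; clear; lia.
apply: False_ind.
have d5 v : v \in cover E -> deg v <= 5.
  move=> vE; rewrite leqNgt; apply/negP => d6; have := tight v vE.
  have vp : v \notin pv by apply/negP => /pvP [_ d2]; rewrite d2 in d6.
  have vw : v \notin wk by rewrite inE; apply/negP => /andP[/eqP d4 _]; rewrite d4 in d6.
  rewrite in_npv // out_0 // cards0 addn0 => tv.
  have le_ : #|nb v :&: (pv :|: wk)| <= deg v by apply/subset_leq_card/subsetIl.
  have e6 : deg v = 6 by move: #|nb v :&: _| #|nb v| d6 tv le_; clear; lia.
  apply: (weak_deg6 e6); apply/setIidPl/eqP; rewrite eqEcard subsetIl.
  by rewrite e6 in tv *; move: #|nb v :&: _| tv; clear; lia.
have now v : v \in cover E -> v \notin wk.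
  move=> vE; apply/negP => /weak_nbh [u [nv _ d6 _]].
  have uE : u \in cover E by apply: (@nbh_cover v); rewrite nv setU11.
  by have := d5 u uE; rewrite leqNgt d6.
(* Equality with degree at most five and no weak vertices: the numbers of private neighbours for
   degrees 3, 4, 5 must be 0, 2, 4. *)
have shape v : v \in cover E -> v \notin pv ->
    deg v = 3 \/ 3 < deg v /\ [/\ #|nb v :\: pv| <= 2 & 0 < #|nb v :&: pv|].
  move=> vE vp; have := tight v vE; rewrite in_npv // out_0 ?now // cards0 addn0 inle ?d5 //.
  have := cardsID pv (nb v); have := d5 v vE; have := clique_deg sE crE k0 vE.
  by move: #|nb v :&: _| #|nb v| #|nb v :\: _|; clear; lia.
have [x|nop] := classic (exists x, x \in pv).
  pose hv := [set v in cover E | 3 < deg v].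
  have hvp v : v \in hv -> v \notin pv.
    by rewrite inE => /andP[_ d4]; apply/negP => /pvP [_ d2]; rewrite d2 in d4.
  case: x => x xp; have [xE dx] := pvP xp.
  (* By [shape], a vertex of degree at least four has at most two non-private neighbours, so pairing
     all adjacent vertices of [hv] respects the bound two; each triangle through a private vertex or
     through [hv] contains such a pair. *)
  pose P0 u v := [&& adj E u v, u \in hv & v \in hv].
  have hit_pv S y : C E S -> y \in S -> y \in pv -> hits P0 S.
    move=> CS yS yp; have [yE dy] := pvP yp; have SE := private_clique sE k0 dy CS yS.
    have /card_gt0P [a ay] : 0 < deg y by rewrite dy.
    have [c ny [nac ac da dc]] := triangle_private_nbh yE dy ay.
    have cy : c \in nb y by rewrite ny set22.
    apply/hitsP; exists a, c; rewrite SE !in_setU1 ay cy !orbT; split=> //.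
    by rewrite /P0 ac !inE !(nbh_cover (v := y)) // da dc.
  apply: (@irreducible (pv :|: hv) P0 x) => //.
  - by rewrite in_setU xp.
  - by move=> u v; rewrite /P0 adjC [(u \in hv) && _]andbC.
  - by move=> u; rewrite /P0 adjxx.
  - by move=> u v /and3P[_ uh _]; rewrite in_setU uh orbT.
  - move=> v; have [vh|vh] := boolP (v \in hv); last first.
      by rewrite (eq_card (B := pred0)) ?card0 // => u; rewrite !inE /P0 (negPf vh) andbF.
    apply: leq_trans (_ : #|nb v :\: pv| <= 2).
      apply/subset_leq_card/subsetP => u; rewrite inE => /and3P[vu _ uh].
      by rewrite in_setD hvp // in_nbh.
    have vp := hvp v vh; move: vh; rewrite inE => /andP[vE d4].
    by have [e3|[_ [-> _]]] := shape v vE vp; first by rewrite e3 in d4.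
  - move=> S y CS yS /setUP[yp|yh]; first exact: hit_pv CS yS yp.
    have [/existsP [z /andP[zS zp]]|/existsPn noz] :=
      boolP [exists z, (z \in S) && (z \in pv)]; first exact: hit_pv CS zS zp.
    have yp := hvp y yh; move: (yh); rewrite inE => /andP[yE d4].
    have [e3|[_ [c2]]] := shape y yE yp; first by rewrite e3 in d4.
    case/card_gt0P => z /setIP[zy zp]; have [u [uy _ up du]] := private_third zy zp.
    have SE : S :\ y = nb y :\: pv.
      apply/eqP; rewrite eqEcard; apply/andP; split.
        apply/subsetP => w /setD1P[nwy wS]; rewrite in_setD.
        have := noz w; rewrite wS /= => ->.
        by have := subsetP (clique_sub CS yS) w wS; rewrite in_setU1 (negPf nwy).
      apply: leq_trans c2 _; have /clique_setP [] := CS.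
      by rewrite (cardsD1 y) yS; move: #|S :\ y|; clear; lia.
    have uS : u \in S.
      have : u \in S :\ y by rewrite SE in_setD up.
      by case/setD1P.
    apply/hitsP; exists y, u; split=> //; rewrite /P0 -in_nbh uy yh inE du andbT /=.
    exact: (nbh_cover uy).
(* Without private vertices the tight graph is cubic. The edge from a triangle to an outside vertex
   [x'] lies in a second triangle, which shares an edge with the first. *)
have cubic v : v \in cover E -> deg v = 3.
  move=> vE; have vp : v \notin pv by apply/negP => vp; case: nop; exists v.
  have [//|[_ [_ /card_gt0P [x /setIP[_ xp]]]]] := shape v vE vp.
  by case: nop; exists x.
have [S0 CS0] := critical_exists crE; have /clique_setP [cS0 aS0] := CS0.
have SE0 v : v \in S0 -> v \in cover E.
  move=> vS; have /card_gt0P [u /setD1P[nuv uS]] : 0 < #|S0 :\ v|.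
    by move: cS0; rewrite (cardsD1 v) vS; move: #|S0 :\ v|; clear; lia.
  by apply: (@adj_cover _ _ v u); apply: aS0 => //; rewrite eq_sym.
have nbS v : v \in S0 -> exists2 v', v' \notin S0 & nb v = v' |: S0 :\ v.
  move=> vS; have sub : S0 :\ v \subset nb v.
    by apply/subsetP => u /setD1P[nuv uS]; rewrite in_nbh aS0 // eq_sym.
  have cSv : #|S0 :\ v| = 2 by move: cS0; rewrite (cardsD1 v) vS; move: #|S0 :\ v|; clear; lia.
  have /card_gt0P [v' /setDP[v'v v'S]] : 0 < #|nb v :\: (S0 :\ v)|.
    by rewrite cardsDS // cubic ?SE0 // cSv.
  have nv'v : v' != v by apply: contraTneq v'v => ->; rewrite in_nbh adjxx.
  have v'S' : v' \notin S0 by move: v'S; rewrite in_setD1 nv'v.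
  exists v' => //; apply/esym/eqP; rewrite eqEcard subUset sub1set v'v sub //=.
  by rewrite cubic ?SE0 // cardsU1 v'S cSv.
have /card_gt0P [x xS] : 0 < #|S0| by rewrite cS0.
have [x' x'S nx] := nbS x xS.
have [S1 [CS1 xS1 x'S1]] : exists S, [/\ C E S, x \in S & x' \in S].
  by apply: (clique_edge crE); rewrite -in_nbh nx setU11.
have /clique_setP [cS1 aS1] := CS1.
have nxx' : x != x' by apply: contraNneq x'S => <-.
have /card_gt0P [y] : 0 < #|S1 :\ x :\ x'|.
  move: cS1; rewrite (cardsD1 x S1) xS1 (cardsD1 x' (S1 :\ x)) !inE eq_sym nxx' x'S1.
  by move: #|_|; clear; lia.
rewrite !inE => /and3P[nyx' nyx yS1].
have yS : y \in S0.
  have := subsetP (clique_sub CS1 xS1) y yS1.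
  by rewrite nx !inE (negPf nyx) (negPf nyx').
have yx' : adj E y x' by apply: aS1.
have ny : nb y = x' |: S0 :\ y.
  have [y' y'S ny] := nbS y yS; suff -> : x' = y' by [].
  by move: yx'; rewrite -in_nbh ny !inE (negPf x'S) andbF orbF => /eqP.
have /card_gt0P [z] : 0 < #|S0 :\ x :\ y|.
  move: cS0; rewrite (cardsD1 x S0) xS (cardsD1 y (S0 :\ x)) !inE nyx yS.
  by move: #|_|; clear; lia.
rewrite !inE => /and3P[nzy nzx zS].
have S0E : S0 = [set x; y; z].
  apply/esym/eqP; rewrite eqEcard cS0; apply/andP; split.
    by apply/subsetP => w; rewrite !inE -orbA => /or3P[] /eqP ->.
  by rewrite -setUA cardsU1 cards2 !inE negb_or !(eq_sym x) nyx nzx eq_sym nzy.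
(* Either [x'] completes the triangle to a [K_4], and all pairs in [S0] are used, or the two
   triangles share just the edge from [x] to [y], and that pair is enough. *)
have [zx'|zx'] := boolP (adj E z x').
  have nz : nb z = x' |: S0 :\ z.
    have [z' z'S nz] := nbS z zS; suff -> : x' = z' by [].
    by move: zx'; rewrite -in_nbh nz !inE (negPf x'S) andbF orbF => /eqP.
  apply: (@triangle_complete_reduction S0 x) => //; first exact: SE0.
    by rewrite cS0.
  move=> S v CS vS vS0.
  have nv : nb v = x' |: S0 :\ v by move: vS0; rewrite S0E !inE -orbA => /or3P[] /eqP ->; rewrite -?S0E.
  have /clique_setP [cS aS] := CS.
  have sub := clique_sub CS vS; rewrite nv setUCA setD1K // in sub.
  have : #|S :\: S0| <= 1.
    rewrite -(cards1 x'); apply/subset_leq_card/subsetP => u /setDP[uS uS0].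
    by have := subsetP sub u uS; rewrite in_setU1 (negPf uS0) orbF in_set1.
  by have := cardsID S0 S; rewrite cS; move: #|_ :&: _| #|_ :\: _|; clear; lia.
apply: (@triangle_complete_reduction [set x; y] x).
- exact: set21.
- exact: SE0.
- by rewrite cards2; case: eqP.
move=> S v CS vS vxy; have /clique_setP [cS aS] := CS.
have nv : nb v = x' |: S0 :\ v by move: vxy; rewrite !inE => /orP[] /eqP ->.
have vS0 : v \in S0 by move: vxy; rewrite !inE => /orP[] /eqP ->.
have sub := clique_sub CS vS; rewrite nv setUCA setD1K // in sub.
have : #|S :\: [set x; y]| <= 1.
  apply/card_le1_eqP => a c /setDP[aS' axy] /setDP[cS' cxy].
  have mem w : w \in S -> w \notin [set x; y] -> w = x' \/ w = z.
    move=> wS wxy; have := subsetP sub w wS; rewrite S0E.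
    by move: wxy; rewrite !inE => /negPf -> /= => /orP[] /eqP ->; [left|right].
  have nadj : x' \in S -> z \in S -> False.
    move=> x'S' zS'; case/negP: zx'; apply: aS => //.
    by apply: contraNneq x'S => <-.
  have [ea|ea] := mem a aS' axy; have [ec|ec] := mem c cS' cxy; rewrite ea ec //.
    by case: nadj; rewrite -?ea -?ec.
  by case: nadj; rewrite -?ea -?ec.
by have := cardsID [set x; y] S; rewrite cS; move: #|_ :&: _| #|_ :\: _|; clear; lia.
Qed.

End Triangles.

(** * Four-cycles *)

Lemma uniq_sub_card (T : finType) (s : seq T) (A : {set T}) :
  uniq s -> {subset s <= A} -> size s <= #|A|.
Proof. by move=> us sA; rewrite cardE uniq_leq_size // => x /sA; rewrite mem_enum. Qed.

Section FourCycles.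
Variables (n : nat) (C : {set {set 'I_n}} -> {set 'I_n} -> bool).
Hypothesis C_mono : forall (E E' : {set {set 'I_n}}) S, E \subset E' -> C E S -> C E' S.
Hypothesis C_local : forall E S, C E S -> C [set e in E | e \subset S] S.
Variable E : {set {set 'I_n}}.
Hypothesis sE : E \subset pairs n.
Hypothesis C_deg : forall S v, C E S -> v \in S -> 1 < #|nbh E v :&: S|.
Hypothesis C_four : forall S v, C E S -> v \in S -> exists p w q,
  [/\ S = [set v; p; w; q], uniq [:: v; p; w; q], adj E v p, adj E p w & adj E w q /\ adj E q v].
Hypothesis crE : critical 1 C E.

Local Notation nb := (nbh E).
Local Notation deg v := #|nbh E v|.
Implicit Types (S : {set 'I_n}) (u v w x y z : 'I_n).

Let irreducible l x := @critical_irreducible_pairs n C E l x C_mono C_local crE.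
Let deg2_adj := deg2_adj C_deg.
Let deg2_nonadj := deg2_nonadj C_mono C_local sE C_deg crE.
Let deg3_S := deg3_S C_deg.
Let cover_deg := cover_deg C_mono C_local sE C_deg crE.

Lemma adj_of_nbh v u (A : {set 'I_n}) : nb v = A -> u \in A -> adj E v u.
Proof. by move=> <-; rewrite in_nbh. Qed.

Lemma four_cycle_deg2 S x a b : nb x = [set a; b] -> deg x = 2 -> C E S -> x \in S ->
  exists y, [/\ y != x, adj E a y, adj E b y & S = [set x; a; y; b]].
Proof.
move=> nx dx CS xS; have [p [w [q [SE us xp pw [wq qx]]]]] := C_four CS xS.
move: us; rewrite /= !inE !negb_or => /and4P[/and3P[nxp nxw nxq] /andP[npw npq] nwq _].
have px : p \in nb x by rewrite in_nbh.
have xq : q \in nb x by rewrite in_nbh adjC.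
have nwx : w != x by rewrite eq_sym.
have wq' : adj E q w by rewrite adjC.
exists w; move: px xq; rewrite nx !inE.
move=> /orP[] /eqP ep /orP[] /eqP eq; subst p q; rewrite ?eqxx // in npq *.
by split=> //; rewrite SE; apply/setP => u; rewrite !inE; case: (u == x); case: (u == a); case: (u == b); case: (u == w).
Qed.

Lemma deg2_common x a b : x \in cover E -> nb x = [set a; b] -> deg x = 2 ->
  exists y, [/\ y != x, adj E a y & adj E b y].
Proof.
move=> xE nx dx; have xa : adj E x a by apply: adj_of_nbh nx _; rewrite set21.
have [S [CS xS _]] := critical_edge C_mono C_local crE xa.
by have [y [nyx ay by_ _]] := four_cycle_deg2 nx dx CS xS; exists y.
Qed.

Lemma deg2_other x a : deg x = 2 -> adj E x a ->
  exists b, [/\ nb x = [set a; b], a != b & deg b <> 2].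
Proof.
move=> dx xa; have [b nx nab] : exists2 b, nb x = [set a; b] & a != b.
  by apply: card2_split; rewrite ?in_nbh.
exists b; split=> // db; apply: (deg2_nonadj _ dx db).
by apply: adj_of_nbh nx _; rewrite set22.
Qed.

Section Bvertex.
Variables v x1 x2 w z1 z2 : 'I_n.
Hypotheses (nv : nb v = [set x1; x2; w]) (ux : uniq [:: x1; x2; w]).
Hypotheses (d1 : deg x1 = 2) (d2 : deg x2 = 2).
Hypotheses (n1 : nb x1 = [set v; z1]) (n2 : nb x2 = [set v; z2]).
Hypotheses (nz1 : v != z1) (nz2 : v != z2).

Let vx1 : adj E v x1. Proof. by apply: adj_of_nbh nv _; rewrite !inE eqxx. Qed.
Let vx2 : adj E v x2. Proof. by apply: adj_of_nbh nv _; rewrite !inE eqxx !orbT. Qed.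

(** The fourth vertex of a four-cycle through [z1], [x1], [v] is a neighbour of [v] other than [x1].
    It is [w], or it is [x2], and then [z1] is the second neighbour of [x2]. *)
Lemma Bvertex_z1 : z1 = z2 \/ adj E z1 w.
Proof.
have x1E : x1 \in cover E by apply: (@adj_cover _ _ x1 v); rewrite adjC.
have [y [nyx vy zy]] := deg2_common x1E n1 d1.
move: vy; rewrite -in_nbh nv !inE (negPf nyx) /= => /orP[] /eqP ey; subst y; last by right.
left; move: zy; rewrite adjC -in_nbh n2 !inE (eq_sym z1) (negPf nz1) => /eqP //.
Qed.

(** Without this edge the only four-cycle through [x1] or [x2] would be the one on [v], [x1], [z1],
    [x2], and the pair [(x1, x2)] would hit it. *)
Lemma Bvertex_twin_adj : z1 = z2 -> adj E z1 w.
Proof.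
move=> ez; apply/negPn/negP => zw.
move: ux; rewrite /= !inE negb_or => /and3P[/andP[n12 _] _ _].
have memS S y : C E S -> y \in S -> (y == x1) || (y == x2) -> (x1 \in S) && (x2 \in S).
  move=> CS yS yx; have [vS zS] : v \in S /\ z1 \in S.
    case/orP: yx => /eqP ey; subst y.
      by split; apply: deg2_adj CS yS => //; apply: adj_of_nbh n1 _; rewrite ?set21 ?set22.
    by split; apply: deg2_adj CS yS => //; apply: adj_of_nbh n2 _; rewrite ?set21 ?ez ?set22.
  have common u u' : u = x1 \/ u = x2 -> nb u = [set v; z1] -> u \in S ->
      exists2 y', y' != u & [/\ y' \in S, y' \in nb v & adj E z1 y'].
    move=> eu nu uS; have du : deg u = 2 by case: eu => ->.
    have [y' [ny' vy' zy' SE]] := four_cycle_deg2 nu du CS uS.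
    by exists y' => //; split; rewrite ?in_nbh // SE !inE eqxx !orbT.
  have n2' : nb x2 = [set v; z1] by rewrite ez.
  case/orP: yx => /eqP ey; subst y; rewrite yS ?andbT /=.
    have [y' ny' [y'S]] := common x1 v (or_introl erefl) n1 yS.
    rewrite nv !inE (negPf ny') /= => /orP[] /eqP ey; rewrite ey in y'S *; first by [].
    by rewrite (negPf zw).
  have [y' ny' [y'S]] := common x2 v (or_intror erefl) n2' yS.
  rewrite nv !inE (negPf ny') orbF => /orP[] /eqP ey; rewrite ey in y'S *; first by [].
  by rewrite (negPf zw).
apply: (@irreducible [:: (x1, x2)] x1).
- by rewrite /= inE n12.
- exact: mem_head.
- by apply: (@adj_cover _ _ x1 v); rewrite adjC.
move=> S y CS yS; rewrite !inE => yx; have /andP[s1 s2] := memS S y CS yS yx.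
exact: hits_paired (mem_head _ _) s1 s2.
Qed.

Lemma Bvertex_adj : adj E z1 w.
Proof. by have [/Bvertex_twin_adj|] := Bvertex_z1. Qed.

Let S_x1 S : C E S -> x1 \in S -> (v \in S) && (z1 \in S).
Proof.
move=> CS s1; apply/andP; split; apply: deg2_adj CS s1 => //;
  by apply: adj_of_nbh n1 _; rewrite ?set21 ?set22.
Qed.

Let S_x2 S : C E S -> x2 \in S -> (v \in S) && (z2 \in S).
Proof.
move=> CS s1; apply/andP; split; apply: deg2_adj CS s1 => //;
  by apply: adj_of_nbh n2 _; rewrite ?set21 ?set22.
Qed.

Let neqs : [/\ x1 != x2, x1 != w & x2 != w].
Proof. by move: ux; rewrite /= !inE negb_or => /and3P[/andP[]]. Qed.

Let vE : v \in cover E. Proof. exact: adj_cover vx1. Qed.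
Let vw : adj E v w. Proof. by apply: adj_of_nbh nv _; rewrite !inE eqxx !orbT. Qed.
Let z1x1 : adj E z1 x1.
Proof. by rewrite adjC; apply: adj_of_nbh n1 _; rewrite set22. Qed.
Let z2x2 : adj E z2 x2.
Proof. by rewrite adjC; apply: adj_of_nbh n2 _; rewrite set22. Qed.

(** Otherwise [v] and [z1] have the same three neighbours. A copy through either uses [x1] or [x2],
    hence contains both [v] and [z1], and the pairs [(v, x1)] and [(z1, x2)] hit it. *)
Lemma Bvertex_twin_deg : z1 = z2 -> deg z1 <> 3.
Proof.
move=> ez d3; have zw := Bvertex_adj; have [n12 n1w n2w] := neqs.
have nz : nb z1 = [set x1; x2; w].
  apply/esym/eqP; rewrite eqEcard d3; apply/andP; split.
    apply/subsetP => u; rewrite !inE -orbA => /or3P[] /eqP -> //.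
    by rewrite ez.
  by rewrite -nv nv -setUA cardsU1 cards2 !inE negb_or n12 n1w n2w.
have hv S : C E S -> v \in S -> z1 \in S -> hits (paired [:: (v, x1); (z1, x2)]) S.
  move=> CS vS zS; have := deg3_S nv CS vS; case/or3P => /andP[s1 s2].
  - exact: hits_paired (mem_head _ _) vS s1.
  - exact: hits_paired (mem_head _ _) vS s1.
  - by apply: hits_paired zS s1; rewrite !inE eqxx orbT.
have both S : C E S -> (v \in S) || (z1 \in S) -> (v \in S) && (z1 \in S).
  move=> CS /orP[] yS.
    have := deg3_S nv CS yS; case/or3P => /andP[s1 s2]; try exact: S_x1.
    by have := S_x2 CS s1; rewrite ez.
  have := deg3_S nz CS yS; case/or3P => /andP[s1 s2]; try exact: S_x1.
  by have := S_x2 CS s1; rewrite ez.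
apply: (@irreducible [:: (v, x1); (z1, x2)] v) => //.
- rewrite /= !inE !negb_or nz1 (adj_neq sE vx1) (adj_neq sE vx2) n12.
  by rewrite (adj_neq sE z1x1) ez (adj_neq sE z2x2).
- exact: mem_head.
move=> S y CS yS yl; suff vz : (v \in S) || (z1 \in S).
  by have /andP[vS zS] := both _ CS vz; apply: hv.
move: yl; rewrite !inE => /or4P[] /eqP ey; rewrite ey in yS.
- by rewrite yS.
- by rewrite yS orbT.
- by have /andP[-> _] := S_x1 CS yS.
- by have /andP[-> _] := S_x2 CS yS.
Qed.

(** Otherwise [(v, x1)] and [(w, z2)] form a reduction: a copy through [v] that misses [x1] contains
    [x2] and [w], hence also [z2]; a copy through one of the other ends contains [v] or is hit by
    [(w, z2)]. *)
Lemma Bvertex_deg : z1 != z2 -> nb w = [set v; z1; z2] -> deg z2 <> 3.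
Proof.
move=> nz nw d3; have [n12 n1w n2w] := neqs.
have wz2 : adj E w z2 by apply: adj_of_nbh nw _; rewrite !inE eqxx orbT.
have [s nbz2] : exists s, nb z2 = [set x2; w; s].
  have [s [ns1 ns2]] : exists s, s \in nb z2 :\ x2 :\ w /\ True.
    have /card_gt0P [s sin] : 0 < #|nb z2 :\ x2 :\ w|.
      move: d3; rewrite (cardsD1 x2) in_nbh z2x2 (cardsD1 w) !inE eq_sym n2w adjC wz2.
      by move: #|_|; clear; lia.
    by exists s.
  move: ns1; rewrite !inE => /and3P[nsw nsx zs]; exists s.
  apply/esym/eqP; rewrite eqEcard d3; apply/andP; split.
    apply/subsetP => u; rewrite !inE -orbA => /or3P[] /eqP -> //.
    by rewrite adjC.
  by rewrite -setUA cardsU1 cards2 !inE negb_or n2w !(eq_sym _ s) nsx nsw.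
pose l := [:: (v, x1); (w, z2)].
have wz_in : (w, z2) \in l by rewrite !inE eqxx orbT.
have hv S : C E S -> v \in S -> hits (paired l) S.
  move=> CS vS; have := deg3_S nv CS vS; case/or3P => /andP[s1 s2].
  - exact: hits_paired (mem_head _ _) vS s1.
  - exact: hits_paired (mem_head _ _) vS s1.
  - by have /andP[_ zS] := S_x2 CS s1; apply: hits_paired wz_in s2 zS.
apply: (@irreducible l v) => //.
- rewrite /l /= !inE !negb_or (adj_neq sE vw) (adj_neq sE vx1) nz2 /=.
  rewrite eq_sym n1w (adj_neq sE wz2) /= andbT.
  by apply/eqP => e; apply: (@deg2_nonadj x1 x2) => //; rewrite e.
- exact: mem_head.
move=> S y CS yS; rewrite !inE => /or4P[] /eqP ey; rewrite ey in yS.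
- exact: hv.
- have := deg3_S nw CS yS; case/or3P => /andP[s1 s2]; try exact: hv.
  exact: hits_paired wz_in yS s2.
- by have /andP[vS _] := S_x1 CS yS; apply: hv.
- have := deg3_S nbz2 CS yS; case/or3P => /andP[s1 s2].
  + exact: hits_paired wz_in s2 yS.
  + by have /andP[vS _] := S_x2 CS s1; apply: hv.
  + exact: hits_paired wz_in s1 yS.
Qed.

End Bvertex.

Let D := [set v | deg v == 2].
(** With charge [3 deg - 8], a degree two vertex lacks two units and asks each neighbour for one,
    while a degree three vertex can spare one. [B] consists of the degree three vertices asked twice
    by [D], and [W] of those asked at least twice once [B] passes its shortfall on. *)
Let B := [set v | (deg v == 3) && (#|nb v :&: D| == 2)].
Let W := [set v | [&& deg v == 3, v \notin B & 1 < #|nb v :&: (D :|: B)|]].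

Lemma inD v : (v \in D) = (deg v == 2). Proof. by rewrite inE. Qed.
Lemma inDP v : reflect (deg v = 2) (v \in D). Proof. by rewrite inE; apply: eqP. Qed.
Lemma inBP v : v \in B -> deg v = 3 /\ #|nb v :&: D| = 2.
Proof. by rewrite inE => /andP[/eqP-> /eqP->]. Qed.

Lemma B_notD v : v \in B -> v \notin D.
Proof. by move=> /inBP [d3 _]; rewrite inD d3. Qed.

Lemma nbh3 v a c d : deg v = 3 -> adj E v a -> adj E v c -> adj E v d ->
  uniq [:: a; c; d] -> nb v = [set a; c; d].
Proof.
move=> d3 va vc vd /= /and3P[]; rewrite !inE negb_or => /andP[nac nad] ncd _.
apply/esym/eqP; rewrite eqEcard d3; apply/andP; split.
  by apply/subsetP => u; rewrite !inE -orbA => /or3P[] /eqP ->.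
by rewrite -setUA cardsU1 cards2 !inE negb_or nac nad ncd.
Qed.

Lemma B_struct v : v \in B -> exists x1 x2 w z1 z2,
  [/\ nb v = [set x1; x2; w], uniq [:: x1; x2; w], deg x1 = 2, deg x2 = 2 & deg w <> 2] /\
  [/\ nb x1 = [set v; z1], nb x2 = [set v; z2], v != z1, v != z2 &
     [/\ deg z1 <> 2, deg z2 <> 2, adj E z1 w & adj E z2 w]].
Proof.
move=> /inBP [d3 t2].
have [x1 [x2 [w [nv ux]]]] : exists x1 x2 w,
   [/\ nb v = [set x1; x2; w], uniq [:: x1; x2; w], x1 \in D & x2 \in D].
  by apply: card3_split; rewrite ?t2.
move=> /inDP d1 /inDP d2.
have x1v : adj E x1 v by rewrite adjC; apply: adj_of_nbh nv _; rewrite !inE eqxx.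
have x2v : adj E x2 v by rewrite adjC; apply: adj_of_nbh nv _; rewrite !inE eqxx orbT.
have [z1 [n1 nz1 dz1]] := deg2_other d1 x1v.
have [z2 [n2 nz2 dz2]] := deg2_other d2 x2v.
have nv' : nb v = [set x2; x1; w] by rewrite nv (setUC [set x1]).
have ux' : uniq [:: x2; x1; w].
  by move: ux; rewrite /= !inE !negb_or (eq_sym x2 x1) => /and3P[/andP[-> ->] -> _].
exists x1, x2, w, z1, z2; split; split=> //.
- exact: (deg3_two_deg2 C_mono C_local sE C_deg crE nv ux d1 d2).
- split=> //; first exact: (Bvertex_adj nv ux d1 d2 n1 n2).
  exact: (Bvertex_adj nv' ux' d2 d1 n2 n1).
Qed.

(** The vertex [v] would be the third neighbour of [u], hence also adjacent to [z1]. Neither [u] nor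
    [z1] has degree two, so [v] has at most one neighbour in [D]. *)
Lemma BB_nonadj u v : u \in B -> v \in B -> adj E u v -> False.
Proof.
move=> uB vB uv.
have [x1 [x2 [w [z1 [z2 [[nu ux d1 d2 dw] [n1 n2 nz1 _ [dz1 _ zw _]]]]]]]] := B_struct uB.
have [d3 t2] := inBP vB.
have ew : v = w.
  move: uv; rewrite -in_nbh nu !inE -orbA => /or3P[] /eqP e //.
    by rewrite e d1 in d3.
  by rewrite e d2 in d3.
have : #|[set u; z1]| <= #|nb v :\: D|.
  apply/subset_leq_card/subsetP => y; rewrite in_set2 in_setD in_nbh inD.
  case/orP => /eqP ->; first by have [-> _] := inBP uB; rewrite adjC uv.
  by apply/andP; split; [apply/eqP|rewrite ew adjC].
by rewrite cards2 nz1; have := cardsID D (nb v); rewrite t2 d3; move: #|_ :\: _|; clear; lia.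
Qed.

(** At most one neighbour of [w] has degree two, so some neighbour [v] lies in [B]. If its far
    vertices [z1] and [z2] were distinct, [Bvertex_deg] would keep both out of [D :|: B], leaving
    [w] a single neighbour there. So they coincide in one vertex [z], of degree above three. *)
Lemma W_struct w : w \in W -> exists v z u x1 x2,
  [/\ nb w = [set v; z; u], uniq [:: v; z; u], v \in B, u \in D :|: B & 3 < deg z] /\
  [/\ nb v = [set x1; x2; w], uniq [:: x1; x2; w], deg x1 = 2, deg x2 = 2 &
    nb x1 = [set v; z] /\ nb x2 = [set v; z]].
Proof.
rewrite inE => /and3P[/eqP d3 wB t2].
have tD : #|nb w :&: D| <= 1.
  rewrite leqNgt; apply/negP => lt.
  have [x1 [x2 [x3 [nw ux /inDP d1 /inDP d2]]]] := card3_split d3 lt.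
  have d3' := deg3_two_deg2 C_mono C_local sE C_deg crE nw ux d1 d2.
  case/negP: wB; rewrite inE d3 eqxx /= eqn_leq lt andbT.
  apply: leq_trans (_ : #|[set x1; x2]| <= 2); last by rewrite cards2; case: eqP.
  apply/subset_leq_card/subsetP => y; rewrite in_setI nw !inE.
  by case/andP => /orP[//|/eqP ->] /eqP.
have /card_gt0P [v /setIP[vw vB]] : 0 < #|nb w :&: B|.
  have [le _] := leq_card_setU (nb w :&: D) (nb w :&: B); move: le; rewrite -setIUr.
  by move: #|_ :&: B| #|_ :&: D| #|_ :&: (_ :|: _)| t2 tD; clear; lia.
have [x1 [x2 [w' [z1 [z2 [[nv ux d1 d2 dw] [n1 n2 nz1 nz2 [dz1 dz2 zw1 zw2]]]]]]]] := B_struct vB.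
have ew : w = w'.
  have : w \in nb v by rewrite in_nbh adjC -in_nbh.
  by rewrite nv !inE -orbA => /or3P[] /eqP e //; rewrite e ?d1 ?d2 in d3.
subst w'.
have nv' : nb v = [set x2; x1; w] by rewrite nv (setUC [set x1]).
have ux' : uniq [:: x2; x1; w].
  by move: ux; rewrite /= !inE !negb_or (eq_sym x2 x1) => /and3P[/andP[-> ->] -> _].
have wv : adj E w v by rewrite -in_nbh.
rewrite adjC in zw1; rewrite adjC in zw2.
have [ez|nz] := eqVneq z1 z2; last first.
  have nw : nb w = [set v; z1; z2].
    by apply: nbh3 => //; rewrite /= !inE negb_or nz1 nz2 nz.
  have nw' : nb w = [set v; z2; z1] by rewrite nw -!setUA (setUC [set z1]).
  have nz' : z2 != z1 by rewrite eq_sym.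
  have e2 := Bvertex_deg nv ux d1 d2 n1 n2 nz2 nz nw.
  have e1 := Bvertex_deg nv' ux' d2 d1 n2 n1 nz1 nz' nw'.
  have out z : deg z <> 2 -> deg z <> 3 -> z \notin D :|: B.
    move=> dz2' dz3'; rewrite in_setU inD negb_or; apply/andP; split; first exact/eqP.
    by apply/negP => /inBP [].
  suff : #|nb w :&: (D :|: B)| <= 1 by rewrite leqNgt t2.
  rewrite -(cards1 v); apply/subset_leq_card/subsetP => y; rewrite in_setI nw !in_setU !in_set1 -!in_setU.
  move=> /andP[/orP[/orP[//|/eqP ey]|/eqP ey]]; rewrite ey; apply: contraLR => _; exact: out.
subst z2.
have dz3 := Bvertex_twin_deg nv ux d1 d2 n1 n2 nz1 erefl.
have zE : 1 < deg z1 by apply: cover_deg; apply: (@adj_cover _ _ z1 w); rewrite adjC.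
have dz4 : 3 < deg z1 by move: #|_| dz1 dz3 zE; clear; lia.
have zDB : z1 \notin D :|: B.
  rewrite in_setU inD negb_or; apply/andP; split; first exact/eqP.
  by apply/negP => /inBP [].
have /card_gt0P [u] : 0 < #|(nb w :&: (D :|: B)) :\ v|.
  move: t2; rewrite (cardsD1 v) in_setI vw in_setU vB orbT.
  by move: #|_|; clear; lia.
rewrite in_setD1 in_setI => /and3P[nuv uw uDB].
have nuz : u != z1 by apply: contraTneq uDB => ->.
exists v, z1, u, x1, x2; split; split=> //.
  by apply: nbh3 => //; rewrite -?in_nbh //= !inE negb_or nz1 !(eq_sym _ u) nuv nuz.
by rewrite /= !inE negb_or nz1 !(eq_sym _ u) nuv nuz.
Qed.

Section Tight.
(** [T4] and [T3] are what equality in the discharging of [four_cycle_critical] means at vertices of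
    degree at least four and at the remaining degree three vertices. They are refuted by emptying
    [W], then [B], then the degrees above three. *)
Hypothesis T4 : forall v, 3 < deg v -> deg v = 4 /\ nb v \subset D :|: B :|: W.
Hypothesis T3 : forall v, deg v = 3 -> v \notin B -> v \notin W ->
  #|nb v :&: (D :|: B :|: W)| = 1.
Hypothesis C_nonempty : forall S, C E S -> S != set0.

Lemma W_deg w : w \in W -> deg w = 3.
Proof. by rewrite inE => /and3P[/eqP]. Qed.

Lemma W_notB w : w \in W -> w \notin B.
Proof. by rewrite inE => /and3P[]. Qed.

Lemma W_notD w : w \in W -> w \notin D.
Proof. by move=> /W_deg d3; rewrite inD d3. Qed.

Lemma nbh4 v a c d e : deg v = 4 -> adj E v a -> adj E v c -> adj E v d -> adj E v e ->
  uniq [:: a; c; d; e] -> nb v = [set a; c; d; e].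
Proof.
move=> d4 va vc vd ve ue; apply/esym/eqP; rewrite eqEcard d4; apply/andP; split.
  by apply/subsetP => u; rewrite !inE -!orbA => /or4P[] /eqP ->.
suff -> : [set a; c; d; e] = [set u in [:: a; c; d; e]] by rewrite cardsE (card_uniqP ue).
by apply/setP => u; rewrite !inE -!orbA.
Qed.

(** By [T4] the vertex [z] has degree four and all its neighbours lie in [D], [B] or [W]. If [u] is
    in [B], its two degree two neighbours are also neighbours of [z], giving five. If [u] has degree
    two, its other neighbour [y] is the fourth neighbour of [z], and it can be neither in [D] nor in
    [B] nor in [W]. *)
Lemma noW w : w \notin W.
Proof.
apply/negP => wW.
have [v [z [u [x1 [x2 [[nw uw vB uDB dz] [nv ux d1 d2 [n1 n2]]]]]]]] := W_struct wW.
have [dz4 /subsetP sz] := T4 dz.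
have [dv _] := inBP vB; have dw := W_deg wW.
have zx1 : adj E z x1 by rewrite adjC; apply: adj_of_nbh n1 _; rewrite set22.
have zx2 : adj E z x2 by rewrite adjC; apply: adj_of_nbh n2 _; rewrite set22.
have wz : adj E w z by apply: adj_of_nbh nw _; rewrite !inE eqxx orbT.
have zw : adj E z w by rewrite adjC.
have wu : adj E w u by apply: adj_of_nbh nw _; rewrite !inE eqxx orbT.
move: (uw) (ux); rewrite /= !inE !negb_or => /and3P[/andP[nvz nvu] nzu _].
move=> /and3P[/andP[n12 n1w] n2w _].
have vD1 y : y \in nb v -> deg y = 2 -> y = x1 \/ y = x2.
  rewrite nv !inE -orbA => /or3P[] /eqP ->; [by left|by right|by rewrite dw].
have nbx y : y = x1 \/ y = x2 -> nb y = [set v; z] by case=> ->.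
case/setUP: uDB => [/inDP du|uB]; last first.
  have [y1 [y2 [w' [c1 [c2 [[nu uy e1 e2 dw'] [m1 m2 nc1 nc2 [dc1 dc2 cw1 cw2]]]]]]]] := B_struct uB.
  have [du3 _] := inBP uB.
  have ew : w = w'.
    have : w \in nb u by rewrite in_nbh adjC.
    by rewrite nu !inE -orbA => /or3P[] /eqP e //; rewrite e ?e1 ?e2 in dw.
  subst w'.
  have key y c : deg y = 2 -> nb y = [set u; c] -> u != c -> adj E c w -> adj E z y.
    move=> dy my nc cw; have yc : adj E y c by apply: adj_of_nbh my _; rewrite set22.
    have : c \in nb w by rewrite in_nbh adjC.
    rewrite nw !inE (eq_sym c u) (negPf nc) orbF => /orP[] /eqP ec; subst c.
      have /nbx ny : y = x1 \/ y = x2 by apply: vD1 => //; rewrite in_nbh adjC.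
      have : u \in nb y by rewrite my set21.
      by rewrite ny !inE !(eq_sym u) (negPf nvu) (negPf nzu).
    by rewrite adjC.
  have zy1 := key y1 c1 e1 m1 nc1 cw1; have zy2 := key y2 c2 e2 m2 nc2 cw2.
  move: uy; rewrite /= !inE !negb_or => /and3P[/andP[ny12 ny1w] ny2w _].
  have xy x y c : nb x = [set v; z] -> nb y = [set u; c] -> x != y.
    move=> nx ny; apply: contraNneq nvu => e; have : u \in nb x by rewrite e ny set21.
    by rewrite nx !inE !(eq_sym u) (negPf nzu) orbF.
  have : size [:: x1; x2; w; y1; y2] <= deg z.
    apply: uniq_sub_card.
      rewrite /= !inE !negb_or n12 n1w n2w !(eq_sym w) ny1w ny2w ny12.
      by rewrite !(xy _ _ _ n1 m1, xy _ _ _ n1 m2, xy _ _ _ n2 m1, xy _ _ _ n2 m2).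
    by move=> a; rewrite in_nbh !inE => /or4P[/eqP->|/eqP->|/eqP->|/orP[]/eqP->].
  by rewrite dz4.
have uw' : adj E u w by rewrite adjC.
have [y [nu nwy dy]] := deg2_other du uw'.
have [t [ntu wt yt]] := deg2_common (adj_cover uw') nu du.
have yz : adj E y z.
  move: wt; rewrite -in_nbh nw !inE (negPf ntu) orbF => /orP[] /eqP et; subst t => //.
  have : y \in nb v by rewrite in_nbh adjC.
  rewrite nv !inE (eq_sym y w) (negPf nwy) orbF => /orP[] /eqP ey.
    by rewrite ey in dy.
  by rewrite ey in dy.
have nyx x : deg x = 2 -> x != y by move=> dx; apply/eqP => e; rewrite -e in dy.
have nz : nb z = [set x1; x2; w; y].
  apply: nbh4 => //; first by rewrite adjC.
  by rewrite /= !inE !negb_or n12 n1w n2w (nyx x1) // (nyx x2) // nwy.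
have zD a : adj E z a -> deg a = 2 -> a = x1 \/ a = x2.
  rewrite -in_nbh nz !inE -!orbA => /or4P[] /eqP -> da; [by left|by right| |by case: dy].
  by rewrite dw in da.
have : y \in D :|: B :|: W by apply: sz; rewrite nz !inE eqxx !orbT.
case/setUP => [/setUP[/inDP //|yB]|yW].
  have [a1 [a2 [w' [c1 [c2 [[ny uy e1 e2 dw'] [m1 m2 nc1 nc2 [dc1 dc2 cw1 cw2]]]]]]]] := B_struct yB.
  have ew : z = w'.
    have : z \in nb y by rewrite in_nbh.
    by rewrite ny !inE -orbA => /or3P[] /eqP e //; rewrite e ?e1 ?e2 in dz4.
  subst w'.
  have key a c : deg a = 2 -> nb a = [set y; c] -> y != c -> adj E c z -> deg c <> 2 -> a = u.
    move=> da ma nc cz dc; have : c \in nb z by rewrite in_nbh adjC.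
    rewrite nz !inE (eq_sym c y) (negPf nc) orbF -orbA => /or3P[] /eqP ec; subst c => //.
    have : a \in nb w by rewrite in_nbh adjC; apply: adj_of_nbh ma _; rewrite set22.
    rewrite nw !inE -orbA => /or3P[] /eqP ea //; first by rewrite ea dv in da.
    by rewrite ea dz4 in da.
  move: uy; rewrite /= inE negb_or => /andP[/andP[]].
  by rewrite (key a1 c1) // (key a2 c2) // eqxx.
have [v' [z' [u' [x1' [x2' [[ny uy v'B u'DB dz'] [nv' ux' d1' d2' [n1' n2']]]]]]]] := W_struct yW.
have [dv' _] := inBP v'B.
have ez : z = z'.
  have : z \in nb y by rewrite in_nbh.
  rewrite ny !inE -orbA => /or3P[] /eqP e //; first by rewrite e dv' in dz4.
  by case/setUP: u'DB; rewrite -e; [move/inDP|move/inBP => []]; rewrite dz4.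
subst z'.
have x1'z : adj E z x1' by rewrite adjC; apply: adj_of_nbh n1' _; rewrite set22.
have /nbx nx' := zD _ x1'z d1'.
have ev : v' = v.
  have : v' \in nb x1' by rewrite n1' set21.
  rewrite nx' !inE => /orP[] /eqP // e.
  by rewrite e dz4 in dv'.
have : y \in nb v by rewrite -ev nv' !inE eqxx !orbT.
rewrite nv !inE -orbA => /or3P[] /eqP e.
- by rewrite e in dy.
- by rewrite e in dy.
- by rewrite e eqxx in nwy.
Qed.

(** Let [w] be the third neighbour of [v]. If it had degree three, the [Bvertex] lemmas would give
    [z2] degree above three, and [T4] at [z2] would fail for its neighbour [w]. So [T4] applies to
    [w], and its neighbours [z1] and [z2], not of degree two, lie in [B]. *)
Lemma tight_B v x : v \in B -> adj E v x -> deg x = 2 -> nb x \subset B.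
Proof.
move=> vB vx dx.
have [x1 [x2 [w [z1 [z2 [[nv ux d1 d2 dw] [n1 n2 nz1 nz2 [dz1 dz2 zw1 zw2]]]]]]]] := B_struct vB.
have wv : adj E w v by rewrite adjC; apply: adj_of_nbh nv _; rewrite !inE eqxx !orbT.
have wE : 1 < deg w by apply: cover_deg; exact: adj_cover wv.
have z2E : 1 < deg z2 by apply: cover_deg; exact: adj_cover zw2.
have wB : w \notin B by apply/negP => wB; apply: (BB_nonadj wB vB wv).
have big z : 3 < deg z -> adj E z w -> False.
  move=> dz zw; have [_ /subsetP /(_ w)] := T4 dz.
  rewrite in_nbh zw !in_setU inD (negPf wB) (negPf (noW w)) !orbF => /(_ isT) /eqP //.
have [d3|d4] : deg w = 3 \/ 3 < deg w by move: #|_| dw wE; clear; lia.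
  apply: False_ind; apply: (big z2) => //.
  suff : deg z2 <> 3 by move: #|_| dz2 z2E; clear; lia.
  have [ez|nz] := eqVneq z1 z2.
    by have := Bvertex_twin_deg nv ux d1 d2 n1 n2 nz1 ez; rewrite ez.
  apply: (Bvertex_deg nv ux d1 d2 n1 n2 nz2 nz); apply: nbh3 => //.
  - by rewrite adjC.
  - by rewrite adjC.
  - by rewrite /= !inE negb_or nz1 nz2 nz.
have [_ /subsetP sw] := T4 d4.
have zB z : adj E z w -> deg z <> 2 -> z \in B.
  move=> zw dz; have := sw z; rewrite in_nbh adjC zw !in_setU inD (negPf (noW z)) orbF.
  by move=> /(_ isT) /orP[/eqP|].
have : x \in nb v by rewrite in_nbh.
rewrite nv !inE -orbA => /or3P[] /eqP ex.
- by rewrite ex n1 subUset !sub1set vB zB.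
- by rewrite ex n2 subUset !sub1set vB zB.
- by rewrite -ex in dw.
Qed.

(** By [tight_B], [D'] contains all degree two neighbours of vertices in [B], and every copy through
    [B] uses one of them; [deg2_matching] applies to [D'] and [B]. *)
Lemma noB v : v \notin B.
Proof.
apply/negP => vB.
pose D' := [set x in D | nb x \subset B].
have inD' u x : u \in B -> adj E u x -> deg x = 2 -> x \in D'.
  by move=> uB ux dx; rewrite inE inD dx (tight_B uB ux dx).
have [x1 [x2 [w [z1 [z2 [[nv ux d1 d2 dw] _]]]]]] := B_struct vB.
have vx1 : adj E v x1 by apply: adj_of_nbh nv _; rewrite !inE eqxx.
apply: (@deg2_matching n C C_mono C_local E C_deg crE D' B x1).
- exact: inD' vB vx1 d1.
- by apply: (@adj_cover _ _ x1 v); rewrite adjC.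
- by move=> y; rewrite inE => /andP[/inDP].
- apply/pred0P => y /=; apply/negP => /andP[]; rewrite inE => /andP[yD _] /B_notD.
  by rewrite yD.
- move=> u /inBP [_ <-]; apply/subset_leq_card/setIS/subsetP => y.
  by rewrite inE => /andP[].
- move=> S u CS uS uB.
  have [y1 [y2 [w' [c1 [c2 [[nu uy e1 e2 _] _]]]]]] := B_struct uB.
  have a1 : adj E u y1 by apply: adj_of_nbh nu _; rewrite !inE eqxx.
  have a2 : adj E u y2 by apply: adj_of_nbh nu _; rewrite !inE eqxx orbT.
  have := deg3_S nu CS uS; case/or3P => /andP[s1 _].
  + by exists y1 => //; apply: inD' uB a1 e1.
  + by exists y1 => //; apply: inD' uB a1 e1.
  + by exists y2 => //; apply: inD' uB a2 e2.
Qed.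

Lemma tight_deg4 v u : 3 < deg v -> adj E v u -> deg u = 2.
Proof.
move=> dv vu; have [_ /subsetP /(_ u)] := T4 dv.
by rewrite in_nbh vu !in_setU inD (negPf (noB u)) (negPf (noW u)) !orbF => /(_ isT) /eqP.
Qed.

Lemma tight_deg3 v : deg v = 3 -> #|nb v :&: D| = 1.
Proof.
move=> dv; rewrite -(T3 dv (noB v) (noW v)); apply: eq_card => u.
by rewrite !in_setI !in_setU (negPf (noB u)) (negPf (noW u)) !orbF.
Qed.

Lemma tight_deg3_uniq v x y : deg v = 3 -> adj E v x -> adj E v y -> deg x = 2 -> deg y = 2 -> x = y.
Proof.
move=> dv vx vy dx dy; have /eqP := tight_deg3 dv.
rewrite eqn_leq => /andP[/card_le1_eqP h _].
by apply: h; rewrite in_setI in_nbh ?vx ?vy inD ?dx ?dy.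
Qed.

(** Here [b] has degree four as well, since a degree three vertex has only one degree two neighbour.
    If [x] and [y] are the only common neighbours of [a] and [b], the pair [(x, y)] is a reduction.
    Otherwise all four are common, because a non-common one comes with a second, and [(a, b)] is a
    reduction. *)
Lemma tight_no_deg4 x a b : deg x = 2 -> nb x = [set a; b] -> a != b -> 3 < deg a -> False.
Proof.
move=> dx nx nab da; have [da4 _] := T4 da.
have xa : adj E x a by apply: adj_of_nbh nx _; rewrite set21.
have xb : adj E x b by apply: adj_of_nbh nx _; rewrite set22.
have ax : adj E a x by rewrite adjC.
have [y [nyx ay by_]] := deg2_common (adj_cover xa) nx dx.
have dy := tight_deg4 da ay.
have db : 3 < deg b.
  have bE : 1 < deg b by apply: cover_deg; apply: (@adj_cover _ _ b x); rewrite adjC.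
  have db2 : deg b <> 2 by move=> db; apply: (deg2_nonadj xb dx db).
  suff db3 : deg b <> 3 by move: #|_| bE db2 db3; clear; lia.
  move=> db3; case/eqP: nyx; apply: (tight_deg3_uniq db3 by_ _ dy dx).
  by rewrite adjC.
have [db4 _] := T4 db.
have other s c : adj E a s -> adj E s c -> a != c -> nb s = [set a; c].
  move=> as_ sc nac; have [c' [ns _ _]] := deg2_other (tight_deg4 da as_) (etrans (adjC _ _ _) as_).
  by move: sc; rewrite -in_nbh ns !inE (eq_sym c a) (negPf nac) /= => /eqP ->.
have nxE s : adj E a s -> adj E b s -> nb s = [set a; b].
  by move=> as_ bs; apply: other => //; rewrite adjC.
have [c2|c3] := leqP #|nb a :&: nb b| 2.
  have ab : nb a :&: nb b = [set x; y].
    apply/esym/eqP; rewrite eqEcard cards2 eq_sym nyx c2 andbT.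
    by apply/subsetP => u; rewrite in_set2 in_setI !in_nbh => /orP[] /eqP ->; rewrite ?ax ?ay ?by_ // adjC xb.
  apply: (@irreducible [:: (x, y)] x).
  - by rewrite /= inE eq_sym nyx.
  - exact: mem_head.
  - exact: adj_cover xa.
  move=> S t CS tS tl.
  have tab : t \in nb a :&: nb b by rewrite ab; move: tl; rewrite !inE.
  have dt : deg t = 2 by move: tab; rewrite in_setI !in_nbh => /andP[at_ _]; apply: tight_deg4 at_.
  have nt : nb t = [set a; b] by move: tab; rewrite in_setI !in_nbh => /andP[]; apply: nxE.
  have [t' [nt' at' bt' SE]] := four_cycle_deg2 nt dt CS tS.
  have : t' \in [set x; y] by rewrite -ab in_setI !in_nbh at' bt'.
  have t'S : t' \in S by rewrite SE !inE eqxx !orbT.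
  move: tl tS t'S nt'; rewrite !inE => /orP[] /eqP -> s1 s2 nt' /orP[] /eqP e; rewrite e ?eqxx // in nt' s2.
  - exact: hits_paired (mem_head _ _) s1 s2.
  - exact: hits_paired (mem_head _ _) s2 s1.
have sub : nb a \subset nb b.
  apply/subsetP => s; rewrite in_nbh => as_; apply/negPn/negP => sb.
  have ds := tight_deg4 da as_.
  have [c [ns nac dc]] := deg2_other ds (etrans (adjC _ _ _) as_).
  have sc : adj E s c by apply: adj_of_nbh ns _; rewrite set22.
  have [s' [ns' as' cs']] := deg2_common (adj_cover sc) ns ds.
  have ns'E : nb s' = [set a; c] by apply: other => //; rewrite adjC.
  have ncb : c != b by apply: contraNneq sb => <-; rewrite in_nbh adjC.
  have s'b : s' \notin nb b.
    rewrite in_nbh adjC -in_nbh ns'E !inE negb_or (eq_sym b a) nab (eq_sym b c).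
    by [].
  have : #|(nb a :&: nb b) :|: [set s; s']| <= deg a.
    by apply/subset_leq_card; rewrite subUset subsetIl subUset !sub1set !in_nbh as_ as'.
  have dj : (nb a :&: nb b) :&: [set s; s'] = set0.
    apply/setP => u; rewrite !in_setI in_set2 in_set0; apply/negP => /andP[/andP[_ ub]].
    by case/orP => /eqP e; rewrite e ?(negPf sb) ?(negPf s'b) in ub.
  rewrite cardsU dj cards0 cards2 eq_sym ns' da4; move: c3; move: #|_|; clear; lia.
have eab : nb a = nb b by apply/eqP; rewrite eqEcard sub da4 db4.
apply: (@irreducible [:: (a, b)] a).
- by rewrite /= inE nab.
- exact: mem_head.
- exact: adj_cover ax.
move=> S t CS tS tl; have ta : nb t = nb a by move: tl; rewrite !inE => /orP[] /eqP ->.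
have /card_gt0P [s] : 0 < #|nb t :&: S| by apply: ltnW; apply: C_deg.
rewrite ta in_setI in_nbh => /andP[as_ sS]; have ds := tight_deg4 da as_.
have bs : adj E b s by rewrite -in_nbh -eab in_nbh.
rewrite adjC in as_; rewrite adjC in bs.
exact: hits_paired (mem_head _ _) (deg2_adj ds as_ CS sS) (deg2_adj ds bs CS sS).
Qed.

(** If [b] and [c'] are adjacent, all neighbourhoods of [a], [b], [y], [c'] are known and the pairs
    [(a, b)], [(y, c')] form a reduction. Otherwise [(a, y)] suffices: a copy through one of them
    without the other would need the missing edge between [b] and [c']. *)
Lemma tight_no_deg3 x a b y c c' : deg x = 2 -> nb x = [set a; b] -> a != b ->
  deg a = 3 -> deg b = 3 -> y != x -> adj E a y -> adj E b y -> deg y = 3 ->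
  adj E y c -> deg c = 2 -> nb c = [set y; c'] -> adj E a c' -> False.
Proof.
move=> dx nx nab da db nyx ay by_ dy yc dc nc ac'.
have xa : adj E x a by apply: adj_of_nbh nx _; rewrite set21.
have xb : adj E x b by apply: adj_of_nbh nx _; rewrite set22.
have ax : adj E a x by rewrite adjC.
have bx : adj E b x by rewrite adjC.
have cc' : adj E c c' by apply: adj_of_nbh nc _; rewrite set22.
have c'c : adj E c' c by rewrite adjC.
have nyc' : y != c'.
  apply/eqP => e; have : #|nb c| = 2 by [].
  by rewrite nc e setUid cards1.
have dc' : deg c' <> 2 by move=> dc'; apply: (deg2_nonadj cc' dc dc').
have ncx : c != x.
  apply/eqP => e; have : y \in nb x by rewrite -e in_nbh adjC.
  rewrite nx !inE => /orP[] /eqP ey; first by rewrite ey adjxx in ay.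
  by rewrite ey adjxx in by_.
have nxc' : x != c' by apply/eqP => e; rewrite -e in dc'.
have na : nb a = [set x; y; c'].
  by apply: nbh3 => //; rewrite /= !inE negb_or nxc' eq_sym nyx nyc'.
have nac : a != c by apply/eqP => e; rewrite e dc in da.
have nbc : b != c by apply/eqP => e; rewrite e dc in db.
have ny : nb y = [set a; b; c].
  apply: nbh3 => //; first by rewrite adjC.
    by rewrite adjC.
  by rewrite /= !inE negb_or nab nac nbc.
have nc'b : c' != b.
  apply/eqP => e; case/eqP: ncx; apply: (tight_deg3_uniq db _ bx dc dx).
  by rewrite -e.
have Sc S : C E S -> c \in S -> (y \in S) && (c' \in S).
  move=> CS cS; apply/andP; split; apply: deg2_adj CS cS => //.
  by rewrite adjC.
have Sx S : C E S -> x \in S -> (a \in S) && (b \in S).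
  by move=> CS xS; apply/andP; split; apply: deg2_adj CS xS.
have nya : y != a by rewrite eq_sym; apply: (adj_neq sE ay).
have nc'a : c' != a by rewrite eq_sym; apply: (adj_neq sE ac').
have nby : b != y := adj_neq sE by_.
have [bc'|bc'] := boolP (adj E b c').
  have nb_ : nb b = [set x; y; c'].
    by apply: nbh3 => //; rewrite /= !inE negb_or nxc' eq_sym nyx nyc'.
  have dc'3 : deg c' = 3.
    have c'E : 1 < deg c' by apply: cover_deg; exact: adj_cover c'c.
    suff : ~ 3 < deg c' by move: #|_| c'E dc'; clear; lia.
    by move=> d4; have := tight_deg4 d4 (_ : adj E c' a); rewrite adjC da => /(_ ac').
  have nc' : nb c' = [set a; b; c].
    apply: nbh3 => //; first by rewrite adjC.
      by rewrite adjC.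
    by rewrite /= !inE negb_or nab nac nbc.
  pose l := [:: (a, b); (y, c')].
  have yc'l : (y, c') \in l by rewrite !inE eqxx orbT.
  apply: (@irreducible l a).
  - rewrite /l /= !inE !negb_or nab (eq_sym a y) nya (eq_sym a c') nc'a (eq_sym y b) nby nyc'.
    by rewrite (eq_sym b c') nc'b.
  - exact: mem_head.
  - exact: adj_cover ay.
  have hx S : C E S -> [|| (x \in S) && (y \in S), (x \in S) && (c' \in S) |
        (y \in S) && (c' \in S)] -> hits (paired l) S.
    move=> CS /or3P[] /andP[s1 s2]; last exact: hits_paired yc'l s1 s2.
      by have /andP[sa sb] := Sx S CS s1; apply: hits_paired (mem_head _ _) sa sb.
    by have /andP[sa sb] := Sx S CS s1; apply: hits_paired (mem_head _ _) sa sb.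
  have hc S : C E S -> [|| (a \in S) && (b \in S), (a \in S) && (c \in S) |
        (b \in S) && (c \in S)] -> hits (paired l) S.
    move=> CS /or3P[] /andP[s1 s2]; first exact: hits_paired (mem_head _ _) s1 s2.
      by have /andP[sa sb] := Sc S CS s2; apply: hits_paired yc'l sa sb.
    by have /andP[sa sb] := Sc S CS s2; apply: hits_paired yc'l sa sb.
  move=> S t CS tS; rewrite !inE => /or4P[] /eqP et; rewrite et in tS.
  - exact: hx (deg3_S na CS tS).
  - exact: hc (deg3_S ny CS tS).
  - exact: hx (deg3_S nb_ CS tS).
  - exact: hc (deg3_S nc' CS tS).
apply: (@irreducible [:: (a, y)] a).
- by rewrite /= inE eq_sym nya.
- exact: mem_head.
- exact: adj_cover ay.
move=> S t CS tS; rewrite !inE => /orP[] /eqP et; rewrite et in tS.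
  have := deg3_S na CS tS; case/or3P => /andP[s1 s2].
  - exact: hits_paired (mem_head _ _) tS s2.
  - have [y' [ny' ay' by' SE]] := four_cycle_deg2 nx dx CS s1.
    move: s2; rewrite SE !inE (eq_sym c' x) (negPf nxc') (negPf nc'a) (negPf nc'b) orbF /=.
    by move=> /eqP e; rewrite e by' in bc'.
  - exact: hits_paired (mem_head _ _) tS s1.
have := deg3_S ny CS tS; case/or3P => /andP[s1 s2].
- exact: hits_paired (mem_head _ _) s1 tS.
- exact: hits_paired (mem_head _ _) s1 tS.
have [y' [ny' yy' c'y' SE]] := four_cycle_deg2 nc dc CS s2.
have y'S : y' \in S by rewrite SE !inE eqxx !orbT.
move: yy'; rewrite -in_nbh ny !inE (negPf ny') orbF => /orP[] /eqP e; rewrite e in y'S c'y'.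
  exact: hits_paired (mem_head _ _) y'S tS.
by rewrite adjC c'y' in bc'.
Qed.

(** Around a degree two vertex [x] all degrees are now three. The four-cycle through the degree two
    neighbour [c] of the opposite vertex [y] must close up at [a] or at [b], and the two cases are
    symmetric. *)
Lemma tight_false : False.
Proof.
have [x0 x0E] := critical_cover sE C_deg crE C_nonempty.
have [x xE dx] : exists2 x, x \in cover E & deg x = 2.
  have d2 := cover_deg x0E.
  have [d|[d|d]] : deg x0 = 2 \/ (deg x0 = 3 \/ 3 < deg x0) by move: #|_| d2; clear; lia.
  - by exists x0.
  - have /card_gt0P [x /setIP[]] : 0 < #|nb x0 :&: D| by rewrite tight_deg3.
    by rewrite in_nbh adjC => xx0 /inDP dx; exists x => //; exact: adj_cover xx0.
  - have /card_gt0P [x] : 0 < deg x0 by apply: leq_trans d.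
    by rewrite in_nbh => x0x; exists x; [rewrite adjC in x0x; exact: adj_cover x0x|exact: tight_deg4 x0x].
have /card_gt0P [a] : 0 < deg x by rewrite dx.
rewrite in_nbh => xa; have [b [nx nab db2]] := deg2_other dx xa.
have xb : adj E x b by apply: adj_of_nbh nx _; rewrite set22.
have nx' : nb x = [set b; a] by rewrite setUC.
have nba : b != a by rewrite eq_sym.
have no4 v : adj E x v -> deg v = 3.
  move=> xv; have vE : 1 < deg v by apply: cover_deg; apply: (@adj_cover _ _ v x); rewrite adjC.
  have d2 : deg v <> 2 by move=> dv; apply: (deg2_nonadj xv dx dv).
  suff : ~ 3 < deg v by move: #|_| vE d2; clear; lia.
  move: (xv); rewrite -in_nbh nx !inE => /orP[] /eqP ->.
    exact: (tight_no_deg4 dx nx nab).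
  exact: (tight_no_deg4 dx nx' nba).
have da := no4 a xa; have db := no4 b xb.
have [y [nyx ay by_]] := deg2_common xE nx dx.
have dy : deg y = 3.
  have yE : 1 < deg y by apply: cover_deg; apply: (@adj_cover _ _ y a); rewrite adjC.
  have d2 : deg y <> 2.
    move=> dy; case/eqP: nyx; apply: (tight_deg3_uniq da ay _ dy dx).
    by rewrite adjC.
  suff : ~ 3 < deg y by move: #|_| yE d2; clear; lia.
  by rewrite adjC in ay; move=> d4; have := tight_deg4 d4 ay; rewrite da.
have /card_gt0P [c /setIP[]] : 0 < #|nb y :&: D| by rewrite tight_deg3.
rewrite in_nbh => yc /inDP dc; have cy : adj E c y by rewrite adjC.
have [c' [nc nyc' _]] := deg2_other dc cy.
have [t [ntc yt c't]] := deg2_common (adj_cover cy) nc dc.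
have nac : a != c by apply/eqP => e; rewrite e dc in da.
have nbc : b != c by apply/eqP => e; rewrite e dc in db.
have ny : nb y = [set a; b; c].
  apply: nbh3 => //; first by rewrite adjC.
    by rewrite adjC.
  by rewrite /= !inE negb_or nab nac nbc.
rewrite adjC in c't.
move: yt; rewrite -in_nbh ny !inE (negPf ntc) orbF => /orP[] /eqP et; rewrite et in c't.
  exact: (tight_no_deg3 dx nx nab da db nyx ay by_ dy yc dc nc c't).
exact: (tight_no_deg3 dx nx' nba db da nyx by_ ay dy yc dc nc c't).
Qed.

End Tight.

(** Charge [3 deg], demand [8]. Vertices of [D], [B] and [W] pass on what they lack, each time to
    neighbours of a later kind, and a vertex of degree at least four can serve all its
    neighbours. *)
Lemma four_cycle_critical : (forall S, C E S -> S != set0) -> 4 * #|cover E| < 3 * #|E|.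
Proof.
move=> C0.
pose tr u v := adj E u v &&
  [|| u \in D, (u \in B) && (v \notin D) | (u \in W) && (v \notin D :|: B)].
have in_D v : v \in D -> [set u | tr u v] = set0.
  move=> vD; apply/setP => u; rewrite inE in_set0 /tr in_setU vD /= !andbF !orbF.
  by apply/negP => /andP[uv /inDP du]; apply: (deg2_nonadj uv du); apply/inDP.
have in_B v : v \in B -> [set u | tr u v] = nb v :&: D.
  move=> vB; apply/setP => u; rewrite inE /tr in_setI in_setU in_nbh (negPf (B_notD vB)) vB /=.
  rewrite andbF orbF andbT adjC; case: (boolP (adj E v u)) => //= vu.
  by case: (boolP (u \in B)) => uB; rewrite ?orbF //; case: (BB_nonadj vB uB vu).
have in_T v : v \notin D -> v \notin B -> [set u | tr u v] = nb v :&: (D :|: B :|: W).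
  move=> vD vB; apply/setP => u; rewrite inE /tr !in_setI !in_setU in_nbh adjC.
  by rewrite vD (negPf vD) (negPf vB) !andbT orbA.
have DBW v : [/\ v \in D -> v \notin B, v \in D -> v \notin W & v \in B -> v \notin W].
  split.
  - by apply: contraL; apply: B_notD.
  - by apply: contraL; apply: W_notD.
  - by apply: contraL; apply: W_notB.
have out_D v : v \in D -> [set u | tr v u] = nb v.
  by move=> vD; apply/setP => u; rewrite inE /tr in_nbh vD andbT.
have out_B v : v \in B -> [set u | tr v u] = nb v :\: D.
  move=> vB; have [_ _ nW] := DBW v; apply/setP => u; rewrite inE /tr in_setD in_nbh.
  by rewrite (negPf (B_notD vB)) vB (negPf (nW vB)) /= orbF andbC.
have out_W v : v \in W -> [set u | tr v u] = nb v :\: (D :|: B).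
  move=> vW; apply/setP => u; rewrite inE /tr in_setD in_nbh.
  by rewrite (negPf (W_notD vW)) (negPf (W_notB vW)) vW /= andbC.
have out_0 v : v \notin D -> v \notin B -> v \notin W -> [set u | tr v u] = set0.
  move=> vD vB vW; apply/setP => u; rewrite inE /tr in_set0.
  by rewrite (negPf vD) (negPf vB) (negPf vW) andbF.
have Wnb v u : v \in W -> adj E v u -> [/\ u \notin W & (u \notin D) && (u \notin B) -> 3 < deg u].
  move=> vW vu; have [v' [z [u' [x1 [x2 [[nw _ v'B u'DB dz] _]]]]]] := W_struct vW.
  move: vu; rewrite -in_nbh nw !in_setU !in_set1 -orbA => /or3P[] /eqP ->.
  - by have [_ _ h] := DBW v'; rewrite (h v'B) v'B andbF.
  - by split=> //; apply/negP => /W_deg d3; rewrite d3 in dz.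
  - by have [_ h2 h3] := DBW u'; case/setUP: u'DB => h; rewrite ?(h2 h) ?(h3 h) h ?andbF.
have W2 v : v \in W -> #|nb v :&: (D :|: B :|: W)| = 2 /\ #|nb v :\: (D :|: B)| = 1.
  move=> vW; have [v' [z [u' [x1 [x2 [[nw uw v'B u'DB dz] _]]]]]] := W_struct vW.
  have zDB : z \notin D :|: B.
    rewrite in_setU inD negb_or; apply/andP; split; first by apply/eqP => e; rewrite e in dz.
    by apply/negP => /inBP [d3 _]; rewrite d3 in dz.
  move: uw; rewrite /= !inE negb_or => /and3P[/andP[nvz nvu] nzu _].
  have d3 := W_deg vW.
  have eD : nb v :\: (D :|: B) = [set z].
    apply/setP => t; rewrite in_setD nw in_set1 !in_setU !in_set1 -in_setU.
    have [->|ntz] := eqVneq t z; first by rewrite zDB orbT.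
    rewrite orbF; apply/negP => /andP[tDB /orP[] /eqP et]; move: tDB; rewrite et.
      by rewrite in_setU v'B orbT.
    by rewrite u'DB.
  split; last by rewrite eD cards1.
  have -> : nb v :&: (D :|: B :|: W) = nb v :&: (D :|: B).
    apply/setP => t; rewrite !in_setI in_setU in_nbh; case: (boolP (adj E v t)) => //= vt.
    by have [/negPf -> _] := Wnb v t vW vt; rewrite orbF.
  by have := cardsID (D :|: B) (nb v); rewrite eD cards1 d3; move: #|_|; clear; lia.
have other3 v : v \in cover E -> deg v = 3 -> v \notin B -> v \notin W ->
    #|nb v :&: (D :|: B :|: W)| <= 1.
  move=> vE d3 vB vW.
  have -> : nb v :&: (D :|: B :|: W) = nb v :&: (D :|: B).
    apply/setP => t; rewrite !in_setI in_setU in_nbh; case: (boolP (adj E v t)) => //= vt.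
    case: (boolP (t \in W)) => tW; rewrite ?orbF // orbT.
    have tv : adj E t v by rewrite adjC.
    by have [_] := Wnb t v tW tv; rewrite inD d3 vB => /(_ isT).
  by rewrite leqNgt; apply: contra vW => lt; rewrite inE d3 vB lt.
have le v : v \in cover E -> 8 + #|[set u | tr u v]| <= 3 * deg v + #|[set u | tr v u]|.
  move=> vE; have [vD|vD] := boolP (v \in D).
    by rewrite in_D // out_D // cards0; move/inDP: vD => ->.
  have [vB|vB] := boolP (v \in B).
    have [d3 t2] := inBP vB; rewrite in_B // out_B // d3 t2.
    by have := cardsID D (nb v); rewrite t2 d3; move: #|_|; clear; lia.
  rewrite in_T //; have [vW|vW] := boolP (v \in W).
    by have [-> h] := W2 v vW; rewrite out_W // h W_deg.
  have [d3|d4] : deg v = 3 \/ 3 < deg v.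
    by have := cover_deg vE; move: vD; rewrite inD; move: #|nb v|; clear; lia.
    by have := other3 v vE d3 vB vW; rewrite d3; move: #|_| #|_|; clear; lia.
  have : #|nb v :&: (D :|: B :|: W)| <= deg v by apply/subset_leq_card/subsetIl.
  by move: #|nb v :&: _| #|nb v| #|_| d4; clear; lia.
have eqa : \sum_(v in cover E) 8 = 2 * (4 * #|cover E|) by rewrite sum_nat_const; clear; lia.
have eqb : \sum_(v in cover E) 3 * deg v = 2 * (3 * #|E|).
  by rewrite -big_distrr /= handshake // mulnCA.
have [|lt|tight] := discharging _ le.
- move=> u v /andP[uv _]; rewrite (adj_cover uv); move: uv; rewrite adjC.
  exact: adj_cover.
- by move: lt; rewrite eqa eqb; clear; lia.
have inc v : 0 < deg v -> v \in cover E by rewrite in_cover_nbh.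
case: (@tight_false) => // v.
  move=> d4; have vE : v \in cover E by apply: inc; apply: leq_trans d4.
  have vD : v \notin D by rewrite inD; apply/eqP => e; rewrite e in d4.
  have vB : v \notin B by apply/negP => /inBP [e _]; rewrite e in d4.
  have vW : v \notin W by apply/negP => /W_deg e; rewrite e in d4.
  have := tight v vE; rewrite in_T // out_0 // cards0 addn0 => tv.
  have le' : #|nb v :&: (D :|: B :|: W)| <= deg v by apply/subset_leq_card/subsetIl.
  have e4 : deg v = 4 by move: #|nb v :&: _| #|nb v| d4 tv le'; clear; lia.
  split=> //; apply/setIidPl/eqP; rewrite eqEcard subsetIl.
  by rewrite e4 in tv *; move: #|nb v :&: _| tv; clear; lia.
move=> d3 vB vW; have vE : v \in cover E by apply: inc; rewrite d3.
have vD : v \notin D by rewrite inD d3.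
have := tight v vE; rewrite in_T // out_0 // cards0 addn0 d3.
by move: #|_|; clear; lia.
Qed.

End FourCycles.

(** * Copies of a fixed graph *)

Section Embeddings.
Variables (k : nat) (EK : {set {set 'I_k}}).

Definition embeds n (E : {set {set 'I_n}}) (f : {ffun 'I_k -> 'I_n}) : bool :=
  injectiveb f && [forall e in EK, f @: e \in E].

Definition copy_set n (E : {set {set 'I_n}}) (S : {set 'I_n}) : bool :=
  [exists f : {ffun 'I_k -> 'I_n}, embeds E f && (S == f @: setT)].

Definition copy_edges n (f : {ffun 'I_k -> 'I_n}) : {set {set 'I_n}} :=
  [set f @: (e : {set 'I_k}) | e in EK].

Lemma embedsP n (E : {set {set 'I_n}}) (f : {ffun 'I_k -> 'I_n}) :
  reflect (injective f /\ copy_edges f \subset E) (embeds E f).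
Proof.
apply: (iffP andP) => [[/injectiveP fi /forall_inP fE]|[fi /subsetP fE]]; split=> //.
- by apply/subsetP => e' /imsetP [e eK ->]; apply: fE.
- exact/injectiveP.
- by apply/forall_inP => e eK; apply: fE; apply: imset_f.
Qed.

Lemma copy_set_mono n (E E' : {set {set 'I_n}}) (S : {set 'I_n}) :
  E \subset E' -> copy_set E S -> copy_set E' S.
Proof.
move=> sE /existsP [f /andP[/embedsP [fi fE] SE]]; apply/existsP; exists f.
by rewrite SE andbT; apply/embedsP; split=> //; apply: subset_trans sE.
Qed.

Lemma copy_set_local n (E : {set {set 'I_n}}) (S : {set 'I_n}) :
  copy_set E S -> copy_set [set e in E | e \subset S] S.
Proof.
move=> /existsP [f /andP[/embedsP [fi fE] SE]]; apply/existsP; exists f.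
rewrite SE andbT; apply/embedsP; split=> //; apply/subsetP => e' e'f.
rewrite inE (subsetP fE) //=; case/imsetP: e'f => e _ ->; rewrite (eqP SE).
exact/imsetS/subsetT.
Qed.

(* Strictly 1-balanced and without isolated vertices. *)
Definition balanced : Prop :=
  [/\ EK \subset pairs k, cover EK = setT &
      forall I : {set 'I_k}, 1 < #|I| -> #|I| < k ->
        k.-1 * #|[set e in EK | e \subset I]| < #|EK| * #|I|.-1].

End Embeddings.

Lemma critical_ext n b (C C' : {set {set 'I_n}} -> {set 'I_n} -> bool) E :
  C =2 C' -> critical b C E -> critical b C' E.
Proof.
move=> eC [np pr]; split=> [[P [sP iP dP hP]]|E' /pr [P [sP iP dP hP]]].
  by apply: np; exists P; split=> // S; rewrite eC; apply: hP.
by exists P; split=> // S; rewrite -eC; apply: hP.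
Qed.

Lemma imset_pair (aT rT : finType) (f : aT -> rT) x y : f @: [set x; y] = [set f x; f y].
Proof. by rewrite imsetU !imset_set1. Qed.

Section CliqueCopies.
Variable k : nat.

Lemma card_clique_edges : 2 * #|clique_edges k| = k * k.-1.
Proof.
have -> : #|clique_edges k| = 'C(k, 2) by rewrite /clique_edges /pairs card_draws card_ord.
by rewrite -mul_bin_diag bin1.
Qed.

Lemma copy_set_clique n (E : {set {set 'I_n}}) S :
  copy_set (clique_edges k) E S = clique_set k E S.
Proof.
apply/existsP/clique_setP => [[f /andP[/embedsP [fi /subsetP fE] /eqP ->]]|[cS aS]].
  rewrite card_imset // cardsT card_ord; split=> // u v /imsetP [i _ ->] /imsetP [j _ ->] nij.
  apply: fE; rewrite -imset_pair; apply: imset_f; rewrite inE cards2.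
  by have [e|//] := eqVneq i j; move: nij; rewrite e eqxx.
pose f := [ffun i : 'I_k => enum_val (cast_ord (esym cS) i)].
have fi : injective f.
  by move=> i j; rewrite !ffunE => /enum_val_inj /cast_ord_inj.
have fS i : f i \in S by rewrite ffunE enum_valP.
exists f; apply/andP; split.
  apply/embedsP; split=> //; apply/subsetP => e' /imsetP [e].
  rewrite inE => /cards2P [i [j [nij ->]]] ->; rewrite imset_pair; apply: aS => //.
  by apply: contra nij => /eqP /fi ->.
rewrite eq_sym eqEcard card_imset // cardsT card_ord cS leqnn andbT.
by apply/subsetP => u /imsetP [i _ ->].
Qed.

Lemma clique_balanced : 1 < k -> balanced (clique_edges k).
Proof.
move=> k2; split=> //.
  apply/setP => i; rewrite inE; apply/bigcupP.
  have /card_gt0P [j] : 0 < #|[set: 'I_k] :\ i|.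
    have := cardsT 'I_k; rewrite card_ord (cardsD1 i) inE.
    by move: #|_| k2; clear; lia.
  rewrite !inE andbT => nji; exists [set i; j]; last exact: set21.
  by rewrite inE cards2 (eq_sym i) nji.
move=> I I2 Ik.
have eI : #|[set e in clique_edges k | e \subset I]| = 'C(#|I|, 2).
  by rewrite -cards_draws; apply: eq_card => e; rewrite !inE andbC.
have cI : 2 * 'C(#|I|, 2) = #|I| * #|I|.-1 by rewrite -mul_bin_diag bin1.
rewrite eI -(ltn_pmul2l (isT : 0 < 2)) mulnCA cI (mulnA 2) card_clique_edges mulnA.
rewrite ltn_pmul2r; last by move: #|I| I2; clear; lia.
by rewrite mulnC ltn_pmul2r //; move: k2; clear; lia.
Qed.

End CliqueCopies.

Section CycleCopies.
Variable k : nat.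
Hypothesis k3 : 2 < k.

Lemma ordS_neq (i : 'I_k) : ordS i != i.
Proof.
rewrite -val_eqE /=; have ik := ltn_ord i; have [lt|ge] := ltnP i.+1 k.
  by rewrite modn_small //; move: lt; clear; lia.
have -> : i.+1 = k by apply/eqP; rewrite eqn_leq ik ge.
by rewrite modnn; move: ge k3; clear; lia.
Qed.

Lemma ordS2_neq (i : 'I_k) : ordS (ordS i) != i.
Proof.
rewrite -val_eqE /=; have ik := ltn_ord i; have [lt|ge] := ltnP i.+1 k.
  rewrite (modn_small lt); have [lt2|ge2] := ltnP i.+2 k.
    by rewrite modn_small //; clear; lia.
  have -> : i.+2 = k by apply/eqP; rewrite eqn_leq lt ge2.
  by rewrite modnn; move: ge2 k3; clear; lia.
have -> : i.+1 = k by apply/eqP; rewrite eqn_leq ik ge.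
by rewrite modnn modn_small; move: ge k3; clear; lia.
Qed.

Lemma cycle_edge_inj : injective (fun i : 'I_k => [set i; ordS i]).
Proof.
move=> i j /setP eij; have := eij i; have := eij j; rewrite !inE !eqxx /=.
move=> /orP[/eqP //|/eqP ej] /esym /orP[/eqP //|/eqP ei].
by move: (ordS2_neq i); rewrite -ej -ei eqxx.
Qed.

Lemma card_cycle_edges : #|cycle_edges k| = k.
Proof. by rewrite card_imset ?card_ord //; apply: cycle_edge_inj. Qed.

Lemma ordS_closed (I : {set 'I_k}) : I != set0 -> {in I, forall i, ordS i \in I} -> I = setT.
Proof.
move=> /set0Pn [i0 i0I] cl.
have it m : iter m (@ordS k) i0 \in I by elim: m => //= m IH; apply: cl.
have val_it m : val (iter m (@ordS k) i0) = (i0 + m) %% k.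
  elim: m => [|m IH] /=; first by rewrite addn0 modn_small.
  by rewrite IH addnS -addn1 modnDml addn1.
apply/setP => j; rewrite inE.
have -> : j = iter (j + (k - i0)) (@ordS k) i0; last exact: it.
apply/val_inj; rewrite val_it addnCA subnKC; last exact: ltnW.
by rewrite modnDr modn_small.
Qed.

(** A nonempty proper subset is not closed under successor, so it spans fewer edges than it has
    vertices. *)
Lemma cycle_balanced : balanced (cycle_edges k).
Proof.
split.
- by apply/subsetP => e /imsetP [i _ ->]; rewrite inE cards2 (eq_sym i) ordS_neq.
- apply/setP => i; rewrite inE; apply/bigcupP; exists [set i; ordS i]; last exact: set21.
  exact: imset_f.
move=> I I2 Ik; rewrite card_cycle_edges.
have lt : #|[set e in cycle_edges k | e \subset I]| < #|I|.
  apply: leq_ltn_trans (_ : #|[set i in I | ordS i \in I]| < _).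
    apply: leq_trans (leq_imset_card (fun i : 'I_k => [set i; ordS i]) _).
    apply/subset_leq_card/subsetP => e; rewrite inE => /andP[/imsetP [i _ ->]].
    by rewrite subUset !sub1set => iI; apply: imset_f; rewrite inE.
  apply: proper_card; apply/properP; split; first by apply/subsetP => i; rewrite inE => /andP[].
  have [/exists_inP [i iI niI]|/exists_inPn all] := boolP [exists i in I, ordS i \notin I].
    by exists i => //; rewrite inE iI.
  suff IT : I = setT by move: Ik; rewrite IT cardsT card_ord ltnn.
  apply: ordS_closed; first by rewrite -card_gt0; apply: ltnW.
  by move=> i /all; rewrite negbK.
move: #|I| #|[set e in _ | _]| I2 lt k3; clear => s e; nia.
Qed.

Lemma cycle_copy_deg n (E : {set {set 'I_n}}) S v :
  copy_set (cycle_edges k) E S -> v \in S -> 1 < #|nbh E v :&: S|.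
Proof.
move=> /existsP [f /andP[/embedsP [fi /subsetP fE] /eqP ->]] /imsetP [i _ ->].
have fadj j : adj E (f j) (f (ordS j)).
  by apply: fE; rewrite -imset_pair; apply/imset_f/imset_f.
apply/card_gt1P; exists (f (ordS i)), (f (ord_pred i)); split.
- by rewrite in_setI in_nbh fadj imset_f.
- rewrite in_setI in_nbh adjC imset_f // andbT.
  by have := fadj (ord_pred i); rewrite ord_predK.
apply/negP => /eqP /fi e; have := ordS2_neq (ord_pred i).
by rewrite ord_predK e eqxx.
Qed.

Lemma cycle_copy_nonempty n (E : {set {set 'I_n}}) S :
  copy_set (cycle_edges k) E S -> S != set0.
Proof.
move=> /existsP [f /andP[_ /eqP ->]]; apply/set0Pn; exists (f (Ordinal (ltnW (ltnW k3)))).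
exact: imset_f.
Qed.

End CycleCopies.

Lemma four_cycle_copy n (E : {set {set 'I_n}}) S v : E \subset pairs n ->
  copy_set (cycle_edges 4) E S -> v \in S -> exists p w q,
  [/\ S = [set v; p; w; q], uniq [:: v; p; w; q], adj E v p, adj E p w & adj E w q /\ adj E q v].
Proof.
move=> sE /existsP [f /andP[/embedsP [fi /subsetP fE] /eqP ->]] /imsetP [i _ ->].
have fadj j : adj E (f j) (f (ordS j)).
  by apply: fE; rewrite -imset_pair; apply/imset_f/imset_f.
have us : uniq [:: i; ordS i; ordS (ordS i); ordS (ordS (ordS i))].
  by move: i => [[|[|[|[|]]]] ?].
have i4 : ordS (ordS (ordS (ordS i))) = i.
  by apply/val_inj; move: i {us} => [[|[|[|[|]]]] ?].
exists (f (ordS i)), (f (ordS (ordS i))), (f (ordS (ordS (ordS i)))); split=> //.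
- have -> : [set: 'I_4] = [set i; ordS i; ordS (ordS i); ordS (ordS (ordS i))].
    apply/esym/eqP; rewrite eqEcard subsetT cardsT card_ord.
    suff -> : [set i; ordS i; ordS (ordS i); ordS (ordS (ordS i))] =
       [set j in [:: i; ordS i; ordS (ordS i); ordS (ordS (ordS i))]].
      by rewrite cardsE (card_uniqP us).
    by apply/setP => j; rewrite !inE -!orbA.
  by rewrite !imsetU !imset_set1.
- by rewrite -[[:: _; _; _; _]]/(map f [:: i; ordS i; ordS (ordS i); ordS (ordS (ordS i))]) map_inj_uniq.
- by split=> //; have := fadj (ordS (ordS (ordS i))); rewrite i4.
Qed.

Lemma cycle_edges3 : cycle_edges 3 = clique_edges 3.
Proof.
apply/eqP; rewrite eqEcard; apply/andP; split.
  by have [] := @cycle_balanced 3 isT.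
by rewrite card_cycle_edges //; have := card_clique_edges 3; move: #|_|; clear; lia.
Qed.

Lemma critical_dense k b (EK : {set {set 'I_k}}) : 3 < k \/ k = 3 /\ b = 2 -> (3 < k -> b = 1) ->
  EK = clique_edges k \/ EK = cycle_edges k ->
  forall n (E : {set {set 'I_n}}), E \subset pairs n -> critical b (copy_set EK (n := n)) E ->
  #|EK| * #|cover E| < k.-1 * #|E|.
Proof.
move=> kb b1 EKE n E sE cr.
have clique_case : EK = clique_edges k -> k * #|cover E| < 2 * #|E| ->
    #|EK| * #|cover E| < k.-1 * #|E|.
  move=> ->; have := card_clique_edges k; have : 0 < k.-1 by case: kb => [|[-> _]] //; clear; lia.
  by move: #|clique_edges k| #|cover E| #|E|; clear; nia.
have [k4|[ek eb]] := kb; last first.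
  subst k b; have EK3 : EK = clique_edges 3 by case: EKE => ->; rewrite ?cycle_edges3.
  apply: clique_case => //; apply: triangle_critical => //.
  by apply: critical_ext cr => E' S; rewrite EK3 copy_set_clique.
rewrite b1 // in cr; case: EKE => eK.
  apply: clique_case => //; apply: large_clique_critical => //.
  by apply: critical_ext cr => E' S; rewrite eK copy_set_clique.
have k3 : 2 < k by apply: ltnW.
rewrite {1}eK card_cycle_edges //.
have Cm := @copy_set_mono _ EK n; have Cl := @copy_set_local _ EK n.
have Cd S v : copy_set EK E S -> v \in S -> 1 < #|nbh E v :&: S|.
  by rewrite eK; apply: cycle_copy_deg.
have C0 S : copy_set EK E S -> S != set0 by rewrite eK; apply: cycle_copy_nonempty.
have [k5|k5] := ltnP 4 k; first exact: (long_cycle_critical Cm Cl sE Cd cr k5 C0).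
have ek : k = 4 by apply/eqP; rewrite eqn_leq k4 k5.
subst k; apply: (four_cycle_critical Cm Cl sE Cd _ cr C0) => S v.
by rewrite eK; apply: four_cycle_copy.
Qed.

(** * Exploration of connected unions of copies *)

Section Exploration.
Variables (k : nat) (EK : {set {set 'I_k}}).
Hypothesis bal : balanced EK.
Hypothesis k2 : 1 < k.
Local Notation q := #|EK|.

Section Copies.
Variable n : nat.
Implicit Types (U E G : {set {set 'I_n}}) (f : {ffun 'I_k -> 'I_n}) (A : {set 'I_n}).

(** Connectivity without paths, in the form that an exploration getting stuck too early
    contradicts. *)
Definition connected_copies E : Prop := forall U, U \subset E -> U != set0 ->
  (forall f, embeds EK E f -> (exists i, f i \in cover U) -> copy_edges EK f \subset U) -> U = E.

Lemma cover_copy_edges f : cover (copy_edges EK f) = f @: setT.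
Proof.
have [_ cK _] := bal; apply/setP => v; apply/bigcupP/imsetP => [[e' /imsetP [e eK ->]]|[i _ ->]].
  by case/imsetP => i ie ->; exists i.
have : i \in cover EK by rewrite cK inE.
by case/bigcupP => e eK ie; exists (f @: e); apply: imset_f.
Qed.

Lemma coverU U E : cover (U :|: E) = cover U :|: cover E.
Proof. by rewrite /cover bigcup_setU. Qed.

Lemma card_copy_edges f : injective f -> #|copy_edges EK f| = q.
Proof. by move=> fi; rewrite card_imset //; apply: imset_inj. Qed.

(** A proper closed part [U] has a pairing of its own. Restricted to the vertices of [U] it hits
    every copy meeting them, which is a reduction. *)
Lemma critical_connected b E : E \subset pairs n -> critical b (copy_set EK (n := n)) E -> connected_copies E.
Proof.
move=> sE cr U sU U0 cl; apply/eqP/negPn/negP => nUE.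
have [P [sP iP dP hP]] : pairable b (copy_set EK (n := n)) U.
  by apply: cr.2; rewrite properEneq nUE.
have /set0Pn [e eU] := U0.
have /set0Pn [x xe] : e != set0.
  by rewrite -card_gt0 (card_edge sE) // (subsetP sU).
have xU : x \in cover U by apply/bigcupP; exists e.
have xE : x \in cover E by apply/bigcupP; exists e => //; apply: (subsetP sU).
apply: (@critical_irreducible n b _ (@copy_set_mono _ EK n) (@copy_set_local _ EK n) E cr
  (cover U) (fun u v => [&& P u v, u \in cover U & v \in cover U]) x) => //.
- by move=> u v; rewrite sP [(u \in _) && _]andbC.
- by move=> u; rewrite iP.
- by move=> u v /and3P[].
- move=> v; apply: leq_trans (dP v); apply/subset_leq_card/subsetP => u; rewrite !inE.
  by case/and3P.
move=> S y /existsP [f /andP[fE /eqP SE]] yS yU.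
have fU : copy_edges EK f \subset U.
  by apply: cl fE _; move: yS; rewrite SE => /imsetP [i _ e']; exists i; rewrite -e'.
have CS : copy_set EK U S.
  apply/existsP; exists f; rewrite SE eqxx andbT; apply/embedsP; split=> //.
  by have /embedsP [] := fE.
have SU u : u \in S -> u \in cover U.
  rewrite SE -cover_copy_edges => /bigcupP [e' e'f ue']; apply/bigcupP; exists e' => //.
  exact: (subsetP fU).
have /hitsP [u [v [uS vS Puv]]] := hP _ CS.
by apply/hitsP; exists u, v; rewrite Puv !SU.
Qed.

Variable L : nat.

(** Two reasons to stop, both making [U] unlikely: density wins a factor [n^(-1/q)], and with [L]
    about [log2 n] size wins through the small constant in [p]. *)
Definition terminal U := (q * #|cover U| < k.-1 * #|U|) || (L <= #|U|).

(* [A] is the set of vertices of the explored part [U] still to be processed. *)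
Fixpoint explored (fuel : nat) G A U : bool :=
  terminal U ||
  match fuel with
  | 0 => false
  | m.+1 => if [pick v in A] is Some v then
      explored m G (A :\ v) U ||
      [exists f : {ffun 'I_k -> 'I_n},
        [&& injectiveb f, v \in f @: setT & ~~ (copy_edges EK f \subset U)] &&
        ((copy_edges EK f \subset G) &&
          explored m G (A :|: f @: setT :\: cover U) (U :|: copy_edges EK f))]
    else false
  end.

(** Taking only copies inside [E], the exploration cannot get stuck before it has reached [E], which
    is terminal. A step removes a vertex from [A], or adds an edge and at most [k - 1] vertices, so
    the quantity compared with [fuel] decreases. *)
Lemma explored_complete E G fuel A U : E \subset G -> connected_copies E ->
  q * #|cover E| < k.-1 * #|E| -> U \subset E -> U != set0 -> A \subset cover U ->
  (forall f, embeds EK E f -> (exists2 i, f i \in cover U & f i \notin A) ->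
     copy_edges EK f \subset U) ->
  k * (#|E| - #|U|) + #|A| <= fuel -> explored fuel G A U.
Proof.
move=> sEG conn dense; have termE : terminal E by rewrite /terminal dense.
elim: fuel A U => [|m IH] A U sU U0 sA done lem /=.
  have -> : U = E; last by rewrite termE.
  apply/eqP; rewrite eqEcard sU /=; move: lem k2; move: #|E| #|U| #|A|; clear; nia.
apply/orP; case: pickP => [v vA|A0]; last first.
  left; suff -> : U = E by [].
  apply: conn => // f fE [i fi]; apply: done fE _; exists i => //.
  by have /= -> := A0 (f i).
have vU : v \in cover U := subsetP sA v vA.
have [/existsP [f /and3P[fE vf nfU]]|/existsPn no] := boolP [exists f : {ffun 'I_k -> 'I_n},
   [&& embeds EK E f, v \in f @: setT & ~~ (copy_edges EK f \subset U)]].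
  right; apply/orP; right; apply/existsP; exists f; have /embedsP [fi sf] := fE.
  rewrite vf nfU !andbT; have -> : injectiveb f by apply/injectiveP.
  rewrite (subset_trans sf sEG) /=; apply: IH.
  - by rewrite subUset sU.
  - by apply/set0Pn; have /set0Pn [e eU] := U0; exists e; rewrite inE eU.
  - rewrite coverU cover_copy_edges subUset (subset_trans sA (subsetUl _ _)) /=.
    by apply: subset_trans (subsetDl _ _) (subsetUr _ _).
  - move=> g gE [i]; rewrite coverU cover_copy_edges !inE negb_or => gi /andP[giA].
    rewrite negb_and negbK => gi2; apply: subset_trans (subsetUl _ _); apply: done gE _.
    by exists i => //; case/orP: gi => // gi3; rewrite gi3 orbF in gi2.
  - have lt : #|U| < #|U :|: copy_edges EK f|.
      apply: proper_card; rewrite properE subsetUl /=; apply: contra nfU => s.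
      by apply: subset_trans s; apply: subsetUr.
    have le : #|U :|: copy_edges EK f| <= #|E| by apply/subset_leq_card; rewrite subUset sU.
    have cA : #|A :|: f @: setT :\: cover U| <= #|A| + k.-1.
      apply: leq_trans (leq_card_setU _ _) _; rewrite leq_add2l.
      have : #|(f @: setT) :\: cover U| <= #|(f @: setT) :\ v|.
        by apply/subset_leq_card/setDS; rewrite sub1set.
      have := card_imset setT fi; rewrite cardsT card_ord (cardsD1 v (f @: setT)) vf.
      by move: #|(f @: setT) :\ v| #|(f @: setT) :\: cover U|; clear; lia.
    by move: lem lt le cA k2; move: #|E| #|U| #|A| #|U :|: _| #|A :|: _|; clear; nia.
right; apply/orP; left; apply: IH => //.
- by apply: subset_trans sA; apply: subD1set.
- move=> f fE [i fiU]; rewrite in_setD1 negb_and negbK => /orP[/eqP e|fiA].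
    have := no f; rewrite fE -e imset_f //= negbK //.
  by apply: done fE _; exists i.
- by move: lem; rewrite (cardsD1 v A) vA; clear; lia.
Qed.

Lemma copy_edges_pairs f : injective f -> copy_edges EK f \subset pairs n.
Proof.
have [sK _ _] := bal; move=> fi; apply/subsetP => e' /imsetP [e eK ->].
by have := subsetP sK e eK; rewrite !inE card_imset.
Qed.

Lemma card_copy_cap U f : injective f ->
  #|copy_edges EK f :&: U| <= #|[set e in EK | e \subset f @^-1: cover U]|.
Proof.
move=> fi; rewrite -(card_imset [set e in EK | _] (imset_inj fi)).
apply/subset_leq_card/subsetP => e' /setIP[/imsetP [e eK ->] eU]; apply: imset_f.
rewrite inE eK; apply/subsetP => i ie; rewrite inE; apply/bigcupP; exists (f @: e) => //.
exact: imset_f.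
Qed.

Lemma card_preim_cover U f : injective f ->
  #|f @^-1: cover U| = #|f @: setT :&: cover U|.
Proof.
move=> fi; rewrite -(card_imset (f @^-1: cover U) fi); apply: eq_card => u.
rewrite in_setI; apply/imsetP/andP => [[i]|[/imsetP [i _ ->] iU]].
  by rewrite inE => iU ->; rewrite imset_f.
by exists i; rewrite ?inE.
Qed.

(** Here [d] counts new vertices and [t] old edges. If the copy meets [U] only in [v], then
    [(k-1) e - q v] does not change; otherwise it grows by at least one, by strict balancedness
    applied to the overlap, or because an edge is new when all vertices are old. *)
Lemma add_copy U f v : injective f -> v \in f @: setT -> v \in cover U ->
  ~~ (copy_edges EK f \subset U) ->
  let d := #|f @: setT :\: cover U| in let t := #|copy_edges EK f :&: U| in
  [/\ #|cover (U :|: copy_edges EK f)| = #|cover U| + d,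
      #|U :|: copy_edges EK f| = #|U| + (q - t), t <= q &
      d = k.-1 /\ t = 0 \/ q * d + (k.-1 * t).+1 <= k.-1 * q].
Proof.
move=> fi vf vU nsub d t.
have cf : #|f @: setT| = k by rewrite card_imset // cardsT card_ord.
have sd : #|f @: setT :&: cover U| + d = k by rewrite cardsID.
have s1 : 0 < #|f @: setT :&: cover U| by apply/card_gt0P; exists v; rewrite inE vf.
have tq : t < q.
  rewrite -(card_copy_edges fi); apply: proper_card; rewrite properE subsetIl.
  by apply: contra nsub => s; apply: subset_trans s (subsetIr _ _).
split.
- rewrite coverU cover_copy_edges cardsU /d cardsD setIC -addnBA //.
  exact/subset_leq_card/subsetIl.
- rewrite cardsU setIC -(card_copy_edges fi) -addnBA //.
  exact/subset_leq_card/subsetIl.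
- exact: ltnW.
have te := card_copy_cap U fi; have cI := card_preim_cover U fi; rewrite -/t in te.
have [sK _ balI] := bal.
have [e1|s2] : #|f @: setT :&: cover U| = 1 \/ 1 < #|f @: setT :&: cover U|.
  by move: #|_| s1; clear; lia.
  left; split; first by move: sd; rewrite e1; clear; lia.
  apply/eqP; rewrite -leqn0; apply: leq_trans te _; rewrite leqn0 cards_eq0.
  apply/eqP/setP => e; rewrite !inE; apply/negP => /andP[eK sub].
  have := subset_leq_card sub; rewrite cI e1.
  by have := subsetP sK e eK; rewrite inE => /eqP ->.
right; have kq : 0 < k.-1 by move: k2; clear; lia.
have [sk|sk] := ltnP #|f @: setT :&: cover U| k.
  have lt := balI (f @^-1: cover U); rewrite cI in lt; have {}lt := lt s2 sk.
  have -> : k.-1 * q = q * d + q * #|f @: setT :&: cover U|.-1.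
    rewrite mulnC -mulnDr; congr (_ * _); move: sd s1; move: #|_ :&: _| d; clear; lia.
  by rewrite leq_add2l; apply: leq_ltn_trans lt; rewrite leq_mul2l te orbT.
have -> : d = 0 by move: sd sk; move: #|_ :&: _| d; clear; lia.
rewrite muln0 add0n; apply: leq_trans (_ : k.-1 * t.+1 <= _).
  by rewrite mulnS; move: kq; clear; lia.
by rewrite leq_mul2l tq orbT.
Qed.

End Copies.

End Exploration.

(** * The game *)

Lemma subset_of_card (T : finType) (A F : {set T}) m : A \subset F -> #|A| <= m -> m <= #|F| ->
  exists S : {set T}, [/\ A \subset S, S \subset F & #|S| = m].
Proof.
move=> sAF leAm lemF; have [d] : exists d, m = #|A| + d by exists (m - #|A|); rewrite subnKC.
elim: d A sAF leAm => [|d IH] A sAF leAm em; first by exists A; rewrite em addn0.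
have /card_gt0P [x /setDP[xF xA]] : 0 < #|F :\: A|.
  by rewrite cardsDS // subn_gt0; move: lemF; rewrite em; move: #|A| #|F|; clear; lia.
have [||| S [sS SF cS]] := IH (x |: A).
- by rewrite subUset sub1set xF.
- by rewrite cardsU1 xA em; move: #|A|; clear; lia.
- by rewrite em cardsU1 xA; move: #|A|; clear; lia.
by exists S; split=> //; apply: subset_trans sS; apply: subsetUr.
Qed.

Section Game.
Variables (h : nat) (EH : {set {set 'I_h}}) (n : nat) (EG : {set {set 'I_n}}) (b : nat).
Implicit Types M B : {set 'I_n}.

Section Breaker.
Variable P : rel 'I_n.
Hypotheses (sP : symmetric P) (iP : irreflexive P).
Hypothesis dP : forall v, #|[set u | P v u]| <= b.
Definition independent M := [forall u in M, forall v in M, ~~ P u v].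
Hypothesis noH : forall M, independent M -> ~~ contains_copy EH EG M.

Definition partners M := [set u | [exists v in M, P v u]].

Lemma indep_partners M : independent M -> [disjoint partners M & M].
Proof.
move=> /forall_inP iM; apply/pred0P => u /=; apply/negP => /andP[].
rewrite inE => /exists_inP [v vM Pvu] uM.
by have /forall_inP /(_ u uM) := iM v vM; rewrite Pvu.
Qed.

(** Invariant: when Maker is to move, Breaker owns all [P]-neighbours of Maker's vertices; when
    Breaker is to move, at most [b] of them are missing. *)
Lemma breaker_wins_from fuel M B turn : [disjoint M & B] -> independent M ->
  (if turn then partners M \subset B else #|partners M :\: B| <= b) ->
  ~~ maker_wins_from EH EG b fuel M B turn.
Proof.
elim: fuel M B turn => [|fuel IH] M B turn dMB iM inv /=; first exact: noH.
case: eqP => [_|/eqP /set0Pn [x0 x0F]]; first exact: noH.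
case: turn inv => [sub|card].
  apply/exists_inPn => v; rewrite !inE negb_or => /andP[vM vB].
  have nvM u : u \in M -> ~~ P u v.
    move=> uM; apply: contra vB => Puv; apply: (subsetP sub); rewrite inE.
    by apply/exists_inP; exists u.
  apply: IH.
  - by rewrite disjoints_subset subUset sub1set inE vB -disjoints_subset.
  - apply/forall_inP => u; rewrite !inE => /predU1P[->|uM]; apply/forall_inP => w;
      rewrite !inE => /predU1P[->|wM].
    + by rewrite iP.
    + by rewrite sP nvM.
    + exact: nvM.
    + by have /forall_inP /(_ u uM) /forall_inP /(_ w wM) := iM.
  - apply: leq_trans (dP v); apply/subset_leq_card/subsetP => u; rewrite !inE.
    case/andP => uB /exists_inP [w]; rewrite !inE => /predU1P[->//|wM] Pwu.
    by case/negP: uB; apply: (subsetP sub); rewrite inE; apply/exists_inP; exists w.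
set F := ~: (M :|: B).
have sub : partners M :\: B \subset F.
  apply/subsetP => u /setDP[uP uB]; rewrite !inE negb_or uB andbT.
  by rewrite (disjointFr (indep_partners iM) uP).
(* The rules prescribe the exact size of Breaker's move, so the wanted vertices are padded with
   arbitrary free ones. *)
have [|S [sS SF cS]] := subset_of_card sub _ (geq_minr b #|F|).
  by rewrite leq_min card subset_leq_card.
apply/forallPn; exists S; rewrite negb_imply SF cS eqxx /=; apply: IH => //.
  rewrite disjoints_subset setCU subsetI -disjoints_subset dMB /=.
  apply/subsetP => u uM; rewrite inE; apply/negP => /(subsetP SF).
  by rewrite !inE uM.
apply/subsetP => u uP; rewrite inE; have [//|uB] := boolP (u \in B).
by apply: (subsetP sS); rewrite inE uB.
Qed.

Lemma breaker_wins maker_first : ~~ makers_win EH EG b maker_first.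
Proof.
apply: breaker_wins_from.
- by rewrite -setI_eq0 setI0.
- by apply/forall_inP => u; rewrite inE.
- have -> : partners set0 = set0.
    by apply/setP => u; rewrite !inE; apply/exists_inPn => v; rewrite inE.
  by case: maker_first; rewrite ?sub0set // set0D cards0.
Qed.

End Breaker.

Section Maker.
Hypothesis dense : forall S : {set 'I_n}, n <= b.+1 * #|S| + b -> contains_copy EH EG S.
Hypothesis b0 : 0 < b.

(** Maker may play arbitrarily. The slack [b] on his turn allows for Breaker having moved first, and
    it is the additive [b] in [dense]. *)
Lemma maker_wins_from_dense fuel M B turn : [disjoint M & B] ->
  #|~: (M :|: B)| <= fuel -> #|B| <= b * #|M| + (if turn then b else 0) ->
  maker_wins_from EH EG b fuel M B turn.
Proof.
have fin M' B' t : [disjoint M' & B'] -> ~: (M' :|: B') = set0 ->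
    #|B'| <= b * #|M'| + (if t then b else 0) -> contains_copy EH EG M'.
  move=> d e0 le; apply: dense.
  have : #|M' :|: B'| = n by rewrite -[RHS]card_ord -cardsT -(setCK (M' :|: B')) e0 setC0.
  rewrite cardsU disjoint_setI0 // cards0 subn0; case: t le; move: #|M'| #|B'|; clear; nia.
elim: fuel M B turn => [|fuel IH] M B turn dMB leF leB /=.
  by apply: (fin M B turn) => //; apply/eqP; rewrite -cards_eq0 -leqn0.
case: eqP => [e0|/eqP /set0Pn [v vF]]; first exact: (fin M B turn).
have [vM vB] : v \notin M /\ v \notin B by apply/andP; move: vF; rewrite !inE negb_or.
case: turn leB => leB.
  apply/exists_inP; exists v => //; apply: IH.
  - by rewrite disjoints_subset subUset sub1set inE vB -disjoints_subset.
  - have -> : ~: (v |: M :|: B) = ~: (M :|: B) :\ v.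
      by apply/setP => u; rewrite !inE !negb_or andbA.
    by move: leF; rewrite (cardsD1 v (~: (M :|: B))) vF.
  - by rewrite cardsU1 vM; move: leB; move: #|M| #|B|; clear; nia.
apply/forallP => S; apply/implyP => /andP[SF /eqP cS]; apply: IH.
- rewrite disjoints_subset setCU subsetI -disjoints_subset dMB /=.
  apply/subsetP => u uM; rewrite inE; apply/negP => /(subsetP SF).
  by rewrite !inE uM.
- have -> : ~: (M :|: (B :|: S)) = ~: (M :|: B) :\: S.
    by rewrite setUA setCU setDE.
  rewrite cardsDS // cS; have : 0 < #|~: (M :|: B)| by apply/card_gt0P; exists v.
  by move: leF b0; move: #|~: _|; clear; lia.
- rewrite -[X in _ <= X + b](addn0); apply: leq_trans (leq_card_setU _ _) _.
  by rewrite cS; apply: leq_add => //; apply: geq_minl.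
Qed.

Lemma maker_wins_dense maker_first : makers_win EH EG b maker_first.
Proof.
apply: maker_wins_from_dense.
- by rewrite -setI_eq0 set0I.
- by apply: leq_trans (max_card _) _; rewrite card_ord.
- by rewrite cards0.
Qed.

End Maker.

End Game.

Section RandomGraphs.
Import ring lra.
Import Order.TTheory GRing.Theory Num.Theory.
Local Open Scope ring_scope.

(** * Random subsets *)

Section RandomSubset.
Variables (R : realFieldType) (T : finType) (p : R).
Hypothesis p01 : 0 <= p <= 1.
Implicit Types (W X Y A : {set T}) (F G : {set T} -> bool).

Let p0 : 0 <= p. Proof. by case/andP: p01. Qed.
Let q0 : 0 <= 1 - p. Proof. by rewrite subr_ge0; case/andP: p01. Qed.

Definition weight W X : R := p ^+ #|X| * (1 - p) ^+ (#|W| - #|X|).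

(** The ground set [W] is a parameter so that conditioning on one element amounts to deleting it
    from [W]. *)
Definition Pr W F : R := \sum_(X in powerset W | F X) weight W X.

Lemma weight_ge0 W X : 0 <= weight W X.
Proof. by apply: mulr_ge0; apply: exprn_ge0. Qed.

Lemma Pr_ge0 W F : 0 <= Pr W F.
Proof. by apply: sumr_ge0 => X _; apply: weight_ge0. Qed.

Lemma eq_Pr W F G : (forall X, X \subset W -> F X = G X) -> Pr W F = Pr W G.
Proof.
move=> e; apply: eq_bigl => X; rewrite inE; case sX: (X \subset W) => //=.
exact: e.
Qed.

Lemma Pr_mono W F G : (forall X, X \subset W -> F X -> G X) -> Pr W F <= Pr W G.
Proof.
move=> i; rewrite /Pr (bigID F (fun X => (X \in powerset W) && G X)) /=.
rewrite (eq_bigl (fun X => (X \in powerset W) && G X && F X)) => [|X].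
  by rewrite lerDl; apply: sumr_ge0 => X _; apply: weight_ge0.
rewrite inE; case sX: (X \subset W) => //=; case FX: (F X); rewrite ?andbF // andbT.
by apply/esym/i; rewrite ?sX.
Qed.

Lemma Pr_split W F G : Pr W F = Pr W (fun X => F X && G X) + Pr W (fun X => F X && ~~ G X).
Proof. by rewrite /Pr (bigID G) /=; congr (_ + _); apply: eq_bigl => X; rewrite andbA. Qed.

Lemma Pr_or W F G : Pr W (fun X => F X || G X) <= Pr W F + Pr W G.
Proof.
rewrite (Pr_split W (fun X => F X || G X) F).
apply: lerD; apply: Pr_mono => X _; first by move=> /andP[].
by case: (F X) => //=; rewrite ?andbT.
Qed.

Lemma Pr_has (I : Type) W (s : seq I) (F : I -> {set T} -> bool) :
  Pr W (fun X => has (fun i => F i X) s) <= \sum_(i <- s) Pr W (F i).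
Proof.
elim: s => [|i s IH].
  by rewrite big_nil /Pr big_pred0 // => X; rewrite andbF.
rewrite big_cons; apply: le_trans (Pr_or W (F i) _) _.
by rewrite lerD2l.
Qed.

Lemma Pr_exists (I : finType) W (Q : pred I) (F : I -> {set T} -> bool) :
  Pr W (fun X => [exists i, Q i && F i X]) <= \sum_(i | Q i) Pr W (F i).
Proof.
apply: le_trans (_ : Pr W (fun X => has (fun i => F i X) (enum Q)) <= _).
  apply: Pr_mono => X _ /existsP [i /andP[Qi Fi]]; apply/hasP; exists i => //.
  by rewrite mem_enum.
by apply: le_trans (Pr_has _ _ _) _; rewrite big_enum.
Qed.

Definition free_of t F := forall X, F (t |: X) = F X.

Lemma Pr_in t W F : t \in W -> free_of t F ->
  Pr W (fun X => (t \in X) && F X) = p * Pr (W :\ t) F.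
Proof.
move=> tW f; rewrite /Pr mulr_sumr.
rewrite (reindex_onto (fun Y => t |: Y) (fun X => X :\ t)) /=; last first.
  by move=> X /andP[_ /andP[tX _]]; rewrite setD1K.
apply: eq_big => [Y|Y].
  rewrite !inE eqxx f subUset sub1set tW /= subsetD1.
  have [tY|tY] := boolP (t \in Y).
    rewrite andbF; apply/negP => /andP[_ /eqP e].
    by have := setD11 t (t |: Y); rewrite e tY.
  by rewrite setU1K // eqxx !andbT.
rewrite !inE subUset sub1set tW /= => /andP[/andP[sY _] /eqP e].
have tY : t \notin Y by rewrite -e setD11.
rewrite /weight cardsU1 tY exprS -!mulrA; congr (_ * (_ * _ ^+ _)).
by rewrite (cardsD1 t W) tW.
Qed.

Lemma Pr_out t W F : t \in W -> free_of t F ->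
  Pr W (fun X => F X && ~~ (t \in X)) = (1 - p) * Pr (W :\ t) F.
Proof.
move=> tW f; rewrite /Pr mulr_sumr; apply: eq_big => [Y|Y].
  by rewrite !inE subsetD1 -andbA [F Y && _]andbC.
rewrite !inE => /andP[sY /andP[_ tY]].
have sY' : Y \subset W :\ t by rewrite subsetD1 sY.
rewrite /weight mulrCA -exprS; congr (_ * _ ^+ _).
have := subset_leq_card sY'; rewrite (cardsD1 t W) tW add1n => le.
by rewrite subSn.
Qed.

Lemma Pr_free t W F : t \in W -> free_of t F -> Pr W F = Pr (W :\ t) F.
Proof.
move=> tW f; rewrite (Pr_split W F (fun X => t \in X)) Pr_out //.
rewrite (@eq_Pr W _ (fun X => (t \in X) && F X)) ?Pr_in //; last by move=> X _; rewrite andbC.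
by ring.
Qed.

Lemma Pr_true W : Pr W xpredT = 1.
Proof.
elim: {W}_.+1 {-2}W (ltnSn #|W|) => // m IH W ltW.
have [->|/set0Pn [t tW]] := eqVneq W set0.
  rewrite /Pr (big_pred1 set0) ?/weight ?cards0 ?expr0 ?mulr1 // => X.
  by rewrite inE andbT subset0.
by rewrite (Pr_free tW) // IH //; move: ltW; rewrite (cardsD1 t W) tW.
Qed.

(** Independence: the assumption says that [F] does not look at the elements of [A]. *)
Lemma Pr_sub A W F : A \subset W -> (forall X, F (X :|: A) = F X) ->
  Pr W (fun X => (A \subset X) && F X) = p ^+ #|A| * Pr W F.
Proof.
elim: {A}_.+1 {-2}A (ltnSn #|A|) F => // m IH A ltA F sA f.
have [->|/set0Pn [t tA]] := eqVneq A set0.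
  by rewrite cards0 mul1r; apply: eq_Pr => X _; rewrite sub0set.
have tW : t \in W := subsetP sA t tA.
have ft : free_of t F.
  move=> X; rewrite -f -[RHS]f; congr F; apply/setP => u; rewrite !inE.
  by case: eqP => // ->; rewrite tA !orbT.
have sAt : A :\ t \subset W by apply: subset_trans sA; apply: subD1set.
have fAt X : F (X :|: A :\ t) = F X.
  by rewrite -ft setUCA setD1K.
have fg : free_of t (fun X => (A :\ t \subset X) && F X).
  move=> X; rewrite ft; congr (_ && _); apply/idP/idP => [/subsetP s|/subset_trans]; last first.
    by apply; apply: subsetUr.
  apply/subsetP => u uA; have := s u uA; rewrite !inE.
  by case/setD1P: uA => /negPf -> _.
rewrite (@eq_Pr W _ (fun X => (t \in X) && ((A :\ t \subset X) && F X))); last first.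
  by move=> X _; rewrite andbA -{1}(setD1K tA) subUset sub1set.
rewrite Pr_in // -Pr_free // IH // ?(cardsD1 t A) ?tA ?exprS ?mulrA //.
by move: ltA; rewrite (cardsD1 t A) tA.
Qed.

Lemma Pr_subset A W : A \subset W -> Pr W (fun X => A \subset X) = p ^+ #|A|.
Proof.
move=> sA; rewrite -[RHS]mulr1 -(Pr_true W) -(@Pr_sub A W xpredT) //.
by apply: eq_Pr => X _; rewrite andbT.
Qed.

(** A special case of Harris' inequality, obtained by replacing [F X] by [F (X :|: A)], which
    ignores [A] and is no more likely than [F]. *)
Lemma Pr_sub_decreasing A W F : A \subset W -> (forall X Y, X \subset Y -> F Y -> F X) ->
  Pr W (fun X => (A \subset X) && F X) <= p ^+ #|A| * Pr W F.
Proof.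
move=> sA dec.
rewrite (@eq_Pr W _ (fun X => (A \subset X) && F (X :|: A))); last first.
  by move=> X _; case: (boolP (A \subset X)) => //= sAX; rewrite (setUidPl sAX).
rewrite (@Pr_sub A W (fun X => F (X :|: A))) //; last by move=> X; rewrite -setUA setUid.
apply: ler_wpM2l; first exact: exprn_ge0.
by apply: Pr_mono => X _; apply: dec; apply: subsetUl.
Qed.

End RandomSubset.

(** * First moment bound for dense unions *)

Lemma card_cover_le n (U : {set {set 'I_n}}) : U \subset pairs n -> (#|cover U| <= 2 * #|U|)%N.
Proof.
move=> sU; apply: leq_trans (leq_card_cover U) _.
rewrite mulnC -sum_nat_const; apply: leq_sum => e /(subsetP sU).
by rewrite inE => /eqP ->.
Qed.

Lemma sum_prod_ffun (R : comRingType) (I T : finType) (g : T -> R) :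
  \sum_(f : {ffun I -> T}) \prod_i g (f i) = (\sum_u g u) ^+ #|I|.
Proof. by rewrite -(bigA_distr_bigA (fun _ u => g u)) prodr_const. Qed.

Lemma quarter_add (R : realFieldType) : 4^-1 + 4^-1 <= 2^-1 :> R.
Proof. by lra. Qed.

Lemma ler_pM4 (R : realFieldType) (Z zd a a' td xe xr X m m' dl : R) :
  0 <= Z -> 0 <= zd -> 0 <= a' -> 0 <= xe -> 0 <= xr -> 0 <= m' ->
  a' <= a * td -> xr <= X -> m' <= m * dl ->
  Z * zd * a' * (xe * xr) * m' <= Z * a * xe * m * (X * dl * (td * zd)).
Proof.
move=> Z0 zd0 a0 xe0 xr0 m0 la lx lm.
have -> : Z * a * xe * m * (X * dl * (td * zd)) = Z * zd * (a * td) * (xe * X) * (m * dl).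
  by ring.
apply: ler_pM => //; first by rewrite !mulr_ge0.
apply: ler_pM => //; rewrite ?mulr_ge0 //.
  by apply: ler_wpM2l => //; rewrite mulr_ge0.
exact: ler_wpM2l.
Qed.

Section ExplorationBound.
Variables (k : nat) (EK : {set {set 'I_k}}).
Hypothesis bal : balanced EK.
Hypothesis k2 : (1 < k)%N.
Local Notation q := #|EK|.
Variables (R : realFieldType) (n L : nat) (p z : R).
Hypothesis p01 : 0 <= p <= 1.
Hypothesis z01 : 0 < z <= 1.
(* [z] is n^(-1/q), hence [pz] below reads p <= x/4 * n^(-(k-1)/q). *)
Hypothesis nz : n%:R * z ^+ q = 1.
Hypothesis nL : (n <= 2 ^ L)%N.

(** [x] pays for copies attached at one vertex: the weights of the possible images of a vertex sum
    to at most 3. [D] pays for the others, where the sum is at most [2 L + 2] since fewer than [L]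
    edges cover at most [2 L] vertices. *)
Variables x D : R.
Hypothesis x0 : 0 < x.
Hypothesis x3 : x * 3 ^+ k <= 4^-1.
Hypothesis D1 : 1 <= D.
Hypothesis DL : D^-1 * (2 * L + 2)%:R ^+ k <= 4^-1.
Hypothesis pz : p <= x / 4 * z ^+ k.-1.

Implicit Types (U E G : {set {set 'I_n}}) (f : {ffun 'I_k -> 'I_n}) (A : {set 'I_n}).

Let z0 : 0 < z. Proof. by case/andP: z01. Qed.
Let z1 : z <= 1. Proof. by case/andP: z01. Qed.
Let p0 : 0 <= p. Proof. by case/andP: p01. Qed.

Let x1 : x <= 1.
Proof.
have c1 : 1 <= 3 ^+ k :> R by rewrite exprn_ege1 // ler1n.
have : x <= x * 3 ^+ k by rewrite ler_peMr // ltW.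
by move=> le; apply: le_trans le (le_trans x3 _); lra.
Qed.

Let D0 : 0 < D. Proof. exact: lt_le_trans D1. Qed.

Let q0 : (0 < q)%N.
Proof.
have [_ cK _] := bal; rewrite card_gt0; apply/eqP => e0.
have : Ordinal (ltnW k2) \in cover EK by rewrite cK inE.
by rewrite e0 /cover big_set0 inE.
Qed.

Let zexp a b : (a <= b)%N -> z ^+ b <= z ^+ a.
Proof. by move=> ab; apply: ler_wiXn2l => //; apply: ltW. Qed.

(* Bounds the probability that an exploration in state [(A, U)] ends in a terminal set. *)
Definition potential A U : R :=
  z ^+ (q * #|cover U| + 1) * 2 ^+ #|A| * x ^+ #|U| *
  D ^+ (q * #|cover U| + 1 - k.-1 * #|U|).

Lemma potential_ge0 A U : 0 <= potential A U.
Proof. by rewrite !mulr_ge0 // exprn_ge0 // ltW. Qed.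

Lemma potential_ge A U : z ^+ (q * #|cover U| + 1) * x ^+ #|U| <= potential A U.
Proof.
have a1 : 1 <= 2 ^+ #|A| :> R by rewrite exprn_ege1 // ler1n.
have d1 : 1 <= D ^+ (q * #|cover U| + 1 - k.-1 * #|U|) by rewrite exprn_ege1.
have c0 : 0 <= z ^+ (q * #|cover U| + 1) * x ^+ #|U| by rewrite mulr_ge0 // exprn_ge0 // ltW.
have -> : potential A U = z ^+ (q * #|cover U| + 1) * x ^+ #|U| *
    (2 ^+ #|A| * D ^+ (q * #|cover U| + 1 - k.-1 * #|U|)) by rewrite /potential; set a := z ^+ _; set a2 := 2 ^+ _; set a3 := x ^+ _; set a4 := D ^+ _; rewrite (mulrAC a) mulrA.
by apply: ler_peMr => //; apply: mulr_ege1.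
Qed.

(** If [U] is dense, [z ^+ (k.-1 * #|U|)] is already small enough. If [U] is large, the 4 in [pz]
    yields [4^(-|U|) <= n^(-2) = z^(2q)], which makes up for the at most [q + 1] missing factors
    [z]. *)
Lemma terminal_bound A U : (q * #|cover U| <= k.-1 * #|U| + q)%N ->
  terminal EK L U -> p ^+ #|U| <= potential A U.
Proof.
move=> inv term; apply: le_trans (potential_ge A U).
apply: le_trans (_ : (x / 4 * z ^+ k.-1) ^+ #|U| <= _).
  by rewrite lerXn2r // ?nnegrE // mulr_ge0 ?exprn_ge0 ?divr_ge0 // ltW.
rewrite exprMn -exprM expr_div_n [X in _ <= X]mulrC -mulrA.
apply: ler_wpM2l; first by rewrite exprn_ge0 // ltW.
have i41 : (4 ^+ #|U|)^-1 <= 1 :> R.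
  by rewrite invf_le1 ?exprn_gt0 // exprn_ege1 // ler1n.
case/orP: term => [lt|big].
  apply: le_trans (zexp (_ : q * #|cover U| + 1 <= k.-1 * #|U|)%N); last by rewrite addn1.
  by rewrite ler_piMl // exprn_ge0 // ltW.
have e4 : (4 ^+ #|U|)^-1 <= z ^+ (q + 1).
  apply: le_trans (_ : z ^+ (q + q) <= _); last by apply: zexp; rewrite leq_add2l.
  have zn : z ^+ q = n%:R^-1.
    have n0 : n%:R != 0 :> R by apply: contra_eq_neq nz => ->; rewrite mul0r eq_sym oner_neq0.
    by apply: (mulfI n0); rewrite nz divff.
  have n0 : (0 < n)%N by rewrite lt0n; apply: contra_eq_neq nz => ->; rewrite mul0r eq_sym oner_neq0.
  rewrite exprD zn -invfM lef_pV2 ?posrE ?exprn_gt0 ?mulr_gt0 ?ltr0n //.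
  rewrite -natrM -natrX ler_nat; apply: leq_trans (leq_mul nL nL) _.
  by rewrite -expnD addnn -muln2 mulnC expnM leq_exp2l.
apply: le_trans (_ : z ^+ (q + 1) * z ^+ (k.-1 * #|U|) <= _).
  by apply: ler_wpM2r => //; rewrite exprn_ge0 // ltW.
rewrite -exprD; apply: zexp; move: inv; clear; lia.
Qed.

(** Written as a product over the vertices of the copy, so that the sum over all maps factorises by
    [sum_prod_ffun]. *)
Lemma prod_outside f (V : {set 'I_n}) (c : R) : injective f ->
  \prod_i (if f i \in V then 1 else c) = c ^+ #|f @: setT :\: V|.
Proof.
move=> fi; rewrite (bigID (fun i => f i \in V)) /= big1 ?mul1r => [|i ->] //.
rewrite (eq_bigr (fun=> c)) => [|i /negPf -> //]; rewrite prodr_const; congr (_ ^+ _).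
rewrite -(card_imset _ fi); apply: eq_card => u; rewrite in_setD.
apply/imsetP/andP => [[i iV ->]|[uV /imsetP [i _ e]]]; first by rewrite imset_f.
by exists i; rewrite // unfold_in /= -e.
Qed.

(** Each new vertex costs [2 * z ^+ q], that is [1/n] for its choice and 2 for entering [A]. In
    addition an attachment at one vertex gains [x], because of its new edges, and any other lowers
    the exponent of [D]. *)
Lemma potential_add A U f v : U \subset pairs n -> (q * #|cover U| <= k.-1 * #|U| + q)%N ->
  injective f -> v \in f @: setT -> v \in cover U -> ~~ (copy_edges EK f \subset U) ->
  ~~ terminal EK L U ->
  (q * #|cover (U :|: copy_edges EK f)| <= k.-1 * #|U :|: copy_edges EK f| + q)%N /\
  potential (A :|: f @: setT :\: cover U) (U :|: copy_edges EK f) <= potential A U *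
    (x * \prod_i (if f i \in [set v] then 1 else 2 * z ^+ q) +
     D^-1 * \prod_i (if f i \in cover U then 1 else 2 * z ^+ q)).
Proof.
move=> sU inv fi vf vU nsub; rewrite /terminal negb_or -!ltnNge ltnS => /andP[phi _].
rewrite !prod_outside //.
have [eV eU tq cases] := add_copy bal k2 fi vf vU nsub.
have cA := leq_trans (leq_card_setU A (f @: setT :\: cover U)) (leqnn _).
have cf : #|f @: setT :\: [set v]| = k.-1.
  have := card_imset setT fi; rewrite cardsT card_ord (cardsD1 v) vf.
  by move: #|_ :\ v|; clear; lia.
rewrite cf; move: eV eU tq cases cA.
move: #|f @: setT :\: cover U| #|copy_edges EK f :&: U| => d t eV eU tq cases cA.
have z2 : 0 <= 2 * z ^+ q by rewrite mulr_ge0 // exprn_ge0 // ltW.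
have inv' : (q * #|cover (U :|: copy_edges EK f)| <= k.-1 * #|U :|: copy_edges EK f| + q)%N.
  rewrite eV eU; move: #|cover U| #|U| (q) cases inv tq; clear => c e m.
  by case=> [[-> ->]|]; nia.
split=> //; rewrite /potential eV eU mulnDr.
set v0 := #|cover U|; set e := #|U|.
have zE : z ^+ (q * v0 + q * d + 1) = z ^+ (q * v0 + 1) * (z ^+ q) ^+ d.
  by rewrite addnAC exprD exprM.
have le2 : 2 ^+ #|A :|: f @: setT :\: cover U| <= 2 ^+ #|A| * 2 ^+ d :> R.
  by rewrite -exprD ler_weXn2l // ler1n.
have Psi0 := potential_ge0 A U; rewrite /potential -/v0 -/e in Psi0.
have B1 : 0 <= x * (2 * z ^+ q) ^+ k.-1 by rewrite mulr_ge0 ?exprn_ge0 // ltW.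
have B2 : 0 <= D^-1 * (2 * z ^+ q) ^+ d by rewrite mulr_ge0 ?exprn_ge0 ?invr_ge0 // ltW.
have nn : [/\ 0 <= z ^+ (q * v0 + 1), 0 <= (z ^+ q) ^+ d,
    0 <= 2 ^+ #|A :|: f @: setT :\: cover U| :> R, 0 <= x ^+ e &
    forall a b, 0 <= x ^+ a /\ 0 <= D ^+ b].
  by split; try split; rewrite ?exprn_ge0 // ltW.
have [n1 n2 n3 n4 n5] := nn.
rewrite zE [x ^+ (_ + _)]exprD; case: cases => [[dk t0]|le].
  apply: le_trans (ler_wpM2l Psi0 (_ : x * (2 * z ^+ q) ^+ k.-1 <= _)); last by rewrite lerDl.
  have -> : (q * v0 + q * d + 1 - k.-1 * (e + (q - t)) = q * v0 + 1 - k.-1 * e)%N.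
    by rewrite dk t0 /v0 /e; move: #|cover U| #|U| (q) (k.-1); clear => c e m k'; nia.
  have -> : x * (2 * z ^+ q) ^+ k.-1 = x * 1 * (2 ^+ d * (z ^+ q) ^+ d).
    by rewrite mulr1 dk exprMn.
  apply: ler_pM4 => //; try exact: (n5 _ _).1; try exact: (n5 0%N _).2.
    by rewrite t0 subn0 -[X in _ <= X]expr1; apply: ler_wiXn2l => //; apply: ltW.
  by rewrite mulr1.
apply: le_trans (ler_wpM2l Psi0 (_ : D^-1 * (2 * z ^+ q) ^+ d <= _)); last by rewrite lerDr.
have -> : D^-1 * (2 * z ^+ q) ^+ d = 1 * D^-1 * (2 ^+ d * (z ^+ q) ^+ d).
  by rewrite mul1r exprMn.
apply: ler_pM4 => //; try exact: (n5 _ _).1; try exact: (n5 0%N _).2.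
  by apply: exprn_ile1 => //; apply: ltW.
rewrite ler_pdivlMr // -exprSr; apply: ler_weXn2l => //.
move: le phi tq; rewrite /v0 /e; move: #|cover U| #|U| (q) (k.-1); clear => c e m k'; nia.
Qed.

Lemma sum_outside (V : {set 'I_n}) :
  \sum_(u : 'I_n) (if u \in V then 1 else 2 * z ^+ q) <= #|V|%:R + 2.
Proof.
rewrite (bigID (mem V)) /=; apply: lerD.
  by rewrite (eq_bigr (fun=> 1)) => [|u ->//]; rewrite sumr_const.
apply: le_trans (_ : \sum_(u : 'I_n) 2 * z ^+ q <= _); last first.
  by rewrite sumr_const card_ord -[_ *+ n]mulr_natl mulrCA nz mulr1.
rewrite [X in _ <= X](bigID (mem V)) /= [X in _ <= X]addrC.
have c0 : 0 <= 2 * z ^+ q by rewrite mulr_ge0 // exprn_ge0 // ltW.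
rewrite (eq_bigr (fun=> 2 * z ^+ q)) => [|u /negPf -> //].
by rewrite lerDl; apply: sumr_ge0.
Qed.

(** Dropping [v] from [A] halves the potential through [2 ^+ #|A|]. The other half pays for all
    copies through [v]: attachments at one vertex and the remaining ones contribute a quarter
    each. *)
Lemma explored_bound fuel A U : U \subset pairs n -> A \subset cover U ->
  (q * #|cover U| <= k.-1 * #|U| + q)%N ->
  Pr p (pairs n) (fun G => (U \subset G) && explored EK L fuel G A U) <= potential A U.
Proof.
elim: fuel A U => [|m IH] A U sU sA inv /=.
  have [term|nterm] := boolP (terminal EK L U).
    apply: le_trans (terminal_bound A inv term); rewrite -(Pr_subset p sU).
    by apply: (Pr_mono p01) => X _ /andP[].
  by rewrite /Pr big_pred0 ?potential_ge0 // => X; rewrite !andbF.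
have [term|nterm] := boolP (terminal EK L U).
  apply: le_trans (terminal_bound A inv term); rewrite -(Pr_subset p sU).
  by apply: (Pr_mono p01) => X _ /andP[].
rewrite /=; case: pickP => [v vA|A0]; last first.
  by rewrite /Pr big_pred0 ?potential_ge0 // => X; rewrite !andbF.
have vU : v \in cover U := subsetP sA v vA.
pose Q f := [&& injectiveb f, v \in f @: setT & ~~ (copy_edges EK f \subset U)].
pose ev f G := (U :|: copy_edges EK f \subset G) &&
  explored EK L m G (A :|: f @: setT :\: cover U) (U :|: copy_edges EK f).
apply: le_trans (_ : Pr p (pairs n) (fun G => (U \subset G) && explored EK L m G (A :\ v) U ||
   [exists f, Q f && ev f G]) <= _).
  apply: (Pr_mono p01) => G _ /andP[UG /orP[ex|/existsP [f /andP[Qf /andP[fG ex]]]]].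
    by rewrite UG ex.
  by apply/orP; right; apply/existsP; exists f; rewrite /Q /ev Qf subUset UG fG.
apply: le_trans (Pr_or p01 _ _ _) _.
have half : potential (A :\ v) U = potential A U / 2.
  rewrite /potential (cardsD1 v A) vA exprS.
  by move: (z ^+ _) (2 ^+ _) (x ^+ _) (D ^+ _) => a1 a2 a3 a4; field.
have first_half : Pr p (pairs n) (fun G => (U \subset G) && explored EK L m G (A :\ v) U)
    <= potential A U / 2.
  by rewrite -half; apply: IH => //; apply: subset_trans sA; apply: subD1set.
suff second_half : Pr p (pairs n) (fun G => [exists f, Q f && ev f G]) <= potential A U / 2.
  by apply: le_trans (lerD first_half second_half) _; rewrite -splitr.
apply: le_trans (Pr_exists p01 _ _ _) _.
pose g1 (u : 'I_n) := if u \in [set v] then 1 else 2 * z ^+ q.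
pose g2 (u : 'I_n) := if u \in cover U then 1 else 2 * z ^+ q.
have c0 : 0 <= 2 * z ^+ q by rewrite mulr_ge0 // exprn_ge0 // ltW.
have g10 u : 0 <= g1 u by rewrite /g1; case: ifP.
have g20 u : 0 <= g2 u by rewrite /g2; case: ifP.
pose rhs f := x * \prod_i g1 (f i) + D^-1 * \prod_i g2 (f i).
have rhs0 f : 0 <= rhs f.
  by apply: addr_ge0; apply: mulr_ge0; rewrite ?invr_ge0 ?(ltW x0) ?(ltW D0) //; apply: prodr_ge0.
apply: le_trans (_ : \sum_(f | Q f) potential A U * rhs f <= _).
  apply: ler_sum => f /and3P[/injectiveP fi vf nsub].
  have [inv' le] := potential_add A sU inv fi vf vU nsub nterm.
  apply: le_trans le; apply: IH => //.
    by rewrite subUset sU (copy_edges_pairs bal).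
  rewrite coverU (cover_copy_edges bal) subUset (subset_trans sA (subsetUl _ _)) /=.
  by apply: subset_trans (subsetDl _ _) (subsetUr _ _).
apply: le_trans (_ : \sum_(f : {ffun 'I_k -> 'I_n}) potential A U * rhs f <= _).
  rewrite [X in _ <= X](bigID Q) /= lerDl; apply: sumr_ge0 => f _.
  by rewrite mulr_ge0 // potential_ge0.
rewrite -mulr_sumr; apply: ler_wpM2l; first exact: potential_ge0.
rewrite big_split /= -!mulr_sumr !sum_prod_ffun card_ord.
have s1 : \sum_u g1 u <= 3.
  by apply: le_trans (sum_outside [set v]) _; rewrite cards1 -(natrD R 1 2).
have s2 : \sum_u g2 u <= (2 * L + 2)%:R.
  apply: le_trans (sum_outside (cover U)) _; rewrite natrD lerD2r ler_nat.
  apply: leq_trans (card_cover_le sU) _; rewrite leq_mul2l /=.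
  by move: nterm; rewrite /terminal negb_or -!ltnNge => /andP[_ /ltnW].
have s10 : 0 <= \sum_u g1 u by apply: sumr_ge0.
have s20 : 0 <= \sum_u g2 u by apply: sumr_ge0.
have b1 : x * (\sum_u g1 u) ^+ k <= 4^-1.
  apply: le_trans x3; apply: ler_wpM2l; first exact: ltW.
  by rewrite lerXn2r // nnegrE.
have b2 : D^-1 * (\sum_u g2 u) ^+ k <= 4^-1.
  apply: le_trans DL; apply: ler_wpM2l; first by rewrite invr_ge0 ltW.
  by rewrite lerXn2r // nnegrE.
by apply: le_trans (lerD b1 b2) _; apply: quarter_add.
Qed.

(** The at most [n^k] choices of the first copy cancel against [z^(qk) = n^(-k)], which leaves one
    factor [z = n^(-1/q)]. *)
Lemma dense_union_bound (bad : {set {set 'I_n}} -> bool) :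
  (forall G, G \subset pairs n -> bad G -> exists E : {set {set 'I_n}},
     [/\ E \subset G, connected_copies EK E, q * #|cover E| < k.-1 * #|E| &
        exists f, embeds EK E f]%N) ->
  Pr p (pairs n) bad <= z * 2 ^+ k * D ^+ (q + 1).
Proof.
move=> Hbad.
pose fuel := (k * #|pairs n| + n)%N.
pose ev f G := (copy_edges EK f \subset G) && explored EK L fuel G (f @: setT) (copy_edges EK f).
apply: le_trans (_ : Pr p (pairs n) (fun G =>
    [exists f : {ffun 'I_k -> 'I_n}, injectiveb f && ev f G]) <= _).
  apply: (Pr_mono p01) => G sG /(Hbad G sG) [E [sE conn dense [f /embedsP [fi fE]]]].
  apply/existsP; exists f; have -> : injectiveb f by apply/injectiveP.
  rewrite /ev (subset_trans fE sE) /=; apply: (explored_complete bal k2 L sE conn dense) => //.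
  - by rewrite -card_gt0 card_copy_edges.
  - by rewrite (cover_copy_edges bal).
  - by move=> g _ [i]; rewrite (cover_copy_edges bal) => ->.
  rewrite /fuel leq_add //; last by apply: leq_trans (max_card _) _; rewrite card_ord.
  rewrite leq_mul2l; apply/orP; right; apply: leq_trans (leq_subr _ _) _.
  by apply/subset_leq_card/(subset_trans sE).
apply: le_trans (Pr_exists p01 _ _ _) _.
have bound f : injectiveb f -> Pr p (pairs n) (ev f) <= z ^+ (q * k) * (z * 2 ^+ k * D ^+ (q + 1)).
  move=> /injectiveP fi.
  apply: le_trans (explored_bound fuel (copy_edges_pairs bal fi) _ _) _.
  - by rewrite (cover_copy_edges bal).
  - rewrite (cover_copy_edges bal) card_copy_edges // card_imset // cardsT card_ord.
    by move: k2 (q); clear; nia.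
  rewrite /potential (cover_copy_edges bal) card_copy_edges // card_imset // cardsT card_ord.
  have -> : (q * k + 1 - k.-1 * q = q + 1)%N by move: k2 (q); clear; nia.
  rewrite exprD expr1.
  have xq : x ^+ q <= 1 by apply: exprn_ile1 => //; apply: ltW.
  rewrite -!mulrA; apply: ler_wpM2l; first by rewrite exprn_ge0 // ltW.
  apply: ler_wpM2l; first exact: ltW.
  apply: ler_wpM2l; first by rewrite exprn_ge0.
  by rewrite ler_piMl // exprn_ge0 // ltW.
apply: le_trans (ler_sum _ (fun f fi => bound f fi)) _.
have B0 : 0 <= z ^+ (q * k) * (z * 2 ^+ k * D ^+ (q + 1)).
  by rewrite !mulr_ge0 ?exprn_ge0 // ltW.
apply: le_trans (_ : \sum_(f : {ffun 'I_k -> 'I_n}) z ^+ (q * k) * (z * 2 ^+ k * D ^+ (q + 1)) <= _).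
  rewrite [X in _ <= X](bigID (fun f : {ffun 'I_k -> 'I_n} => injectiveb f)) /= lerDl.
  by apply: sumr_ge0.
rewrite sumr_const card_ffun !card_ord -[_ *+ (n ^ k)]mulr_natl mulrA natrX exprM -exprMn nz expr1n mul1r.
exact: lexx.
Qed.

End ExplorationBound.

(** * Janson's inequality *)

(* Averaging over a random subset [J] in which every index is kept with probability [th]. *)
Lemma sparse_subfamily (R : realFieldType) (I : finType) (th : R) (a : I -> R) (c : I -> I -> R) :
  0 <= th <= 1 ->
  exists J : {set I}, th * (\sum_i a i) - th ^+ 2 * (\sum_i \sum_(j | j != i) c i j) <=
    \sum_(i in J) a i - \sum_(i in J) \sum_(j in J | j != i) c i j.
Proof.
move=> th01; pose w J := weight th [set: I] J.
pose val (J : {set I}) := \sum_(i in J) a i - \sum_(i in J) \sum_(j in J | j != i) c i j.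
have sumw (F : {set I} -> bool) : \sum_(J | F J) w J = Pr th [set: I] F.
  by apply: eq_bigl => J; rewrite powersetT inE.
have mean : \sum_J w J * val J =
    th * (\sum_i a i) - th ^+ 2 * (\sum_i \sum_(j | j != i) c i j).
  rewrite /val; under eq_bigr => J _ do rewrite mulrBr !mulr_sumr.
  rewrite sumrB; congr (_ - _).
    rewrite (exchange_big_dep xpredT) //= mulr_sumr; apply: eq_bigr => i _.
    rewrite -mulr_suml sumw; congr (_ * _).
    rewrite (@eq_Pr _ _ _ _ _ (fun J : {set I} => [set i] \subset J)); last by move=> J _; rewrite sub1set.
    by rewrite Pr_subset ?subsetT // cards1 expr1.
  rewrite (exchange_big_dep xpredT) //= mulr_sumr; apply: eq_bigr => i _.
  under eq_bigr => J _ do rewrite mulr_sumr.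
  rewrite (exchange_big_dep (fun j => j != i)) /= => [|J j _ /andP[//]].
  rewrite mulr_sumr; apply: eq_bigr => j nji; rewrite -mulr_suml; congr (_ * _).
  rewrite (eq_bigl (fun J : {set I} => [set i; j] \subset J)); last first.
    by move=> J; rewrite subUset !sub1set nji andbT.
  by rewrite sumw Pr_subset ?subsetT // cards2 eq_sym nji.
apply/existsP; rewrite -[X in is_true X]negbK negb_exists; apply/negP => /forallP small.
have w1 : \sum_J w J = 1 by rewrite sumw Pr_true.
have w0 J : 0 <= w J by apply: weight_ge0.
set m := _ - _ in mean small.
have lt J : val J < m by have := small J; rewrite -ltNge.
have : \sum_J w J * val J < \sum_J w J * m.
  have le J : w J * val J <= w J * m by apply: ler_wpM2l => //; apply: ltW.
  rewrite lt_neqAle ler_sum ?andbT //; apply/negP => /eqP e.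
  have z J : w J * m - w J * val J = 0.
    have : \sum_J (w J * m - w J * val J) = 0 by rewrite sumrB e subrr.
    by move/psumr_eq0P => h; apply: h => // J' _; rewrite subr_ge0.
  have wJ J : w J = 0.
    have /eqP := z J; rewrite -mulrBr mulf_eq0 => /orP[/eqP //|].
    by rewrite subr_eq0 => /eqP em; have := lt J; rewrite em ltxx.
  by move: w1; rewrite big1 // => /eqP; rewrite eq_sym oner_eq0.
by rewrite mean -mulr_suml w1 mul1r ltxx.
Qed.

Section Janson.
Variables (R : realFieldType) (T I : finType) (p : R) (W : {set T}) (A : I -> {set T}).
Hypothesis p01 : 0 <= p <= 1.
Hypothesis AW : forall i, A i \subset W.
Implicit Types (s : seq I) (X Y : {set T}).

Let p0 : 0 <= p. Proof. by case/andP: p01. Qed.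

Definition none s X := all (fun i => ~~ (A i \subset X)) s.
Definition meets i j := ~~ [disjoint A i & A j].
(** A lower bound for the conditional probability of [A i] given that no set of [s] is present. *)
Definition gain i s : R := p ^+ #|A i| - \sum_(j <- s | meets i j) p ^+ #|A i :|: A j|.

Lemma none_decreasing s X Y : X \subset Y -> none s Y -> none s X.
Proof.
move=> sXY /allP nY; apply/allP => i /nY; apply: contra => sA.
exact: subset_trans sXY.
Qed.

Lemma none_filter s (Q : pred I) X : none s X -> none (filter Q s) X.
Proof. by move=> /allP n; apply/allP => i; rewrite mem_filter => /andP[_ /n]. Qed.

(** The events disjoint from [A i] are independent of it, and those meeting it are removed by a
    union bound, each joint event being estimated by [Pr_sub_decreasing]. A negative gain makes the
    claim trivial. *)
Lemma janson_step i s : Pr p W (none (i :: s)) <= (1 - gain i s) * Pr p W (none s).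
Proof.
pose c := [seq j <- s | ~~ meets i j]; pose d := [seq j <- s | meets i j].
have split : Pr p W (none s) = Pr p W (fun X => (A i \subset X) && none s X) + Pr p W (none (i :: s)).
  rewrite (Pr_split p W (none s) (fun X => A i \subset X)); congr (_ + _); apply: eq_Pr => X _.
    by rewrite andbC.
  by rewrite /= andbC.
suff le : gain i s * Pr p W (none s) <= Pr p W (fun X => (A i \subset X) && none s X).
  by rewrite mulrBl mul1r lerBrDl [X in _ <= X]split lerD2r.
have [neg|pos] := ltrP (gain i s) 0.
  apply: le_trans (Pr_ge0 p01 _ _); apply: mulr_le0_ge0; first exact: ltW.
  exact: Pr_ge0.
apply: le_trans (_ : gain i s * Pr p W (none c) <= _).
  by apply: ler_wpM2l => //; apply: (Pr_mono p01) => X _; apply: none_filter.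
have indep : Pr p W (fun X => (A i \subset X) && none c X) = p ^+ #|A i| * Pr p W (none c).
  apply: Pr_sub => // X; apply: eq_in_all => j; rewrite mem_filter negbK => /andP[dij _].
  congr (~~ _); apply/idP/idP => [/subsetP sub|/subset_trans]; last by apply; apply: subsetUl.
  apply/subsetP => t tj; have := sub t tj; rewrite inE => /orP[//|ti].
  by have := disjointFr dij ti; rewrite tj.
rewrite mulrBl -indep lerBlDr.
apply: le_trans (_ : Pr p W (fun X => ((A i \subset X) && none s X) ||
    has (fun j => (A i :|: A j \subset X) && none c X) d) <= _).
  apply: (Pr_mono p01) => X _ /andP[Ai nc]; rewrite Ai /=.
  have [//|] := boolP (none s X); rewrite -has_predC => /hasP [j js /=]; rewrite negbK => Aj.
  apply/hasP; exists j; last by rewrite subUset Ai Aj nc.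
  rewrite mem_filter js andbT; have [//|nm] := boolP (meets i j).
  by move/allP: nc => /(_ j); rewrite mem_filter nm js Aj => /(_ isT).
apply: le_trans (Pr_or p01 _ _ _) _; rewrite lerD2l.
apply: le_trans (Pr_has p01 _ _ _) _; rewrite /d big_filter mulr_suml.
apply: ler_sum => j _; apply: (Pr_sub_decreasing p01); first by rewrite subUset !AW.
exact: none_decreasing.
Qed.

(** The exponential enters through three properties, since [R] is any [realFieldType]; it becomes
    the exponential of the reals in [no_copy_prob_le]. *)
Variable ex : R -> R.
Hypothesis ex0 : ex 0 = 1.
Hypothesis exD : forall x y, ex (x + y) = ex x * ex y.
Hypothesis ex1 : forall x, 1 + x <= ex x.

Let ex_ge0 x : 0 <= ex x.
Proof. by rewrite [x]splitr exD -expr2 sqr_ge0. Qed.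

Let ex_mono x y : x <= y -> ex x <= ex y.
Proof.
move=> xy; have -> : y = x + (y - x) by rewrite addrC subrK.
rewrite exD ler_peMr //; apply: le_trans (ex1 _); rewrite lerDl subr_ge0.
exact: xy.
Qed.

Fixpoint total_gain s := if s is i :: s' then gain i s' + total_gain s' else 0.

Lemma janson_seq s : Pr p W (none s) <= ex (- total_gain s).
Proof.
elim: s => [|i s IH] /=; first by rewrite oppr0 ex0 (@eq_Pr _ _ _ _ _ xpredT) // Pr_true.
apply: le_trans (janson_step i s) _; rewrite [- (gain i s + _)]opprD exD.
apply: le_trans (ler_wpM2r (Pr_ge0 p01 _ _) (ex1 _)) _.
by apply: ler_wpM2l.
Qed.

Lemma total_gain_ge s : uniq s ->
  \sum_(i <- s) p ^+ #|A i| -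
  \sum_(i <- s) \sum_(j <- s | (j != i) && meets i j) p ^+ #|A i :|: A j| <= total_gain s.
Proof.
elim: s => [|i s IH] /=; first by rewrite !big_nil subrr.
case/andP => nis us; rewrite !big_cons /gain eqxx /=.
have le : \sum_(l <- s) \sum_(j <- s | (j != l) && meets l j) p ^+ #|A l :|: A j| <=
    \sum_(l <- s) \sum_(j <- i :: s | (j != l) && meets l j) p ^+ #|A l :|: A j|.
  apply: ler_sum => l _; rewrite big_cons; case: ifP => // _.
  by rewrite lerDr exprn_ge0.
have -> : \sum_(j <- s | (j != i) && meets i j) p ^+ #|A i :|: A j| =
    \sum_(j <- s | meets i j) p ^+ #|A i :|: A j|.
  rewrite big_seq_cond [RHS]big_seq_cond; apply: eq_bigl => j.
  case: (boolP (j \in s)) => //= js; have -> // : j != i.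
  by apply: contraNneq nis => <-.
move: (IH us) le; move: (\sum_(l <- s) p ^+ _) (\sum_(j <- s | meets i j) _).
move: (\sum_(l <- s) \sum_(j <- s | _) _) (\sum_(l <- s) \sum_(j <- i :: s | _) _) (p ^+ _) (total_gain s).
by move=> x1 x2 x3 x4 x5 x6; lra.
Qed.

(** Thinning by [th] scales the mean by [th] but the correlation by [th ^+ 2], which keeps the bound
    useful when the correlation exceeds the mean. *)
Lemma janson th : 0 <= th <= 1 ->
  Pr p W (fun X => [forall i, ~~ (A i \subset X)]) <=
  ex (- (th * (\sum_i p ^+ #|A i|) -
         th ^+ 2 * (\sum_i \sum_(j | (j != i) && meets i j) p ^+ #|A i :|: A j|))).
Proof.
move=> th01; pose cc i j := if meets i j then p ^+ #|A i :|: A j| else 0.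
have [J leJ] := sparse_subfamily (fun i => p ^+ #|A i|) cc th01.
apply: le_trans (_ : Pr p W (none (enum J)) <= _).
  by apply: (Pr_mono p01) => X _ /forallP h; apply/allP => i _.
apply: le_trans (janson_seq _) _; apply: ex_mono; rewrite lerN2.
apply: le_trans (total_gain_ge (enum_uniq _)); rewrite big_enum /=.
have eqc (Q : pred I) i : \sum_(j | Q j && (j != i)) cc i j =
   \sum_(j | Q j && ((j != i) && meets i j)) p ^+ #|A i :|: A j|.
  by rewrite /cc -big_mkcondr; apply: eq_bigl => j; rewrite andbA.
apply: le_trans (_ : th * (\sum_i p ^+ #|A i|) - th ^+ 2 * (\sum_i \sum_(j | j != i) cc i j) <= _).
  rewrite lerB // ler_wpM2l ?sqr_ge0 //; apply: ler_sum => i _.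
  by rewrite (eqc xpredT i).
apply: le_trans leJ _; rewrite lerB // big_enum /=; apply: ler_sum => i _.
by rewrite big_enum_cond (eqc (mem J) i).
Qed.

End Janson.

(** * Sets without a copy *)

Lemma ffact_ge m h : ((m - h) ^ h <= m ^_ h)%N.
Proof.
rewrite ffact_prod -[X in (_ ^ X)%N]card_ord -prod_nat_const; apply: leq_prod => i _.
by rewrite leq_sub2l // ltnW.
Qed.

Section Counting.
Variables (h n : nat) (EH : {set {set 'I_h}}).
Hypothesis sH : EH \subset pairs h.
Implicit Types (f g : {ffun 'I_h -> 'I_n}) (J : {set {set 'I_h}}) (V : {set 'I_h}).

Definition shared f g := [set e in EH | f @: e \in copy_edges EH g].

Lemma shared_sub f g : shared f g \subset EH.
Proof. by apply/subsetP => e; rewrite inE => /andP[]. Qed.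

Lemma simple_copy_edges f : injective f -> copy_edges EH f \subset pairs n.
Proof.
move=> fi; apply/subsetP => e' /imsetP [e eK ->].
by have := subsetP sH e eK; rewrite !inE card_imset.
Qed.

Lemma card_shared f g : injective f ->
  #|copy_edges EH f :&: copy_edges EH g| = #|shared f g|.
Proof.
move=> fi; rewrite -(card_imset (shared f g) (imset_inj fi)); apply: eq_card => e'.
rewrite in_setI; apply/andP/imsetP => [[/imsetP [e eH ->] eg]|[e]].
  by exists e; rewrite // inE eH.
by rewrite inE => /andP[eH eg] ->; rewrite imset_f.
Qed.

Lemma card_copy_union f g : injective f -> injective g ->
  (#|copy_edges EH f :|: copy_edges EH g| + #|shared f g| = 2 * #|EH|)%N.
Proof.
move=> fi gi; rewrite -(card_shared g fi) cardsUI.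
by rewrite !card_imset ?addnn ?mul2n //; apply: imset_inj.
Qed.

Lemma shared_image f g a : a \in cover (shared f g) -> exists b, f a = g b.
Proof.
case/bigcupP => e; rewrite inE => /andP[_ /imsetP [e2 _ eg]] ae.
have : f a \in f @: e by apply: imset_f.
by rewrite eg => /imsetP [b _ ->]; exists b.
Qed.

Variable R : realFieldType.

(** The map [pi] records which vertex of [g] coincides with a given vertex of [f]. Given [g] and
    [pi], the values of [f] on [V] are determined. *)
Lemma count_overlapping V :
  \sum_(f : {ffun 'I_h -> 'I_n}) \sum_(g : {ffun 'I_h -> 'I_n}) [forall a in V, exists b, f a == g b]%:R <=
  (h ^ h * n ^ h * n ^ (h - #|V|))%:R :> R.
Proof.
have pick_pi f g : [forall a in V, exists b, f a == g b]%:R <=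
    \sum_(pi : {ffun 'I_h -> 'I_h}) \prod_a ((a \in V) ==> (f a == g (pi a)))%:R :> R.
  case: (boolP [forall a in V, _]) => [/forall_inP ex|_]; last first.
    by apply: sumr_ge0 => pi _; apply: prodr_ge0.
  pose pi := [ffun a => odflt a [pick b | f a == g b]].
  rewrite (bigD1 pi) //= big1 => [|a _]; first by rewrite lerDl sumr_ge0 // => pi' _; apply: prodr_ge0.
  case: (boolP (a \in V)) => //= aV; rewrite ffunE; case: pickP => [b -> //|no].
  by have /existsP [b] := ex a aV; rewrite no.
apply: le_trans (_ : \sum_(f : {ffun 'I_h -> 'I_n}) \sum_(g : {ffun 'I_h -> 'I_n}) \sum_(pi : {ffun 'I_h -> 'I_h})
    \prod_a ((a \in V) ==> (f a == g (pi a)))%:R <= _).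
  by apply: ler_sum => f _; apply: ler_sum => g _; apply: pick_pi.
have one (u : 'I_h -> 'I_n) : \sum_(f : {ffun 'I_h -> 'I_n}) \prod_a ((a \in V) ==> (f a == u a))%:R = (n ^ (h - #|V|))%:R :> R.
  rewrite -(bigA_distr_bigA (fun a v => ((a \in V) ==> (v == u a))%:R)).
  rewrite (bigID (mem V)) /= big1 ?mul1r => [|a aV]; last first.
    rewrite (bigD1 (u a)) //= aV eqxx big1 ?addr0 // => v nv.
    by rewrite (negPf nv).
  rewrite (eq_bigr (fun=> n%:R)) => [|a /negPf ->]; last by rewrite sumr_const card_ord.
  rewrite prodr_const -natrX; congr (_ ^ _)%:R.
  rewrite (eq_card (B := [predC V])) //.
  have : (#|V| + #|[predC V]| = h)%N by rewrite cardC card_ord.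
  by move: #|V| #|[predC V]|; clear; lia.
rewrite exchange_big /=.
under eq_bigr => g _ do rewrite exchange_big /=.
under eq_bigr => g _.
  under eq_bigr => pi _ do rewrite one.
  over.
rewrite !sumr_const !card_ffun !card_ord -!mulrnA; rewrite ler_nat.
by apply: eq_leq; rewrite [RHS]mulnC mulnA.
Qed.

End Counting.

Section NoCopy.
Variables (h n : nat) (EH : {set {set 'I_h}}) (S : {set 'I_n}).
Hypothesis sH : EH \subset pairs h.
Hypothesis EH0 : EH != set0.
Variables (R : realFieldType) (p K a : R) (ex : R -> R).
Hypothesis p01 : 0 <= p <= 1.
Hypothesis ex0 : ex 0 = 1.
Hypothesis exD : forall x y, ex (x + y) = ex x * ex y.
Hypothesis ex1 : forall x, 1 + x <= ex x.
Hypothesis K0 : 0 < K.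
Hypothesis dense : forall J : {set {set 'I_h}}, J \subset EH -> J != set0 ->
  K <= n%:R ^+ #|cover J| * p ^+ #|J|.
Hypothesis a01 : 0 < a <= 1.
Hypothesis largeS : a * n%:R ^+ h <= ((#|S| - h) ^ h)%:R.

Let p0 : 0 <= p. Proof. by case/andP: p01. Qed.
Let a0 : 0 < a. Proof. by case/andP: a01. Qed.

Let B : R := (2 ^ #|EH| * h ^ h)%:R.
Let M : R := n%:R ^+ h * p ^+ #|EH|.

Let n0 : (0 < n)%N.
Proof.
rewrite lt0n; apply/eqP => e; have := dense (subxx EH) EH0.
have /set0Pn [ee eE] := EH0.
have : (0 < #|cover EH|)%N.
  have := subsetP sH ee eE; rewrite inE => /eqP c2.
  have /card_gt0P [x xe] : (0 < #|ee|)%N by rewrite c2.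
  by apply/card_gt0P; exists x; apply/bigcupP; exists ee.
by rewrite e; case: #|cover EH| => // m _; rewrite expr0n mul0r leNgt K0.
Qed.

Let KM : K <= M.
Proof.
apply: le_trans (dense (subxx EH) EH0) _; apply: ler_wpM2r; first by rewrite exprn_ge0.
apply: ler_weXn2l; first by rewrite ler1n.
by apply: leq_trans (max_card _) _; rewrite card_ord.
Qed.

Let M0 : 0 < M. Proof. exact: lt_le_trans KM. Qed.

Let h0 : (0 < h)%N.
Proof.
have /set0Pn [e eE] := EH0; have := subsetP sH e eE; rewrite inE => /eqP c2.
by have := max_card (mem e); rewrite c2 card_ord; apply: leq_trans.
Qed.

Let B1 : 1 <= B.
Proof. by rewrite ler1n muln_gt0 !expn_gt0 h0. Qed.

(** Pairs are sorted by the set [J] of shared edges. With [J] fixed they contribute at most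
    [h^h M^2 / (n^|cover J| p^|J|)], and [dense] bounds that denominator below by [K]. *)
Lemma overlap_bound : \sum_(f : {ffun 'I_h -> 'I_n} | injectiveb f)
    \sum_(g : {ffun 'I_h -> 'I_n} | injectiveb g && (shared EH f g != set0))
      p ^+ #|copy_edges EH f :|: copy_edges EH g| <= B * M ^+ 2 / K.
Proof.
pose term (J : {set {set 'I_h}}) : R := p ^+ (2 * #|EH| - #|J|) * (h ^ h * n ^ h * n ^ (h - #|cover J|))%:R.
apply: le_trans (_ : \sum_(J in powerset EH | J != set0) term J <= _); last first.
  have le J : J \in powerset EH -> J != set0 -> term J <= (h ^ h)%:R * (M ^+ 2 / K).
    rewrite inE => sJ J0; rewrite mulrA ler_pdivlMr //.
    apply: le_trans (ler_wpM2l _ (dense sJ J0)) _.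
      by rewrite mulr_ge0 // exprn_ge0.
    have cJ : (#|J| <= 2 * #|EH|)%N.
      by apply: leq_trans (subset_leq_card sJ) _; rewrite mul2n -addnn leq_addr.
    have cV : (#|cover J| <= h)%N by apply: leq_trans (max_card _) _; rewrite card_ord.
    rewrite /term /M !natrM !natrX.
    have -> : p ^+ (2 * #|EH| - #|J|) * (h%:R ^+ h * n%:R ^+ h * n%:R ^+ (h - #|cover J|)) *
        (n%:R ^+ #|cover J| * p ^+ #|J|) =
        h%:R ^+ h * (n%:R ^+ h * (n%:R ^+ (h - #|cover J|) * n%:R ^+ #|cover J|) *
          (p ^+ (2 * #|EH| - #|J|) * p ^+ #|J|)) :> R.
      by move: (p ^+ _) (p ^+ _) (n%:R ^+ _) (n%:R ^+ _) (n%:R ^+ _) (h%:R ^+ _) => *; ring.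
    by rewrite -!exprD !subnK // exprMn -!exprM addnn -muln2 (mulnC 2).
  apply: le_trans (_ : \sum_(J in powerset EH | J != set0) (h ^ h)%:R * (M ^+ 2 / K) <= _).
    by apply: ler_sum => J /andP[]; apply: le.
  have c0 : 0 <= (h ^ h)%:R * (M ^+ 2 / K).
    by rewrite mulr_ge0 // divr_ge0 // ?exprn_ge0 // ltW.
  apply: le_trans (_ : \sum_(J in powerset EH) (h ^ h)%:R * (M ^+ 2 / K) <= _).
    rewrite [X in _ <= X](bigID (fun J : {set {set 'I_h}} => J != set0)) /= lerDl.
    by apply: sumr_ge0.
  by rewrite sumr_const card_powerset -[_ *+ (2 ^ _)]mulr_natl !mulrA -natrM.
apply: le_trans (_ : \sum_(f : {ffun 'I_h -> 'I_n}) \sum_(g : {ffun 'I_h -> 'I_n})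
    \sum_(J in powerset EH | J != set0) p ^+ (2 * #|EH| - #|J|) *
      [forall a in cover J, exists b, f a == g b]%:R <= _).
  have nn (f g : {ffun 'I_h -> 'I_n}) (J : {set {set 'I_h}}) : 0 <= p ^+ (2 * #|EH| - #|J|) *
      [forall a in cover J, exists b, f a == g b]%:R by rewrite mulr_ge0 // exprn_ge0.
  rewrite [X in _ <= X](bigID (fun f : {ffun 'I_h -> 'I_n} => injectiveb f)) /=.
  apply: le_trans (_ : _ + 0 <= _); first by rewrite addr0; exact: lexx.
  apply: lerD; last by apply: sumr_ge0 => f _; apply: sumr_ge0 => g _; apply: sumr_ge0.
  apply: ler_sum => f /injectiveP fi.
  rewrite [X in _ <= X](bigID (fun g : {ffun 'I_h -> 'I_n} =>
     injectiveb g && (shared EH f g != set0))) /=.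
  apply: le_trans (_ : _ + 0 <= _); first by rewrite addr0; exact: lexx.
  apply: lerD; last by apply: sumr_ge0 => g _; apply: sumr_ge0.
  apply: ler_sum => g /andP[/injectiveP gi sh0].
  rewrite (bigD1 (shared EH f g)) /=; last by rewrite inE shared_sub.
  have -> : [forall a in cover (shared EH f g), exists b, f a == g b].
    by apply/forall_inP => a0' /shared_image [b e]; apply/existsP; exists b; apply/eqP.
  rewrite mulr1; have -> : (2 * #|EH| - #|shared EH f g| = #|copy_edges EH f :|: copy_edges EH g|)%N.
    by rewrite -(card_copy_union EH fi gi) addnK.
  by rewrite lerDl; apply: sumr_ge0.
under eq_bigr => f _ do rewrite exchange_big /=.
rewrite exchange_big /=; apply: ler_sum => J _.
under eq_bigr => f _ do rewrite -mulr_sumr.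
rewrite -mulr_sumr; apply: ler_wpM2l; first by rewrite exprn_ge0.
exact: count_overlapping.
Qed.

Lemma no_copy_bound :
  Pr p (pairs n) (fun G => ~~ contains_copy EH G S) <= ex (- (a ^+ 2 * K / (4 * B))).
Proof.
pose Q := [set f : {ffun 'I_h -> 'I_n} in ffun_on (mem S) | injectiveb f].
have QP f : f \in Q -> injective f /\ forall x, f x \in S.
  by rewrite inE => /andP[/ffun_onP fS /injectiveP fi].
pose A (i : 'I_#|Q|) := copy_edges EH (enum_val i).
have inQ (i : 'I_#|Q|) : enum_val i \in Q := enum_valP i.
have AW i : A i \subset pairs n by apply: simple_copy_edges => //; case: (QP _ (inQ i)).
have cA i : #|A i| = #|EH|.
  by rewrite card_imset //; apply: imset_inj; case: (QP _ (inQ i)).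
have B0 : 0 < B := lt_le_trans ltr01 B1.
have aB : a / (2 * B) * (K / M) <= 1.
  have a1 : a <= 1 by case/andP: a01.
  rewrite -[X in _ <= X]mulr1; apply: ler_pM.
  - by apply: divr_ge0; apply: ltW; rewrite ?mulr_gt0.
  - by apply: divr_ge0; apply: ltW.
  - rewrite ler_pdivrMr ?mul1r; last by rewrite mulr_gt0.
    by apply: le_trans a1 (le_trans B1 _); apply: ler_peMl; [exact: ltW|rewrite ler1n].
  - by rewrite ler_pdivrMr // mul1r.
(* The maximiser of [th a M - th^2 B M^2 / K], with value [a^2 K / (4 B)]; it is at most 1 because
   [K <= M]. *)
pose th := a / (2 * B) * (K / M).
have th01 : 0 <= th <= 1.
  apply/andP; split; last exact: aB.
  by apply: mulr_ge0; apply: divr_ge0; apply: ltW => //; apply: mulr_gt0.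
apply: le_trans (_ : Pr p (pairs n) (fun X => [forall i, ~~ (A i \subset X)]) <= _).
  apply: (Pr_mono p01) => G _ nc; apply/forallP => i; apply: contra nc => AG.
  have [fi fS] := QP _ (inQ i); apply/existsP; exists (enum_val i); apply/and3P; split.
  - exact/injectiveP.
  - exact/forallP.
  - by apply/forall_inP => e eH; apply: (subsetP AG); apply: imset_f.
apply: le_trans (janson p01 AW ex0 exD ex1 th01) _.
have ex_mono x y : x <= y -> ex x <= ex y.
  move=> xy; have -> : y = x + (y - x) by rewrite addrC subrK.
  have exx : 0 <= ex x by rewrite [x]splitr exD -expr2 sqr_ge0.
  rewrite exD ler_peMr //; apply: le_trans (ex1 _); rewrite lerDl subr_ge0.
  exact: xy.
apply: ex_mono; rewrite lerN2.
have mu : a * M <= \sum_i p ^+ #|A i|.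
  under eq_bigr => i _ do rewrite cA.
  rewrite sumr_const card_ord -[_ *+ #|Q|]mulr_natl /M mulrA.
  apply: ler_wpM2r; first by rewrite exprn_ge0.
  apply: le_trans largeS _; rewrite ler_nat.
  have -> : #|Q| = (#|S| ^_ h)%N.
    rewrite /Q card_inj_ffuns_on card_ord; congr (_ ^_ _); exact: eq_card.
  exact: ffact_ge.
have delta : \sum_i \sum_(j | (j != i) && meets A i j) p ^+ #|A i :|: A j| <= B * M ^+ 2 / K.
  apply: le_trans overlap_bound.
  pose F (f g : {ffun 'I_h -> 'I_n}) := p ^+ #|copy_edges EH f :|: copy_edges EH g|.
  have F0 f g : 0 <= F f g by rewrite exprn_ge0.
  apply: le_trans (_ : \sum_(f in Q) \sum_(g in Q | shared EH f g != set0) F f g <= _).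
    rewrite [X in _ <= X]big_enum_val /=; apply: ler_sum => i _.
    rewrite [X in _ <= X]big_enum_val_cond /=.
    rewrite [X in _ <= X](bigID (fun j => (j != i) && meets A i j)) /=.
    apply: le_trans (_ : _ + 0 <= _); last first.
      by apply: lerD; [exact: lexx|apply: sumr_ge0].
    rewrite addr0 le_eqVlt; apply/orP; left; apply/eqP; apply: eq_bigl => j.
    case: (boolP (j != i)) => //= _; rewrite ?andbF //.
    case: (boolP (meets A i j)) => //= mij; rewrite ?andbF // andbT; apply/esym.
    have [fi _] := QP _ (inQ i); rewrite -card_gt0 -(card_shared _ _ fi) card_gt0 setI_eq0.
    exact: mij.
  have sub f : f \in Q -> injectiveb f by rewrite inE => /andP[].
  rewrite [X in _ <= X](bigID (mem Q)) /=.
  apply: le_trans (_ : _ + 0 <= _); last first.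
    apply: lerD; last by apply: sumr_ge0 => f _; apply: sumr_ge0 => g _; exact: (F0 f g).
    exact: lexx.
  rewrite addr0 [X in _ <= X](eq_bigl (mem Q)) /= => [|f]; last first.
    rewrite -[RHS]/(f \in Q); have [fQ|fQ] := boolP (f \in Q); rewrite ?andbF //.
    by rewrite andbT; apply: sub.
  apply: ler_sum => f fQ; rewrite [X in _ <= X](bigID (mem Q)) /=.
  rewrite [X in _ <= X + _](eq_bigl (fun g => (g \in Q) && (shared EH f g != set0))) => [|g].
    by rewrite lerDl; apply: sumr_ge0 => g _; exact: (F0 f g).
  have [gQ|gQ] := boolP (g \in Q); rewrite ?andbF ?andbT //=.
  by have -> : injectiveb g by apply: sub.
have th0 : 0 <= th by case/andP: th01.
apply: le_trans (_ : th * (a * M) - th ^+ 2 * (B * M ^+ 2 / K) <= _); last first.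
  by apply: lerB; apply: ler_wpM2l => //; apply: exprn_ge0.
rewrite le_eqVlt; apply/orP; left; apply/eqP; rewrite /th.
have Mn0 : M != 0 by rewrite gt_eqF.
have Bn0 : B != 0 by rewrite gt_eqF.
have Kn0 : K != 0 by rewrite gt_eqF.
move: a M B K Mn0 Bn0 Kn0 => a' M' B' K' Mn0 Bn0 Kn0.
by field; rewrite Mn0 Bn0 Kn0.
Qed.

End NoCopy.

End RandomGraphs.

(** * The threshold *)

Lemma prob_gnpE n (p : R) (F : {set {set 'I_n}} -> bool) :
  prob_gnp p F = Pr p (pairs n) F.
Proof.
rewrite /prob_gnp /Pr -[foldr _ _ _]/(foldr +%R 0%R _) foldrE big_map big_enum /=.
rewrite [RHS]big_mkcondr /=; apply: eq_big => [E|E _]; first by rewrite !inE.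
by case: (F E); rewrite // /weight !RpowE.
Qed.

Lemma density_le_max h (EH : {set {set 'I_h}}) (V : {set 'I_h}) (E : {set {set 'I_h}}) :
  is_subgraph EH V E -> (1 < #|V|)%N -> Rle (one_density V E) (max_one_density EH).
Proof.
move=> sub V2; rewrite /max_one_density.
have le (s : seq R) x : x \in s -> Rle x (foldr Rmax R0 s).
  elim: s => //= y s IH; rewrite inE => /predU1P[->|/IH le]; first exact: Rmax_l.
  exact: Rle_trans le (Rmax_r _ _).
apply: le; apply/mapP; exists (V, E) => //; rewrite mem_enum inE /=.
by rewrite sub.
Qed.

Section PairingStrategy.
Variables (k b b' h : nat) (EK : {set {set 'I_k}}) (EH : {set {set 'I_h}}).
Variable phi : {ffun 'I_k -> 'I_h}.
Hypotheses (phi_inj : injective phi) (phiE : copy_edges EK phi \subset EH).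
Hypothesis b'b : (b' <= b)%N.

(** A copy of [H] on a [P]-independent set would contain, through [phi], a copy of the clique or
    cycle that [P] misses. *)
Lemma pairable_breaker_wins n (G : {set {set 'I_n}}) maker_first :
  pairable b' (copy_set EK (n := n)) G -> ~~ makers_win EH G b maker_first.
Proof.
move=> [P [sP iP dP hP]]; apply: (breaker_wins sP iP) => [v|M iM].
  exact: leq_trans (dP v) b'b.
apply/existsPn => f; apply/negP => /and3P[/injectiveP fi /forallP fM /forall_inP fE].
pose g := [ffun i => f (phi i)].
have gi : injective g by move=> i j; rewrite !ffunE => /fi /phi_inj.
have gE : copy_edges EK g \subset G.
  apply/subsetP => e' /imsetP [e eK ->].
  have -> : g @: e = f @: (phi @: e).
    by rewrite -imset_comp; apply: eq_imset => i; rewrite ffunE.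
  by apply/fE/(subsetP phiE)/imset_f.
have /hitsP [u [v [uS vS Puv]]] : hits P (g @: setT).
  by apply: hP; apply/existsP; exists g; rewrite eqxx andbT; apply/embedsP.
have inM w : w \in g @: setT -> w \in M by case/imsetP => i _ ->; rewrite ffunE.
by have /forall_inP /(_ u (inM u uS)) /forall_inP /(_ v (inM v vS)) := iM; rewrite Puv.
Qed.

Hypothesis bal : balanced EK.
Hypothesis dense : forall n (E : {set {set 'I_n}}), E \subset pairs n ->
  critical b' (copy_set EK (n := n)) E -> (#|EK| * #|cover E| < k.-1 * #|E|)%N.

Lemma maker_win_dense n (G : {set {set 'I_n}}) maker_first : G \subset pairs n ->
  makers_win EH G b maker_first -> exists E : {set {set 'I_n}},
     [/\ E \subset G, connected_copies EK E, (#|EK| * #|cover E| < k.-1 * #|E|)%N &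
        exists f, embeds EK E f].
Proof.
move=> sG win.
have np : ~ pairable b' (copy_set EK (n := n)) G.
  by move=> /(pairable_breaker_wins maker_first); rewrite win.
have [E sE cr] := exists_critical np.
have sE2 := subset_trans sE sG.
exists E; split=> //.
- exact: (critical_connected bal sE2 cr).
- exact: dense.
have [S /existsP [f /andP[fE _]]] := critical_exists cr.
by exists f.
Qed.

End PairingStrategy.

(** * Elementary limits and growth of logarithms *)

Section RealLimits.
Local Open Scope R_scope.

Lemma nat_above (x : R) : exists N : nat, forall n, (N <= n)%N -> x < INR n.
Proof.
have [N xN] := INR_unbounded x; exists N => n /leP Nn.
exact: Rlt_le_trans xN (le_INR _ _ Nn).
Qed.

Lemma Rpower_cv0 (a s : R) : 0 < s ->
  forall eps, 0 < eps -> exists N : nat, forall n, (N <= n)%N -> a * Rpower (INR n) (- s) < eps.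
Proof.
move=> s0 eps eps0; pose a' := Rabs a + 1.
have a0 : 0 < a' by have := Rabs_pos a; rewrite /a'; lra.
have [N Nle] := nat_above (exp (- ln (eps / a') / s)); exists N => n /Nle lt.
have e0 : 0 < eps / a' by exact: Rdiv_lt_0_compat.
have lt' : Rpower (INR n) (- s) < eps / a'.
  rewrite -(exp_ln (eps / a')) // /Rpower; apply: exp_increasing.
  have /(ln_increasing _ _ (exp_pos _)) := lt; rewrite ln_exp => /(Rmult_lt_compat_l s _ _ s0).
  have -> : s * (- ln (eps / a') / s) = - ln (eps / a') by field; lra.
  lra.
have rp : 0 < Rpower (INR n) (- s) by exact: exp_pos.
have aa : a <= a' by have := Rle_abs a; rewrite /a'; lra.
apply: Rle_lt_trans (Rmult_le_compat_r _ _ _ (Rlt_le _ _ rp) aa) _.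
have -> : eps = a' * (eps / a') by field; lra.
exact: Rmult_lt_compat_l.
Qed.

Lemma ln_le (x y : R) : 0 < x -> x <= y -> ln x <= ln y.
Proof. by move=> x0 [lt|->]; [left; apply: ln_increasing|right]. Qed.

(** Since [ln 2 > 1/2], the binary logarithm is at most [2 ln n], and [1 + y <= exp y] at
    [y = t ln n] bounds this by a power. *)
Lemma trunc_log_le_Rpower (t : R) n : 0 < t -> (0 < n)%N ->
  INR (2 * (trunc_log 2 n).+1 + 2) <= (4 / t + 4) * Rpower (INR n) t.
Proof.
move=> t0 n0; set l := trunc_log 2 n.
have n1R : 1 <= INR n by apply: (le_INR 1); apply/leP.
have l2 : INR l <= 2 * ln (INR n).
  have : 2 ^ l <= INR n.
    have /leP/le_INR := trunc_logP (isT : 1 < 2)%N n0.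
    by rewrite !INRE GRing.natrX RpowE -!INRE.
  have p2 : 0 < 2 ^ l by apply: pow_lt; lra.
  move=> /(ln_le p2); rewrite ln_pow; last lra.
  have := ln_lt_2; have := pos_INR l; move: (INR l) (ln 2) (ln (INR n)) => *; nra.
have P1 : 1 <= Rpower (INR n) t.
  by rewrite -[X in X <= _](Rpower_O (INR n)); [apply: Rle_Rpower; lra|lra].
have Pt : t * ln (INR n) <= Rpower (INR n) t.
  by have := exp_ineq1_le (t * ln (INR n)); rewrite /Rpower; lra.
have Pt' : ln (INR n) <= / t * Rpower (INR n) t.
  apply: (Rmult_le_reg_l t) => //; rewrite -Rmult_assoc Rinv_r; lra.
have -> : INR (2 * l.+1 + 2) = 2 * INR l + 4.
  by rewrite plus_INR mult_INR (S_INR l) (_ : INR 2 = 2) //; lra.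
rewrite Rmult_plus_distr_r /Rdiv Rmult_assoc; lra.
Qed.

End RealLimits.

(** * Below the threshold: Breaker wins with high probability *)

Section ZeroStatement.
Local Open Scope R_scope.
Variables (k b b' h : nat) (EK : {set {set 'I_k}}) (EH : {set {set 'I_h}}).
Variable phi : {ffun 'I_k -> 'I_h}.
Hypotheses (phi_inj : injective phi) (phiE : copy_edges EK phi \subset EH).
Hypothesis b'b : (b' <= b)%N.
Hypothesis bal : balanced EK.
Hypothesis k2 : (1 < k)%N.
Hypothesis dense : forall n (E : {set {set 'I_n}}), E \subset pairs n ->
  critical b' (copy_set EK (n := n)) E -> (#|EK| * #|cover E| < k.-1 * #|E|)%N.

Let q := #|EK|.
Hypothesis q0 : (0 < q)%N.

(** This is [x / 4] for the largest [x] with [x 3^k <= 1/4], as [dense_union_bound] asks. *)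
Definition zero_const : R := / (4 * 3 ^ k) / 4.

Lemma makers_win_prob_le n L (p : R) maker_first : (0 < n)%N -> (n <= 2 ^ L)%N -> 0 <= p <= 1 ->
  p <= zero_const * Rpower (INR n) (- (INR k.-1 / INR q)) ->
  @prob_gnp n p (fun G => makers_win EH G b maker_first) <=
  Rpower (INR n) (- (1 / INR q)) * 2 ^ k * (4 * INR (2 * L + 2) ^ k) ^ (q + 1).
Proof.
move=> n0 nL [p0 p1] pc; rewrite prob_gnpE; apply/RleP.
have n0R : 0 < INR n by apply: lt_0_INR; apply/ltP.
have qR : 0 < INR q by apply: lt_0_INR; apply/ltP.
have kR : 0 < 3 ^ k by apply: pow_lt; lra.
set z := Rpower (INR n) (- (1 / INR q)).
have z0 : 0 < z by apply: exp_pos.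
have n1R : 1 <= INR n by apply: (le_INR 1); apply/leP.
have z1 : z <= 1.
  rewrite /z Rpower_Ropp -[X in _ <= X]Rinv_1; apply: Rinv_le_contravar; first lra.
  rewrite -[X in X <= _](Rpower_O (INR n)) //; apply: Rle_Rpower => //.
  by apply/Rlt_le/Rdiv_lt_0_compat => //; exact: Rlt_0_1.
have zq : z ^ q = / INR n.
  rewrite -Rpower_pow // Rpower_mult.
  have -> : - (1 / INR q) * INR q = - 1 by field; lra.
  by rewrite Rpower_Ropp Rpower_1.
have zk : z ^ k.-1 = Rpower (INR n) (- (INR k.-1 / INR q)).
  by rewrite -Rpower_pow // Rpower_mult; congr Rpower; field; lra.
have D1 : 1 <= 4 * INR (2 * L + 2) ^ k.
  have : 1 <= INR (2 * L + 2) ^ k.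
    by apply: pow_R1_Rle; apply: (le_INR 1); apply/leP; rewrite addn2.
  lra.
have E2 : (2%:R : R)%R = 2 by rewrite -INRE.
have E3 : (3%:R : R)%R = 3 by rewrite -INRE /=; lra.
have E4 : (4%:R : R)%R = 4 by rewrite -INRE /=; lra.
have x0 : 0 < / (4 * 3 ^ k) by apply: Rinv_0_lt_compat; lra.
(* Both choices make the corresponding quarter in the exploration bound an equality. *)
pose x := / (4 * 3 ^ k); pose D := 4 * INR (2 * L + 2) ^ k.
have := @dense_union_bound k EK bal k2 R n L p z _ _ _ nL x D.
rewrite -!RpowE E2 E3 E4 -!INRE -!RmultE => bound.
apply: bound; rewrite /x /D.
- by apply/andP; split; apply/RleP.
- by apply/andP; split; [apply/RltP|apply/RleP].
- by rewrite zq; apply: Rinv_r; lra.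
- exact/RltP.
- by apply/RleP; rewrite -RinvE; right; field; lra.
- exact/RleP.
- by apply/RleP; rewrite -!RinvE; right; field; lra.
- by apply/RleP; rewrite zk -RinvE; apply: pc.
by move=> G sG; apply: (maker_win_dense phi_inj phiE b'b).
Qed.

Lemma makers_win_prob_le_Rpower : exists A, forall n (p : R) maker_first, (0 < n)%N -> 0 <= p <= 1 ->
  p <= zero_const * Rpower (INR n) (- (INR k.-1 / INR q)) ->
  @prob_gnp n p (fun G => makers_win EH G b maker_first) <= A * Rpower (INR n) (- (/ (2 * INR q))).
Proof.
have qR : 0 < INR q by apply: lt_0_INR; apply/ltP.
have kR : 0 < INR k by apply: lt_0_INR; apply/ltP; apply: ltnW.
have q1R : 0 < INR (q + 1) by apply: lt_0_INR; apply/ltP; rewrite addn1.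
(* Chosen so that [t k (q + 1) = 1/(2q)]: the polylogarithmic factor then uses up only half of the
   gain [n^(-1/q)]. *)
pose t := / (2 * INR q * INR k * INR (q + 1)).
have t0 : 0 < t by apply: Rinv_0_lt_compat; do !apply: Rmult_lt_0_compat => //; lra.
pose a := 4 / t + 4.
exists (2 ^ k * (4 * a ^ k) ^ (q + 1)) => n p mf n0 p01 pc.
have n0R : 0 < INR n by apply: lt_0_INR; apply/ltP.
pose l := trunc_log 2 n.
have nL : (n <= 2 ^ l.+1)%N by apply/ltnW/trunc_log_ltn.
apply: Rle_trans (makers_win_prob_le mf n0 nL p01 pc) _.
have lea := trunc_log_le_Rpower t0 n0.
set y := INR _ in lea *; rewrite -/a in lea.
have P0 r : 0 < Rpower (INR n) r by exact: exp_pos.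
have y0 : 0 <= y by exact: pos_INR.
have le1 : (4 * y ^ k) ^ (q + 1) <= (4 * a ^ k) ^ (q + 1) * Rpower (INR n) (/ (2 * INR q)).
  have -> : Rpower (INR n) (/ (2 * INR q)) = (Rpower (INR n) t ^ k) ^ (q + 1).
    rewrite -pow_mult -Rpower_pow // Rpower_mult mult_INR; congr Rpower.
    by rewrite /t; field; lra.
  rewrite -Rpow_mult_distr; apply: pow_incr; split.
    by apply: Rmult_le_pos; [lra|exact: pow_le].
  rewrite Rmult_assoc -Rpow_mult_distr; apply: Rmult_le_compat_l; first lra.
  exact: pow_incr.
have -> : Rpower (INR n) (- (1 / INR q)) =
    Rpower (INR n) (- / (2 * INR q)) * Rpower (INR n) (- / (2 * INR q)).
  by rewrite -Rpower_plus; congr Rpower; field; lra.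
have PP : Rpower (INR n) (- / (2 * INR q)) * Rpower (INR n) (/ (2 * INR q)) = 1.
  by rewrite -Rpower_plus Rplus_opp_l Rpower_O.
move: le1 PP (P0 (- / (2 * INR q))) => le1 PP P1.
have k0 : 0 < 2 ^ k by apply: pow_lt; lra.
set u := Rpower _ _ in PP P1 *; set v := Rpower _ _ in le1 PP.
set Y := (_ ^ _) in le1 *; set Z := (_ ^ _) in le1 *; set c := 2 ^ k in k0 *.
apply: (@Rle_trans _ (u * u * c * (Z * v))).
  by apply: Rmult_le_compat_l => //; apply: Rlt_le; do !apply: Rmult_lt_0_compat.
have -> : u * u * c * (Z * v) = (u * v) * (c * Z * u) by ring.
by rewrite PP; lra.
Qed.

Lemma makers_win_cv0 (p : nat -> R) maker_first : (forall n, 0 <= p n <= 1) ->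
  (exists N : nat, forall n, (N <= n)%N ->
     p n <= zero_const * Rpower (INR n) (- (INR k.-1 / INR q))) ->
  Un_cv (fun n => @prob_gnp n (p n) (fun G => makers_win EH G b maker_first)) 0.
Proof.
move=> p01 [N1 pc] eps eps0.
have [A leA] := makers_win_prob_le_Rpower.
have s0 : 0 < / (2 * INR q).
  by apply: Rinv_0_lt_compat; apply: Rmult_lt_0_compat; [lra|apply: lt_0_INR; apply/ltP].
have [N2 lt] := Rpower_cv0 A s0 eps0.
exists (maxn 1 (maxn N1 N2)) => n /leP; rewrite !geq_max => /and3P[n0 n1 n2].
have := leA n (p n) maker_first n0 (p01 n) (pc n n1).
have := lt n n2.
have : 0 <= @prob_gnp n (p n) (fun G => makers_win EH G b maker_first).
  rewrite prob_gnpE; apply/RleP/Pr_ge0; have [p0 p1] := p01 n.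
  by apply/andP; split; apply/RleP.
by rewrite /Rdist Rminus_0_r => ge0 ltA leP; rewrite Rabs_right; lra.
Qed.

End ZeroStatement.

(** * Above the threshold: Maker wins with high probability *)

Section OneStatement.
Local Open Scope R_scope.
Variables (b h : nat) (EH : {set {set 'I_h}}).
Hypotheses (sH : EH \subset pairs h) (EH0 : EH != set0) (b0 : (0 < b)%N).
Local Notation m := (max_one_density EH).
Hypothesis m0 : 0 < m.

(** For large [n], a set [S] of the size Maker obtains has [|S| - h >= n / (4 (b + 1))]. *)
Definition set_const : R := (/ (4 * INR b.+1)) ^ h.
Definition copy_const : R := INR (2 ^ #|EH| * h ^ h).
(** With [K = C n] in [no_copy_bound], [C >= 8 B / a^2] makes the exponent [a^2 K / (4 B)] at least
    [2 n]. *)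
Definition one_const : R := Rmax 1 (8 * copy_const / set_const ^ 2).

(** Maximality of [m] gives [j / m <= v - 1] for a part with [v] vertices and [j] edges, so
    [n^v n^(-j/m) >= n]; the constant survives because [C^j >= C]. *)
Lemma expected_copies_ge C n (p : R) (J : {set {set 'I_h}}) : 1 <= C -> (0 < n)%N ->
  C * Rpower (INR n) (- / m) <= p -> J \subset EH -> J != set0 ->
  C * INR n <= INR n ^ #|cover J| * p ^ #|J|.
Proof.
move=> C1 n0 pC sJ J0.
have n1R : 1 <= INR n by apply: (le_INR 1); apply/leP.
have v2 : (1 < #|cover J|)%N.
  have /set0Pn [e eJ] := J0; have /eqP <- : #|e| == 2%N.
    by have := subsetP (subset_trans sJ sH) _ eJ; rewrite inE.
  by apply/subset_leq_card/(bigcup_sup e).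
have j0 : (0 < #|J|)%N by rewrite card_gt0.
have dens : INR #|J| / INR (#|cover J| - 1) <= m.
  apply: (@density_le_max _ EH (cover J) J) => //; rewrite /is_subgraph sJ /=.
  by apply/forall_inP => e eJ; apply: (bigcup_sup e).
have [v ev] : exists v, #|cover J| = v.+2 by case: #|cover J| v2 => [|[|v]] // _; exists v.
have [j ej] : exists j, #|J| = j.+1 by case: #|J| j0 => [|j] // _; exists j.
rewrite ev ej subn1 [v.+2.-1]/= in dens *.
have v0 : 0 < INR v.+1 by apply: lt_0_INR; apply/ltP.
have jm : INR j.+1 / m <= INR v.+1.
  apply: (Rmult_le_reg_r m) => //.
  have -> : INR j.+1 / m * m = INR j.+1 / INR v.+1 * INR v.+1 by field; lra.
  by rewrite Rmult_comm; apply: Rmult_le_compat_l => //; lra.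
have P0 r : 0 < Rpower (INR n) r by exact: exp_pos.
have pj : C * Rpower (INR n) (- INR v.+1) <= p ^ j.+1.
  apply: (@Rle_trans _ ((C * Rpower (INR n) (- / m)) ^ j.+1)); last first.
    by apply: pow_incr; split=> //; apply: Rmult_le_pos; [lra|exact: Rlt_le].
  rewrite Rpow_mult_distr; apply: Rmult_le_compat; [lra|exact: Rlt_le| |].
    rewrite -[X in X <= _]pow_1; apply: Rle_pow => //; apply/leP; exact: ltn0Sn.
  rewrite -Rpower_pow // Rpower_mult; apply: Rle_Rpower => //.
  move: jm; rewrite /Rdiv; lra.
apply: (@Rle_trans _ (INR n ^ v.+2 * (C * Rpower (INR n) (- INR v.+1)))); last first.
  by apply: Rmult_le_compat_l => //; apply: pow_le; lra.
right; rewrite Rpower_Ropp Rpower_pow; last lra.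
have : INR n ^ v.+1 <> 0 by apply: pow_nonzero; lra.
by rewrite -[INR n ^ v.+2]/(INR n * INR n ^ v.+1); move=> ?; field.
Qed.

Lemma set_const_bounds : 0 < set_const <= 1.
Proof.
have b1 : 1 <= INR b.+1 by apply: (le_INR 1); apply/leP.
have i0 : 0 < / (4 * INR b.+1) by apply: Rinv_0_lt_compat; lra.
split; first exact: pow_lt.
rewrite -(pow1 h); apply: pow_incr; split; first lra.
by rewrite -[X in _ <= X]Rinv_1; apply: Rinv_le_contravar; lra.
Qed.

Lemma large_set_ge n (S : {set 'I_n}) : (4 * b.+1 * h.+1 <= n)%N -> (n <= b.+1 * #|S| + b)%N ->
  set_const * INR n ^ h <= INR ((#|S| - h) ^ h).
Proof.
move=> nlarge nS; rewrite /set_const -Rpow_mult_distr [INR (_ ^ _)%N]INRE GRing.natrX -INRE -RpowE.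
have b1 : 1 <= INR b.+1 by apply: (le_INR 1); apply/leP.
have i0 : 0 < / (4 * INR b.+1) by apply: Rinv_0_lt_compat; lra.
apply: pow_incr; split; first by apply: Rmult_le_pos; [lra|exact: pos_INR].
have : (n <= 4 * b.+1 * (#|S| - h))%N.
  move: nlarge nS; move: #|S| => s; clear; nia.
move=> /leP/le_INR; rewrite !mult_INR (_ : INR 4 = 4); last by rewrite /=; lra.
move=> le; apply: (Rmult_le_reg_l (4 * INR b.+1)); first lra.
by rewrite -Rmult_assoc Rinv_r ?Rmult_1_l; lra.
Qed.

Lemma no_copy_prob_le n (p : R) (S : {set 'I_n}) : (4 * b.+1 * h.+1 <= n)%N -> 0 <= p <= 1 ->
  one_const * Rpower (INR n) (- / m) <= p -> (n <= b.+1 * #|S| + b)%N ->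
  Rle (Pr p (pairs n) (fun G => ~~ contains_copy EH G S)) (exp (- (2 * INR n))).
Proof.
move=> nlarge [p0 p1] pC nS.
have n0 : (0 < n)%N by apply: leq_trans nlarge.
have n0R : 0 < INR n by apply: lt_0_INR; apply/ltP.
have C1 : 1 <= one_const by exact: Rmax_l.
have [a0 a1] := set_const_bounds.
have E4 : (4%:R : R)%R = 4 by rewrite -INRE /=; lra.
have B0 : 0 < copy_const.
  apply: lt_0_INR; apply/ltP; rewrite muln_gt0 expn_gt0 /=.
  have /set0Pn [e /(subsetP sH)] := EH0; rewrite inE => /eqP e2.
  have /card_gt0P [x _] : (0 < #|e|)%N by rewrite e2.
  by rewrite expn_gt0 (leq_trans _ (ltn_ord x)).
have a2 : 0 < set_const ^ 2 by exact: pow_lt.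
pose K := one_const * INR n.
have := @no_copy_bound h n EH S sH EH0 R p K set_const exp.
rewrite E4 -!INRE -!RpowE => bound.
apply: (@Rle_trans _ (exp (- (set_const ^ 2 * K / (4 * copy_const))))).
  apply/RleP; apply: bound.
  - by apply/andP; split; apply/RleP.
  - exact: exp_0.
  - exact: exp_plus.
  - by move=> x; apply/RleP/exp_ineq1_le.
  - by apply/RltP/Rmult_lt_0_compat => //; lra.
  - by move=> J sJ J0; apply/RleP; rewrite -!RpowE -!RmultE; apply: expected_copies_ge.
  - by apply/andP; split; [apply/RltP|apply/RleP].
  by apply/RleP/large_set_ge.
have C2 : 8 * copy_const / set_const ^ 2 <= one_const by exact: Rmax_r.
have : 2 * INR n <= set_const ^ 2 * K / (4 * copy_const).
  have -> : 2 * INR n = set_const ^ 2 * (8 * copy_const / set_const ^ 2 * INR n) / (4 * copy_const).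
    by field; lra.
  apply: Rmult_le_compat_r; first by apply/Rlt_le/Rinv_0_lt_compat; lra.
  apply: Rmult_le_compat_l; first lra.
  by apply: Rmult_le_compat_r => //; lra.
by move=> [lt|->]; [left; apply: exp_increasing; lra|right].
Qed.

(** The union bound over sets costs [2^n <= exp n], half of the exponent available from
    [no_copy_prob_le]. *)
Lemma makers_win_prob_ge n (p : R) maker_first : (4 * b.+1 * h.+1 <= n)%N -> 0 <= p <= 1 ->
  one_const * Rpower (INR n) (- / m) <= p ->
  1 - exp (- INR n) <= @prob_gnp n p (fun G => makers_win EH G b maker_first).
Proof.
move=> nlarge p01 pC; rewrite prob_gnpE.
have p01' : (0 <= p <= 1)%R by case: p01 => ? ?; apply/andP; split; apply/RleP.
set W := fun G => _.
have lose : Rle (Pr p (pairs n) (fun G => ~~ W G)) (exp (- INR n)).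
  pose Q (S : {set 'I_n}) := (n <= b.+1 * #|S| + b)%N.
  apply: (@Rle_trans _ (Pr p (pairs n) (fun G => [exists S, Q S && ~~ contains_copy EH G S]))).
    apply/RleP/(Pr_mono p01') => G _; apply: contraR => /existsPn noS.
    apply: maker_wins_dense => // S QS.
    by have := noS S; rewrite /Q QS /= negbK.
  apply: (@Rle_trans _ (\sum_(S | Q S) exp (- (2 * INR n)))%R).
    apply/RleP; apply: Order.POrderTheory.le_trans (Pr_exists p01' _ _ _) _.
    by apply: Num.Theory.ler_sum => S QS; apply/RleP/no_copy_prob_le.
  rewrite big_const GRing.iter_addr_0 -GRing.mulr_natl -INRE -RmultE.
  have card_le : INR #|Q| <= 2 ^ n.
    have -> : 2 ^ n = INR (2 ^ n) by rewrite INRE GRing.natrX RpowE -INRE.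
    apply: le_INR; apply/leP; apply: leq_trans (max_card _) _.
    by rewrite -cardsT -powersetT card_powerset cardsT card_ord.
  have pow2 : 2 ^ n <= exp (INR n).
    have -> : exp (INR n) = exp 1 ^ n.
      by rewrite -Rpower_pow; [rewrite /Rpower ln_exp Rmult_1_r|exact: exp_pos].
    by apply: pow_incr; have := exp_ineq1_le 1; lra.
  have -> : exp (- INR n) = exp (INR n) * exp (- (2 * INR n)).
    by rewrite -exp_plus; congr exp; lra.
  by apply: Rmult_le_compat_r; [apply/Rlt_le/exp_pos|exact: Rle_trans card_le pow2].
have : 1 = Pr p (pairs n) W + Pr p (pairs n) (fun G => ~~ W G).
  by rewrite -[LHS](Pr_true p (pairs n)) (Pr_split p (pairs n) xpredT W).
lra.
Qed.

Lemma makers_win_cv1 (p : nat -> R) maker_first : (forall n, 0 <= p n <= 1) ->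
  (exists N : nat, forall n, (N <= n)%N -> p n >= one_const * Rpower (INR n) (- / m)) ->
  Un_cv (fun n => @prob_gnp n (p n) (fun G => makers_win EH G b maker_first)) 1.
Proof.
move=> p01 [N1 pC] eps eps0.
have [N2 lt] := nat_above (- ln eps).
exists (maxn (4 * b.+1 * h.+1) (maxn N1 N2)) => n /leP; rewrite !geq_max => /and3P[n0 n1 n2].
have := makers_win_prob_ge maker_first n0 (p01 n) (Rge_le _ _ (pC n n1)).
have : exp (- INR n) < eps.
  by rewrite -[X in _ < X]exp_ln //; apply: exp_increasing; have := lt n n2; lra.
have : @prob_gnp n (p n) (fun G => makers_win EH G b maker_first) <= 1.
  rewrite prob_gnpE -[X in _ <= X](Pr_true (p n) (pairs n)); apply/RleP/Pr_mono => //.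
  by have [p0 p1] := p01 n; apply/andP; split; apply/RleP.
by rewrite /Rdist => le1 lte leP; rewrite Rabs_left1; lra.
Qed.

End OneStatement.

Delimit Scope R_scope with R.
Delimit Scope nat_scope with nat.

Theorem theorem1 (k b h : nat) (EH : {set {set 'I_h}}) (maker_first : bool) :
  (0 < k)%nat -> (0 < b)%nat ->
  ((4 <= k)%nat \/ (k = 3 /\ (2 <= b)%nat)) ->
  simple_graph EH ->
  (exists (V : {set 'I_h}) (E : {set {set 'I_h}}),
      is_subgraph EH V E /\ (1 < #|V|)%nat /\ one_density V E = max_one_density EH /\
      (is_Kk k V E \/ is_Ck k V E)) ->
  exists c C : R, (0 < c)%R /\ (0 < C)%R /\
    forall p : nat -> R, (forall n, 0 <= p n <= 1)%R ->
      ((exists N : nat, forall n : nat, (N <= n)%nat ->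
          (p n >= C * Rpower (INR n) (- / max_one_density EH))%R) ->
       Un_cv (fun n => @prob_gnp n (p n) (fun EG : {set {set 'I_n}} => makers_win EH EG b maker_first)) 1%R)
      /\
      ((exists N : nat, forall n : nat, (N <= n)%nat ->
          (p n <= c * Rpower (INR n) (- / max_one_density EH))%R) ->
       Un_cv (fun n => @prob_gnp n (p n) (fun EG : {set {set 'I_n}} => makers_win EH EG b maker_first)) 0%R).
Proof.
move=> k0 b0 kb sH [V [E [sub [V2 [dens iso]]]]].
have k3 : 2 < k by case: kb => [|[-> //]]; apply: ltn_trans.
have k1 : 1 < k by apply: ltnW.
have [EK [EKk bal q0 isoK]] : exists EK : {set {set 'I_k}},
    [/\ EK = clique_edges k \/ EK = cycle_edges k, balanced EK, 0 < #|EK| & iso_to EK V E].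
  case: iso => iso; [exists (clique_edges k)|exists (cycle_edges k)]; split; auto.
  - exact: clique_balanced.
  - by have := card_clique_edges k; case: #|_| => //; move: k3; clear; case: k => [|[|k']] //; lia.
  - exact: cycle_balanced.
  - by rewrite card_cycle_edges.
have /existsP [phi /and3P[/injectiveP phi_inj /eqP eV /eqP eE]] := isoK.
have phiE : copy_edges EK phi \subset EH by have /andP[] := sub; rewrite eE.
have cV : #|V| = k by rewrite eV card_imset // cardsT card_ord.
have cE : #|E| = #|EK| by rewrite eE card_imset //; apply: imset_inj.
have q0R : (0 < INR #|EK|)%R by apply: lt_0_INR; apply/ltP.
have k0R : (0 < INR k.-1)%R by apply: lt_0_INR; apply/ltP; rewrite -subn1 subn_gt0.
rewrite /one_density cV cE subn1 in dens.
have m0 : (0 < max_one_density EH)%R by rewrite -dens; apply: Rdiv_lt_0_compat.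
have EH0 : EH != set0.
  have /card_gt0P [e eK] := q0; apply/set0Pn; exists (phi @: e).
  by apply/(subsetP phiE)/imset_f.
(* The part of his bias that Breaker uses for the pairing; any further vertices he claims are
   padding. *)
pose b' := if k == 3 then 2 else 1.
have b'b : b' <= b by rewrite /b'; case: eqP kb => // -> [|[]].
have kb' : 3 < k \/ k = 3 /\ b' = 2.
  by rewrite /b'; case: kb => [|[-> _]]; [left|right].
have b'1 : 3 < k -> b' = 1 by rewrite /b' ltn_neqAle eq_sym => /andP[/negPf ->].
exists (zero_const k), (one_const b EH); split; [|split].
- by apply: Rdiv_lt_0_compat; [apply: Rinv_0_lt_compat; apply: Rmult_lt_0_compat; [lra|apply: pow_lt; lra]|lra].
- exact: Rlt_le_trans Rlt_0_1 (Rmax_l _ _).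
move=> p p01; split; first exact: makers_win_cv1.
(* Here [d_1(H') = m_1(H)] enters: the exponent of the subgraph is that of [H]. *)
have -> : (- / max_one_density EH = - (INR k.-1 / INR #|EK|))%R.
  by rewrite -dens; field; lra.
exact: (makers_win_cv0 phi_inj phiE b'b bal k1 (critical_dense kb' b'1 EKk) q0).
Qed.
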